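(* Let $h\in(0,\infty)$, $M>0$ and $\gamma_\alpha\in\mu(h,M)$. For integers $n\ge1$ let $A_n$ be the number determined by $\Lambda_\alpha(J_0(\lambda_n r))=A_n\,\lambda_n\,J_0(\lambda_n r)$. Assume $A_1\ne1+\alpha_2$. Then $h,\alpha_1,\alpha_2$ are reconstructed as follows: (i) $\alpha_2=\lim_{n\to\infty}A_n-1$. (ii) $h=\dfrac{1}{2\pi}\ln\left(\displaystyle\lim_{n\to\infty}\frac{A_n-1-\alpha_2}{A_{n+1}-1-\alpha_2}\right)$. (iii) $\alpha_1=\dfrac{2A+(A+2)\alpha_2}{2-A}$, where $$A=\lim_{n\to\infty}\frac{(A_n-1-\alpha_2)\,e^{2\lambda_nh}}{1+\alpha_2}.$$
   Context: Let $B=B(0,1)\subset\mathbb{R}^2$. For $\alpha=(\alpha_1,\alpha_2)$ define on $B\times(0,\infty)$ the conductivity $$\gamma_\alpha(z)=\begin{cases}1+\alpha_1 & \text{if } h\le z<\infty,\\ 1+\alpha_2 & \text{if } 0\le z<h,\end{cases}$$ where $z$ is the coordinate in $(0,\infty)$. $\mu(h,M)$ is the set of all such $\gamma_\alpha$ with $\alpha_1,\alpha_2\in[0,M]$. Function spaces. Let $J_0,J_1$ be the Bessel functions of order $0$ and $1$, and $0<\lambda_1<\lambda_2<\cdots$ the positive zeros of $J_0$. $L^2_{rad}(B)$ is the space of radial functions in $L^2(B)$ (functions of $r=\sqrt{x^2+y^2}$), and $L^2_{rad}(B\times(0,\infty))$ is the space of $L^2$ functions of $(r,z)$ only. For $f\in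 L^2_{rad}(B)$ put $$\hat f(n)=\frac{2\int_0^1 f(r)J_0(\lambda_n r)\,r\,dr}{J_1(\lambda_n)^2},\qquad n\ge1.$$ $H^{1/2}_{rad}(B)$ is the set of $f\in L^2_{rad}(B)$ with $\sum_{n\ge1}(1+\lambda_n^2)^{1/2}|\hat f(n)|^2J_1(\lambda_n)^2<\infty$, and $H^{-1/2}_{rad}(B)$ is its dual, whose elements are represented by series $\sum_n\hat f(n)J_0(\lambda_n r)$ with $\sum_{n\ge1}(1+\lambda_n^2)^{-1/2}|\hat f(n)|^2J_1(\lambda_n)^2<\infty$. $H^1_{rad}(B\times(0,\infty))$ is the set of $u\in L^2_{rad}(B\times(0,\infty))$ with $|\nabla u|\in L^2_{rad}(B\times(0,\infty))$. Dirichlet-to-Neumann map. For $f\in H^{1/2}_{rad}(B)$ let $u\in H^1_{rad}(B\times(0,\infty))$ be the unique weak solution of $\nabla\cdot(\gamma_\alpha\nabla u)=0$ in $B\times(0,\infty)$, $u=0$ on $\partial B\times(0,\infty)$, $u=f$ on $B\times\{0\}$. Then $\Lambda_\alpha:H^{1/2}_{rad}(B)\to H^{-1/2}_{rad}(B)$ is $\Lambda_\alpha f=\gamma_\alpha\partial_\nu u|_{z=0}=-(1+\alpha_2)\,\partial_z u|_{z=0}$, where $\nu$ is the exterior unit normal; that is, if $u=\sum_{n\ge1}u_n(z)J_0(\lambda_n r)$, then $\Lambda_\alpha f=-(1+\alpha_2)\sum_{n\ge1}u_n'(0)J_0(\lambda_n r)$. Each $J_0(\lambda_n r)$ is an eigenfunction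 of $\Lambda_\alpha$, so $A_n=\Lambda_\alpha(J_0(\lambda_n r))/(\lambda_nJ_0(\lambda_n r))$ is a well-defined number. *)

(* Defs.v *)
From HB Require Import structures.
From mathcomp Require Import all_boot all_order all_algebra.
From mathcomp Require Import all_classical all_reals all_analysis.

Set Implicit Arguments.
Unset Strict Implicit.
Unset Printing Implicit Defensive.

Import Order.TTheory GRing.Theory Num.Theory.
Import numFieldNormedType.Exports.

Local Open Scope classical_set_scope.
Local Open Scope ring_scope.

Definition besselJ (R : realType) (m : nat) (x : R) : R :=
  limn (series (fun k : nat =>
    (-1) ^+ k / (k`! * (k + m)`!)%:R * (x / 2) ^+ (2 * k + m))).

(* Sequences are indexed from 0: [lambda n] is the (n+1)-st positive zero. *)
Definition positive_zeros_J0 (R : realType) (lambda : nat -> R) : Prop :=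
  {homo lambda : m n / (m < n)%N >-> m < n} /\
  range lambda = [set x : R | 0 < x /\ besselJ 0 x = 0].

Notation leb1 R := (@lebesgue_measure R).

Notation leb2 R := (leb1 R \x leb1 R)%E.

Notation leb3 R := ((leb1 R \x leb1 R) \x leb1 R)%E.

Definition disk (R : realType) : set (R * R) :=
  [set p | p.1 ^+ 2 + p.2 ^+ 2 < 1].

Definition cylinder (R : realType) : set (R * R * R) :=
  [set p | disk p.1 /\ 0 < p.2].

Definition radius (R : realType) (p : R * R) : R :=
  Num.sqrt (p.1 ^+ 2 + p.2 ^+ 2).

(* A radial function is given by its profile in r, resp. in (r, z). *)
Definition radial2 (R : realType) (f : R -> R) (p : R * R) : R :=
  f (radius p).

Definition radial3 (R : realType) (v : R -> R -> R) (p : R * R * R) : R :=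
  v (radius p.1) p.2.

Definition basis3 (R : realType) (i : 'I_3) : R * R * R :=
  ((i == 0%N :> nat)%:R, (i == 1%N :> nat)%:R, (i == 2%N :> nat)%:R).

Definition square_integrable (d : measure_display) (T : measurableType d)
    (R : realType) (mu : set T -> \bar R) (D : set T) (f : T -> R) : Prop :=
  measurable_fun D f /\ (\int[mu]_(x in D) ((f x) ^+ 2)%:E < +oo)%E.

Definition L2rad_disk (R : realType) (f : R -> R) : Prop :=
  square_integrable (leb2 R) (@disk R) (radial2 f).

Definition bessel_coef (R : realType) (lambda : nat -> R) (f : R -> R)
    (n : nat) : R :=
  2 * (\int[leb1 R]_(r in `]0, 1[) (f r * besselJ 0 (lambda n * r) * r)) /
  besselJ 1 (lambda n) ^+ 2.

(* The series defining the norm of order s of the coefficient sequence c. *)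
Definition bessel_summable (R : realType) (lambda : nat -> R) (s : R)
    (c : nat -> R) : Prop :=
  (\sum_(0 <= n <oo)
     ((1 + lambda n ^+ 2) `^ s * c n ^+ 2 * besselJ 1 (lambda n) ^+ 2)%:E
   < +oo)%E.

Definition H12rad (R : realType) (lambda : nat -> R) (f : R -> R) : Prop :=
  L2rad_disk f /\ bessel_summable lambda 2^-1 (bessel_coef lambda f).

(* An element of H^{-1/2} is represented by its coefficient sequence. *)
Definition Hm12rad (R : realType) (lambda : nat -> R) (c : nat -> R) : Prop :=
  bessel_summable lambda (- 2^-1) c.

(* Test functions: C^1, with compact support contained in U. *)
Definition test_function (R : realType) (U : set (R * R * R))
    (phi : R * R * R -> R) : Prop :=
  [/\ continuous phi,
      forall i : 'I_3,
        (forall p, derivable phi p (basis3 R i)) /\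
        continuous (fun p => 'D_(basis3 R i) phi p) &
      exists K : set (R * R * R),
        [/\ compact K, K `<=` U & forall p, ~ K p -> phi p = 0]].

Definition weak_gradient (R : realType) (u : R * R * R -> R)
    (g : 'I_3 -> R * R * R -> R) : Prop :=
  forall (i : 'I_3) (phi : R * R * R -> R), test_function (@cylinder R) phi ->
    \int[leb3 R]_(p in @cylinder R) (u p * 'D_(basis3 R i) phi p) =
    - \int[leb3 R]_(p in @cylinder R) (g i p * phi p).

(* v is (the profile of) an element of H^1_rad with weak gradient g. *)
Definition H1rad (R : realType) (v : R -> R -> R)
    (g : 'I_3 -> R * R * R -> R) : Prop :=
  [/\ square_integrable (leb3 R) (@cylinder R) (radial3 v),
      weak_gradient (radial3 v) g &
      forall i, square_integrable (leb3 R) (@cylinder R) (g i)].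

(* The trace of u on the boundary of the cylinder is 0 on the lateral part and
   f on the bottom.  The trace T u is identified by the Gauss-Green formula
     int_Omega (u d_i phi + d_i u phi) = int_{bd Omega} (T u) phi nu_i
   for phi in C^1_c(R^3), with nu = (0, 0, -1) on the bottom. *)
Definition dirichlet_data (R : realType) (u : R * R * R -> R)
    (g : 'I_3 -> R * R * R -> R) (f : R * R -> R) : Prop :=
  forall (i : 'I_3) (phi : R * R * R -> R), test_function setT phi ->
    \int[leb3 R]_(p in @cylinder R)
      (u p * 'D_(basis3 R i) phi p + g i p * phi p) =
    - (basis3 R i).2 * \int[leb2 R]_(q in @disk R) (f q * phi (q, 0)).

Definition conductivity (R : realType) (h a1 a2 : R) (z : R) : R :=
  if h <= z then 1 + a1 else 1 + a2.

Definition conductivity_class (R : realType) (h M : R) : set (R -> R) :=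
  [set gamma | exists a1 a2 : R,
     [/\ 0 <= a1 <= M, 0 <= a2 <= M & gamma = conductivity h a1 a2]].

(* v is the profile of a weak solution of div (gamma grad u) = 0 with u = 0 on
   the lateral boundary and u = f on the bottom. *)
Definition weak_solution (R : realType) (gamma : R -> R) (f : R -> R)
    (v : R -> R -> R) : Prop :=
  exists g : 'I_3 -> R * R * R -> R,
  [/\ H1rad v g,
      forall phi : R * R * R -> R, test_function (@cylinder R) phi ->
        \int[leb3 R]_(p in @cylinder R)
          (gamma p.2 * \sum_(i < 3) g i p * 'D_(basis3 R i) phi p) = 0 &
      dirichlet_data (radial3 v) g (radial2 f)].

(* d = c'(0), where c is defined up to null sets in (0,oo): the one-sided
   derivative is that of the representative continuous on [0,oo). *)
Definition derivative_at_bottom (R : realType) (c : R -> R) (d : R) : Prop :=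
  exists w : R -> R,
  [/\ {within `[0, +oo[, continuous w},
      {ae leb1 R, forall z, 0 < z -> w z = c z} &
      (w t - w 0) / t @[t --> 0^'+] --> d].

(* The graph of Lambda_alpha : H^{1/2} -> H^{-1/2}; the value Lambda_alpha f is
   given by its sequence c of Fourier-Bessel coefficients. *)
Definition DtN (R : realType) (lambda : nat -> R) (h a1 a2 : R)
    (f : R -> R) (c : nat -> R) : Prop :=
  [/\ H12rad lambda f, Hm12rad lambda c &
      exists v : R -> R -> R, weak_solution (conductivity h a1 a2) f v /\
        forall n, exists2 d : R,
          derivative_at_bottom (fun z => bessel_coef lambda (v^~ z) n) d &
          c n = - (1 + a2) * d].

(* Main.v *)
Require Import Defs.
From HB Require Import structures.
From mathcomp Require Import all_boot all_order all_algebra.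
From mathcomp Require Import all_classical all_reals all_analysis.
From mathcomp Require Import measurable_realfun.
From mathcomp Require Import ring lra.

Set Implicit Arguments.
Unset Strict Implicit.
Unset Printing Implicit Defensive.

Import Order.TTheory GRing.Theory Num.Theory.
Import numFieldNormedType.Exports.

Local Open Scope classical_set_scope.
Local Open Scope ring_scope.

(* Let Phi (q) = J_0 (lambda_n |q|).  Testing the weak equation against functions
   Phi (q) psi (z) shows that the coefficient U (z), the integral of u (., z) Phi over
   the disk, satisfies U'' = lambda_n^2 U off z = h, with U and gamma U' continuous
   across z = h.  As u and grad u are square integrable, the integral of |U| + |U'|
   over ]0, N] is O(N), which excludes the growing exponential above h.  Matching the
   exponentials at h gives
     A_n = (1 + alpha2) (1 - rho q_n) / (1 + rho q_n),
     q_n = exp (- 2 lambda_n h),  rho = (alpha2 - alpha1) / (2 + alpha1 + alpha2).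
   The three limits follow from lambda_n -> oo and lambda_(n+1) - lambda_n -> pi; the
   latter comes from Sturm comparison of sqrt x J_0 (x), a solution of
   y'' + (1 + 1 / (4 x^2)) y = 0, with sines.  Integration in polar coordinates
   identifies U with a constant multiple of the Fourier-Bessel coefficient of u. *)

(** * Bessel functions *)

(** The weak formulation admits only C^1 test functions of compact support, and J_0 (lambda_n |q|)
    psi (z) is not one. The Gauss-Green identity for the trace allows functions on all of R^3, so
    there the mode is cut off outside the disk. The divergence equation needs support inside the
    cylinder, so there the mode is cut off near the lateral wall; this is harmless because it
    vanishes on the wall. The relation U'' = lambda_n^2 U is assembled from three first-order
    identities, so that no second derivative of u appears: one ties U to its vertical derivative and
    trace, one is the divergence equation in z, and one, where the zero lateral trace enters, moves
    the horizontal gradient onto the mode. Regularity of U is derived: the identities hold almost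
    everywhere, and continuous representatives arise as primitives. Bessel functions are treated as
    entire functions of s = (x / 2)^2, which makes J_0 (lambda_n |q|) smooth in |q|^2, also on the
    axis. The assumption on A_1 says that rho is nonzero: for equal layers A_n is constant and h
    leaves no trace. *)

Definition bes_coef (R : realType) (m k : nat) : R :=
  (-1) ^+ k / (k`! * (k + m)`!)%:R.

(** The entire function with J_m (x) = (x / 2)^m bes m ((x / 2)^2). In this variable differentiation
    is simply bes m |-> - bes (m + 1). *)
Definition bes (R : realType) (m : nat) (s : R) : R :=
  limn (pseries (bes_coef R m) s).

Lemma is_cvg_bes (R : realType) (m : nat) (s : R) :
  cvgn (pseries (bes_coef R m) s).
Proof.
apply: normed_cvg.
apply: (@series_le_cvg _ _ (exp_coeff `|s|)).
- by move=> n; exact: normr_ge0.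
- by move=> n; exact: exp_coeff_ge0.
- move=> n; rewrite /bes_coef /exp_coeff /= !normrM normrX normrN1 expr1n mul1r.
  rewrite normrX mulrC ler_wpM2l ?exprn_ge0 // normfV ger0_norm // lef_pV2 ?posrE ?ltr0n ?muln_gt0 ?fact_gt0//.
  by rewrite ler_nat leq_pmulr ?fact_gt0.
- exact: is_cvg_series_exp_coeff.
Qed.

Lemma bes_coef_diffs (R : realType) (m : nat) :
  pseries_diffs (bes_coef R m) = (fun k => - bes_coef R m.+1 k).
Proof.
apply/funext => k; rewrite /pseries_diffs /bes_coef exprS mulN1r mulNr mulrN.
congr (- _); rewrite addSnnS factS -mulnA natrM invfM mulrA mulrCA mulrA.
by rewrite mulKf ?pnatr_eq0.
Qed.

Lemma pseriesN (R : realType) (c : nat -> R) (s : R) :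
  pseries (fun k => - c k) s = - pseries c s.
Proof.
apply/funext => n; rewrite /pseries /series /= fctE -sumrN.
by apply: eq_bigr => i _; rewrite mulNr.
Qed.

Lemma is_derive_bes (R : realType) (m : nat) (s : R) :
  is_derive s 1 (bes m) (- bes m.+1 s).
Proof.
have -> : - bes m.+1 s = limn (pseries (pseries_diffs (bes_coef R m)) s).
  by rewrite bes_coef_diffs pseriesN limN //; exact: is_cvg_bes.
apply: (@pseries_snd_diffs _ _ (`|s| + 1)).
- exact: is_cvg_bes.
- by rewrite bes_coef_diffs pseriesN is_cvgNE; exact: is_cvg_bes.
- have -> : pseries_diffs (pseries_diffs (bes_coef R m)) = bes_coef R m.+2.
    apply/funext => k; rewrite -[RHS]opprK.
    have /(congr1 (fun f => f k)) /= <- := bes_coef_diffs R m.+1.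
    by rewrite bes_coef_diffs /pseries_diffs mulrN.
  exact: is_cvg_bes.
- by rewrite (@ger0_norm _ (`|s| + 1)) ?ltrDl// addr_ge0.
Qed.

(** This is J_0 + J_2 = (2 / x) J_1. Since bes 1 and bes 2 are - F' and F'' for F = bes 0, it is
    also Bessel's equation s F'' + F' + F = 0, the only form in which that equation is used. *)
Lemma bes0_recurrence (R : realType) (s : R) :
  bes 0 s = bes 1 s - s * bes 2 s.
Proof.
rewrite {1}/bes; apply/cvg_lim => //.
(* Multiplication by s shifts the series of bes 2 by one index, whence the partial sum at [n.-1];
   for n = 0 every sum is empty. *)
have -> : pseries (bes_coef R 0) s = pseries (bes_coef R 1) s -
    (fun n => s * pseries (bes_coef R 2) s n.-1).
  apply/funext => -[|n]; rewrite /pseries /series /= !fctE.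
    by rewrite !big_geq//= mulr0 subr0.
  rewrite big_nat_recl//= [X in _ = X - _]big_nat_recl//= mulr_sumr -addrA -sumrB.
  congr (_ + _).
  apply: eq_bigr => k _.
  rewrite /bes_coef !addnS !addn0 !factS !natrM !exprS.
  have k0 : k`!%:R != 0 :> R by rewrite pnatr_eq0 -lt0n fact_gt0.
  have k1 : k.+1%:R = k%:R + 1 :> R by rewrite -natr1.
  have k2 : k.+2%:R = k%:R + 2 :> R by rewrite -addn2 natrD.
  have h1 : k%:R + 1 != 0 :> R by rewrite -k1 pnatr_eq0.
  have h2 : k%:R + 2 != 0 :> R by rewrite -k2 pnatr_eq0.
  rewrite k1 k2; field.
  by rewrite h1 h2 k0.
apply: cvgB; first exact: is_cvg_bes.
apply: cvgMl_tmp.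
rewrite -(@cvg_shiftS _ _ _)/=.
exact: is_cvg_bes.
Qed.

Lemma bes0 (R : realType) (m : nat) : bes m (0 : R) = m`!%:R^-1.
Proof.
apply/cvg_lim => //.
rewrite -(@cvg_shiftS _ _ _)/=.
apply: cvg_near_cst; near=> n.
rewrite /pseries /series /= big_nat_recl//= big1 ?addr0.
  by rewrite /bes_coef fact0 mul1n add0n expr0 mulr1 mul1r.
by move=> i _; rewrite exprS mul0r mulr0.
Unshelve. all: end_near. Qed.

Lemma besselJE (R : realType) (m : nat) (x : R) :
  besselJ m x = (x / 2) ^+ m * bes m ((x / 2) ^+ 2).
Proof.
apply/cvg_lim => //.
have -> : series (fun k : nat =>
    (-1) ^+ k / (k`! * (k + m)`!)%:R * (x / 2) ^+ (2 * k + m)) =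
  (fun n => (x / 2) ^+ m * pseries (bes_coef R m) ((x / 2) ^+ 2) n).
  apply/funext => n; rewrite /pseries /series /= mulr_sumr.
  apply: eq_bigr => i _; rewrite /bes_coef exprD exprM; ring.
by apply: cvgMl_tmp; exact: is_cvg_bes.
Qed.

(** A monotone quantity replaces uniqueness for the ODE, which is singular at 0. With s = (x / 2)^2,
    [E] is s (J_0^2 + J_1^2) and its derivative is J_0^2. A common zero at s0 would give E = 0 on
    all of [0, s0], although bes 0 equals 1 at 0. The lemma allows division by J_1 (lambda_n)^2. *)
Lemma besselJ_zero1 (R : realType) (x : R) : 0 < x ->
  besselJ 0 x = 0 -> besselJ 1 x != 0.
Proof.
move=> x0; rewrite !besselJE expr0 mul1r expr1 mulf_eq0 negb_or.
rewrite mulf_neq0 ?invr_neq0 ?pnatr_eq0 ?(gt_eqF x0)//=.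
set s0 := (x / 2) ^+ 2 => B0; apply/eqP => B1.
have s0_gt0 : 0 < s0 by rewrite exprn_gt0// divr_gt0.
pose E := fun s : R => s * (bes 0 s ^+ 2 + s * bes 1 s ^+ 2).
have dE (s : R) : is_derive s 1 E (bes 0 s ^+ 2).
  have h0 := is_derive_bes 0 s; have h1 := is_derive_bes 1 s.
  rewrite /E.
  apply: is_derive_eq.
  rewrite !scaler1 /GRing.scale/= /GRing.scale/=.
  have := bes0_recurrence s.
  set a := bes 0 s; set b := bes 1 s; set c := bes 2 s => ->. ring.
have E0 : E 0 = 0 by rewrite /E mul0r.
have Es0 : E s0 = 0 by rewrite /E B0 B1 !expr0n/= mulr0 addr0 mulr0.
have Ehomo : {in `[0, s0] &, {homo E : a b / a <= b}}.
  apply: ger0_derive1_le_cc.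
  - by move=> a _; apply: ex_derive.
  - move=> a _; rewrite derive1E derive_val. exact: sqr_ge0.
  - by apply: derivable_within_continuous => a _; exact: ex_derive.
have cB0 : bes 0 s @[s --> (0 : R)] --> (1 : R).
  have -> : (1 : R) = bes 0 0 by rewrite bes0 fact0 invr1.
  have /derivable1_diffP/differentiable_continuous := @ex_derive _ _ _ _ _ _ _ (is_derive_bes 0 (0 : R)).
 exact.
have : \forall s \near (0 : R)^'+, False.
  near=> s.
  have s_gt0 : 0 < s by [].
  have ss0 : s <= s0 by near: s; exact: nbhs_right_le.
  have B0s : 0 < bes 0 s.
    by near: s; exact: (cvgr_gt _ (cvg_at_right_filter cB0) _ ltr01).
  have Es : E s = 0.
    apply/eqP; rewrite eq_le -{1}Es0 -{1}E0.
    by rewrite !Ehomo// in_itv/= ?lexx ?(ltW s_gt0) ?(ltW s0_gt0)// ss0.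
  move/eqP: Es; rewrite mulf_eq0 (gt_eqF s_gt0)/= gt_eqF//.
  by rewrite ltr_wpDr ?exprn_gt0// mulr_ge0 ?sqr_ge0// ltW.
by case/filter_ex.
Unshelve. all: end_near. Qed.

(** * Gaps between the zeros of J0 *)

Lemma sqrt_besselJ0_ode (R : realType) : exists u du : R -> R,
  [/\ forall x : R, 0 < x -> is_derive x 1 u (du x),
      forall x : R, 0 < x -> is_derive x 1 du (- (1 + (4 * x ^+ 2)^-1) * u x) &
      forall x : R, 0 < x -> u x = 0 <-> besselJ 0 x = 0].
Proof.
pose j := fun x : R => bes 0 ((x / 2) ^+ 2).
pose j1 := fun x : R => x / 2 * bes 1 ((x / 2) ^+ 2).
have dj (x : R) : is_derive x 1 j (- j1 x).
  have h0 : is_derive ((x / 2) ^+ 2) 1 (@bes R 0) _ := is_derive_bes 0 _.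
  have h1 : is_derive x 1 (fun y : R => (y / 2) ^+ 2) (x / 2).
    apply: is_derive_eq; rewrite /GRing.scale/=; lra.
  have := @is_derive1_comp _ (@bes R 0) (fun y : R => (y / 2) ^+ 2) x _ _ h0 h1.
  by rewrite mulNr mulrC.
have dj1 (x : R) : x != 0 -> is_derive x 1 j1 (j x - j1 x / x).
  move=> x0.
  have h0 : is_derive ((x / 2) ^+ 2) 1 (@bes R 1) _ := is_derive_bes 1 _.
  have h1 : is_derive x 1 (fun y : R => (y / 2) ^+ 2) (x / 2).
    apply: is_derive_eq; rewrite /GRing.scale/=; lra.
  have h2 := @is_derive1_comp _ (@bes R 1) (fun y : R => (y / 2) ^+ 2) x _ _ h0 h1.
  rewrite /j1; apply: is_derive_eq; rewrite /j /GRing.scale/= bes0_recurrence.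
  rewrite /comp; set b1 := bes 1 _; set b2 := bes 2 _; by field.
(* Only these three properties of the square root are kept, so that the derivative identities become
   rational in [sq x]. *)
have [sq [sq2 sq_gt0 dsq]] : exists sq : R -> R, [/\ forall x : R, 0 < x -> sq x ^+ 2 = x,
    forall x, 0 < x -> 0 < sq x & forall x : R, 0 < x -> is_derive x 1 sq (2 * sq x)^-1].
  exists Num.sqrt; split=> x x0; [by rewrite sqr_sqrtr// ltW|by rewrite sqrtr_gt0|].
  exact: is_derive1_sqrt.
exists (fun x => sq x * j x).
exists (fun x => j x / (2 * sq x) - sq x * j1 x).
split.
- move=> x x0; have := dsq x x0; have := dj x.
  by move=> h h'; apply: is_derive_eq; rewrite /GRing.scale/=; ring.
- move=> x x0; have hs := dsq x x0; have h1 := dj x.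
  have h2 := dj1 x (lt0r_neq0 x0).
  have s0 : sq x != 0 by rewrite gt_eqF// sq_gt0.
  have ss := sq2 x x0.
  have h3 : is_derive x 1 (fun x : R => (2 * sq x)^-1) (- (2 * sq x) ^- 2 / sq x).
    apply: is_derive_eq; first by apply: is_deriveV; rewrite mulf_neq0.
    by rewrite /GRing.scale/=; field.
  apply: is_derive_eq; rewrite /GRing.scale/=.
  move: (j x) (j1 x) => J J1; move: (sq x) ss s0 => r rx r0.
  rewrite -rx; by field.
- move=> x x0; rewrite besselJE expr0 mul1r; split => [/eqP|E0].
    by rewrite mulf_eq0 gt_eqF ?sq_gt0//= => /eqP.
  by rewrite /j E0 mulr0.
Qed.

(** If b - a exceeded pi, the Wronskian would have to rise from 0 at a to - u (a + pi) < 0. *)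
Lemma sturm_upper (R : realType) (u du p : R -> R) (a b : R) :
  0 < a -> a < b ->
  (forall x : R, 0 < x -> is_derive x 1 u (du x)) ->
  (forall x : R, 0 < x -> is_derive x 1 du (- (1 + p x) * u x)) ->
  (forall x : R, 0 <= p x) ->
  u a = 0 -> (forall x, a < x < b -> 0 < u x) -> b - a <= pi.
Proof.
move=> a0 ab Du Ddu p0 ua upos; rewrite leNgt; apply/negP => piba.
have p0' := pi_gt0 R.
(* The Wronskian of u and sin (x - a) is monotone on [a, a + pi]. *)
pose W := fun x : R => u x * cos (x - a) - du x * sin (x - a).
have dW (x : R) : 0 < x -> is_derive x 1 W (p x * u x * sin (x - a)).
  move=> x0; have h1 := Du x x0; have h2 := Ddu x x0.
  apply: is_derive_eq; rewrite /GRing.scale/=; ring.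
have in0 (x : R) : x \in `[a, a + pi] -> 0 < x.
  by rewrite in_itv/= => /andP[+ _]; exact: lt_le_trans.
have : {in `[a, a + pi] &, {homo W : x y / x <= y}}.
  apply: ger0_derive1_le_cc.
  - by move=> x /subset_itv_oo_cc/in0/dW h; exact: ex_derive.
  - move=> x xab; have := dW x (in0 _ (subset_itv_oo_cc xab)) => h.
    rewrite derive1E derive_val.
    move: xab; rewrite in_itv/= => /andP[ax xa].
    rewrite mulr_ge0 ?mulr_ge0 ?p0//.
      by rewrite ltW// upos// ax; lra.
    by rewrite sin_ge0_pi//; lra.
  - by apply: derivable_within_continuous => x /in0/dW h; exact: ex_derive.
move=> /(_ a (a + pi)); rewrite !in_itv/= !lexx/= !lerDl (ltW p0') => /(_ erefl erefl erefl).
rewrite /W ua mul0r subrr sin0 mulr0 subrr addrAC subrr add0r cospi sinpi.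
rewrite mulr0 subr0 mulrN1 oppr_ge0 leNgt upos//; lra.
Qed.

(** Comparison with the faster sine of frequency k. If k (b - a) < pi, the Wronskian decreases
    strictly from 0 and equals - u' (b) sin (k (b - a)) at b, so u' (b) > 0. But u is positive to
    the left of its zero b, so its left difference quotients there are nonpositive. *)
Lemma sturm_lower (R : realType) (u du p : R -> R) (a b k : R) :
  0 < a -> a < b -> 0 < k ->
  (forall x : R, 0 < x -> is_derive x 1 u (du x)) ->
  (forall x : R, 0 < x -> is_derive x 1 du (- (1 + p x) * u x)) ->
  (forall x : R, a < x < b -> 1 + p x < k ^+ 2) ->
  u a = 0 -> u b = 0 -> (forall x, a < x < b -> 0 < u x) -> pi <= k * (b - a).
Proof.
move=> a0 ab k0 Du Ddu pk ua ub upos; rewrite leNgt; apply/negP => piba.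
pose W := fun x : R => k * u x * cos (k * (x - a)) - du x * sin (k * (x - a)).
have dW (x : R) : 0 < x ->
    is_derive x 1 W ((1 + p x - k ^+ 2) * u x * sin (k * (x - a))).
  move=> x0; have h1 := Du x x0; have h2 := Ddu x x0.
  have h3 : is_derive x 1 (fun x => k * (x - a)) k.
    by apply: is_derive_eq; rewrite /GRing.scale/=; ring.
  apply: is_derive_eq; rewrite /GRing.scale/=; ring.
have in0 (x : R) : x \in `[a, b] -> 0 < x.
  by rewrite in_itv/= => /andP[+ _]; exact: lt_le_trans.
have sin0' (x : R) : a < x <= b -> 0 < sin (k * (x - a)).
  move=> /andP[ax xb]; rewrite sin_gt0_pi// mulr_gt0 ?subr_gt0//=.
  by rewrite (le_lt_trans _ piba)// ler_pM2l// lerD2r.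
have : {in `[a, b] &, {homo W : x y /~ x < y}}.
  apply: ltr0_derive1_lt_cc.
  - by move=> x /subset_itv_oo_cc/in0/dW h; exact: ex_derive.
  - move=> x xab; have := dW x (in0 _ (subset_itv_oo_cc xab)) => h.
    rewrite derive1E derive_val.
    move: xab; rewrite in_itv/= => xab; case/andP: (xab) => ax xb.
    rewrite -mulrA nmulr_rlt0 ?subr_lt0 ?pk//.
    by rewrite mulr_gt0 ?upos// sin0'// ax ltW.
  - by apply: derivable_within_continuous => x /in0/dW h; exact: ex_derive.
move=> /(_ b a); rewrite !in_itv/= !lexx/= (ltW ab) => /(_ erefl erefl ab).
rewrite /W ua ub subrr !mulr0 !mul0r sin0 mulr0 subrr add0r oppr_lt0.
rewrite pmulr_lgt0 ?sin0' ?ab ?lexx// => dub.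
have b0 := lt_trans a0 ab.
have [du0 duE] := Du b b0.
suff : du b <= 0 by rewrite leNgt dub.
have : h^-1 *: (u (h *: 1 + b) - u b) @[h --> 0^'-] --> du b.
  rewrite -duE; apply: cvg_trans du0; apply: cvg_app.
  move=> A [e /= e0 Ae]; exists e => //= h he h0; apply: Ae => //.
  by rewrite lt_eqF.
move/cvgr_to_le; apply.
near=> h.
have h0 : h < 0 by [].
rewrite ub subr0 /GRing.scale/= mulr1 mulr_le0_ge0// ?invr_le0 ?ltW//.
apply: upos; rewrite -ltrBlDr gtrDr h0 andbT.
near: h; apply: nbhs_left_gt; lra.
Unshelve. all: end_near. Qed.

Lemma nonzero_sign (R : realType) (u : R -> R) (a b : R) : a < b ->
  {within `]a, b[, continuous u} ->
  (forall x, a < x < b -> u x != 0) ->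
  exists s : R, s ^+ 2 = 1 /\ forall x, a < x < b -> 0 < s * u x.
Proof.
move=> ab cu u0.
have same c d : a < c -> c <= d -> d < b -> 0 < u c * u d.
  move=> ac cd db; rewrite ltNge; apply/negP => ucd.
  have : {within `[c, d], continuous u}.
    apply: continuous_subspaceW cu => z /=; rewrite !in_itv/= => /andP[cz zd].
    by rewrite (lt_le_trans ac)// (le_lt_trans zd).
  move=> /(IVT cd)/(_ (_ : _ <= 0 <= _)) [|z].
    rewrite ge_min le_max.
    have [c0|c0|c0] := ltgtP (u c) 0.
    - by move: ucd; rewrite nmulr_rle0// => ->; rewrite orbT.
    - by move: ucd; rewrite pmulr_rle0// => ->; rewrite orbT.
    - by [].
  rewrite in_itv/= => /andP[cz zd] uz.
  have := u0 z; rewrite uz eqxx (lt_le_trans ac)// (le_lt_trans zd)// => /(_ isT).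
  by [].
pose m := (a + b) / 2.
have mab : a < m < b by rewrite /m; apply/andP; split; lra.
exists (Num.sg (u m)); split; first by rewrite sqr_sg u0.
move=> x /andP[ax xb].
rewrite -(pmulr_rgt0 _ (_ : 0 < `|u m|)) ?normr_gt0 ?u0// mulrA [`|_| * _]mulrC -numEsg.
have /andP[am mb] := mab.
by have [xm|/ltW mx] := leP x m; [rewrite mulrC|]; exact: same.
Qed.

(** Between two consecutive zeros the perturbation 1 / (4 x^2) is positive and below its value (2
    lambda n)^-2 at the left end; the comparison frequencies are therefore 1 and the square root of
    1 + (2 lambda n)^-2. *)
Lemma zeros_gap (R : realType) (lambda : nat -> R) (n : nat) :
  positive_zeros_J0 lambda ->
  0 < lambda n /\
  pi / Num.sqrt (1 + (2 * lambda n) ^- 2) <= lambda n.+1 - lambda n <= pi.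
Proof.
move=> [lhomo lrange].
have lz k : 0 < lambda k /\ besselJ 0 (lambda k) = 0.
  have : range lambda (lambda k) by exists k.
  by rewrite lrange.
have l0 k : 0 < lambda k by have [] := lz k.
split; first exact: l0.
set a := lambda n; set b := lambda n.+1.
have a0 : 0 < a := l0 n.
have ab : a < b by exact: lhomo.
have [u [du [Du Ddu u0]]] := sqrt_besselJ0_ode R.
(* A zero in between would be some [lambda k] with n < k < n + 1, as [lambda] increases strictly and
   lists all zeros. *)
have une0 x : a < x < b -> u x != 0.
  move=> /andP[ax xb]; apply/eqP => /u0 => /(_ (lt_trans a0 ax)) Jx.
  have : range lambda x by rewrite lrange/=; split => //; exact: lt_trans ax.
  case=> k _ lk; move: ax xb; rewrite -lk /a /b.
  have lmono : {mono lambda : m n / (m < n)%N >-> m < n}.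
    by apply: leW_mono; apply: le_mono.
  by rewrite !lmono ltnS => nk /(leq_trans nk); rewrite ltnn.
have ua : u a = 0 by apply/u0 => //; exact: (lz n).2.
have ub : u b = 0 by apply/u0; [exact: l0|exact: (lz n.+1).2].
have cu : {within `]a, b[, continuous u}.
  apply: derivable_within_continuous => x; rewrite in_itv/= => /andP[ax _].
  have h := Du x (lt_trans a0 ax); exact: ex_derive.
have [s [s2 spos]] := nonzero_sign ab cu une0.
have Dsu (x : R) : 0 < x -> is_derive x 1 (fun x => s * u x) (s * du x).
  by move=> x0; have h := Du x x0; apply: is_derive_eq; rewrite /GRing.scale/=; ring.
have Dsdu (x : R) : 0 < x -> is_derive x 1 (fun x => s * du x)
    (- (1 + (4 * x ^+ 2)^-1) * (s * u x)).
  by move=> x0; have h := Ddu x x0; apply: is_derive_eq; rewrite /GRing.scale/=; ring.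
apply/andP; split; last first.
  apply: (sturm_upper a0 ab Dsu Dsdu) spos.
    by move=> x; rewrite invr_ge0 mulr_ge0// sqr_ge0.
  by rewrite ua mulr0.
have k0 : 0 < 1 + (2 * a) ^- 2 by rewrite ltr_wpDr// invr_ge0 sqr_ge0.
rewrite ler_pdivrMr ?sqrtr_gt0// mulrC.
apply: (sturm_lower a0 ab _ Dsu Dsdu) spos.
- by rewrite sqrtr_gt0.
- move=> x /andP[ax _]; have x0 := lt_trans a0 ax.
  rewrite sqr_sqrtr ?ltW// ltrD2l exprMn (_ : 2 ^+ 2 = 4 :> R); last by rewrite -natrX.
  rewrite ltf_pV2 ?posrE ?mulr_gt0 ?exprn_gt0//.
  by rewrite ltr_pM2l// ltrXn2r ?nnegrE ?ltW.
- by rewrite ua mulr0.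
- by rewrite ub mulr0.
Qed.

(** The lower bound for the gap grows with [lambda n], so its value at n = 0 serves for all gaps and
    [lambda] grows at least linearly. *)
Lemma zeros_cvg_pinfty (R : realType) (lambda : nat -> R) :
  positive_zeros_J0 lambda -> lambda @ \oo --> +oo.
Proof.
move=> zl.
pose c : R := pi / Num.sqrt (1 + (2 * lambda 0%N) ^- 2).
have c0 : 0 < c.
  by rewrite divr_gt0 ?pi_gt0// sqrtr_gt0 ltr_wpDr// invr_ge0 sqr_ge0.
have l0 k : 0 < lambda k := (zeros_gap k zl).1.
have lmin k : lambda 0%N <= lambda k.
  elim: k => [|k /le_trans]//; apply.
  by have [lh _] := zl; rewrite ltW// lh.
have lc k : c * k%:R <= lambda k.
  elim: k => [|k IH]; first by rewrite mulr0 ltW.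
  have [_ /andP[+ _]] := zeros_gap k zl.
  rewrite -[k.+1%:R]natr1 mulrDr mulr1 lerBrDl; apply: le_trans; apply: lerD => //.
  rewrite /c ler_pM2l ?pi_gt0// lef_pV2 ?posrE ?sqrtr_gt0 ?ltr_wpDr ?invr_ge0 ?sqr_ge0//.
  rewrite ler_wsqrtr// lerD2l lef_pV2 ?posrE ?exprn_gt0 ?mulr_gt0//.
  rewrite lerXn2r ?nnegrE ?mulr_ge0 ?ler0n ?(ltW (l0 _))//.
  by rewrite ler_pM2l// lmin.
apply/cvgryPge => x; near=> k.
apply: le_trans (lc k); rewrite -ler_pdivrMl//.
by near: k; exact: nbhs_infty_ger.
Unshelve. all: end_near. Qed.

Lemma zeros_gap_cvg (R : realType) (lambda : nat -> R) :
  positive_zeros_J0 lambda -> lambda n.+1 - lambda n @[n --> \oo] --> pi.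
Proof.
move=> zl.
apply: (@squeeze_cvgr _ _ _ _ (fun n => pi / Num.sqrt (1 + (2 * lambda n) ^- 2)) (cst pi)).
- by apply: nearW => n; exact: (zeros_gap n zl).2.
- rewrite -[X in _ --> X]divr1; apply: cvgM; first exact: cvg_cst.
  apply: cvgV; first exact: oner_neq0.
  rewrite -[X in _ --> X]sqrtr1.
  apply: continuous_cvg; first exact: sqrt_continuous.
  rewrite -[X in _ --> X]addr0; apply: cvgD; first exact: cvg_cst.
  rewrite (_ : (fun n => _) = (fun n => (2 * lambda n)^-1 * (2 * lambda n)^-1)); last first.
    by apply/funext=> n; rewrite expr2 invfM.
  have lV0 : (2 * lambda n)^-1 @[n --> \oo] --> 0.
    apply/gtr0_cvgV0; first by near=> n; rewrite mulr_gt0// (zeros_gap n zl).1.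
    apply: (@ger_cvgy _ _ _ _ lambda); last exact: zeros_cvg_pinfty.
    by apply: nearW => n; rewrite ler_peMl ?ler1n// ltW// (zeros_gap n zl).1.
  by rewrite -[X in _ --> X](mulr0 0); exact: (cvgM lV0 lV0).
- exact: cvg_cst.
Unshelve. all: end_near. Qed.

(** * The three limits *)

(** Pure analysis of sequences: the eigenvalue formula enters cleared of denominators, as the
    matching at h produces it. *)
Lemma reconstruction (R : realType) (h a1 a2 : R) (lambda A : nat -> R) :
  0 < h -> 0 <= a1 -> 0 <= a2 -> positive_zeros_J0 lambda ->
  (forall n, (1 + a2 - A n) * expR (lambda n * h) * (2 + a1 + a2) =
     (1 + a2 + A n) * expR (- (lambda n * h)) * (a2 - a1)) ->
  A 0%N != 1 + a2 ->
  let quotient := fun n : nat => (A n - 1 - a2) / (A n.+1 - 1 - a2) in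
  let scaled := fun n : nat =>
    (A n - 1 - a2) * expR (2 * lambda n * h) / (1 + a2) in
  let Alim := limn scaled in
  [/\ cvgn A /\ a2 = limn A - 1,
      cvgn quotient /\ h = 1 / (2 * pi) * ln (limn quotient) &
      [/\ cvgn scaled, 2 - Alim != 0 &
          a1 = (2 * Alim + (Alim + 2) * a2) / (2 - Alim)]].
Proof.
move=> h0 a10 a20 zl HA A0 quotient scaled Alim.
have sp : 0 < 2 + a1 + a2 by lra.
pose rho := (a2 - a1) / (2 + a1 + a2).
have rho1 : -1 < rho by rewrite ltr_pdivlMr//; lra.
have rho2 : rho < 1 by rewrite ltr_pdivrMr//; lra.
pose q n := expR (- (2 * lambda n * h)).
have l0 k : 0 < lambda k := (zeros_gap k zl).1.
have q0 n : 0 < q n by exact: expR_gt0.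
have q1 n : q n < 1.
  by rewrite -expR0 ltr_expR oppr_lt0 !mulr_gt0.
have rq n : 0 < 1 + rho * q n by have := q0 n; have := q1 n; nra.
have q_neq0 n : q n != 0 by rewrite gt_eqF.
have rq_neq0 n : 1 + rho * q n != 0 by rewrite gt_eqF.
have AE n : A n = (1 + a2) * (1 - rho * q n) / (1 + rho * q n).
  have e0 : expR (lambda n * h) != 0 by rewrite gt_eqF ?expR_gt0.
  have := HA n; have -> : expR (- (lambda n * h)) = q n * expR (lambda n * h).
    by rewrite -expRD; congr expR; ring.
  move=> E.
  have {}E : (1 + a2 - A n) = (1 + a2 + A n) * q n * rho.
    rewrite /rho mulrA; apply: (canRL (mulfK (lt0r_neq0 sp))).
    apply: (mulIf e0); rewrite -[LHS]mulrAC E; ring.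
  apply: (canRL (mulfK (lt0r_neq0 (rq n)))).
  lra.
have AB n : A n - 1 - a2 = - 2 * (1 + a2) * rho * q n / (1 + rho * q n).
  by rewrite AE; field; rewrite lt0r_neq0.
(* The only use of the assumption on the first eigenvalue. It makes every A n - 1 - a2 nonzero, so
   the quotients in (ii) are genuine. *)
have rho0 : rho != 0.
  apply: contra_neq A0 => rho0.
  by have := AB 0%N; rewrite rho0 !(mulr0, mul0r) => /eqP; rewrite -addrA -opprD subr_eq0 => /eqP.
have cq : q n @[n --> \oo] --> 0.
  apply: (@cvg_comp _ _ _ (fun n => 2 * lambda n * h) (fun x => expR (- x)) _ +oo);
    last exact: cvgr_expR.
  have /cvgryPge ly := zeros_cvg_pinfty zl.
  apply/cvgryPge => x; have := ly (x / (2 * h)); apply: filterS => n.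
  by rewrite ler_pdivrMr ?mulr_gt0// mulrA [lambda n * 2]mulrC.
have cq' : rho * q n @[n --> \oo] --> 0.
  by rewrite -[X in _ --> X](mulr0 rho); exact: cvgMl_tmp.
have c1 : (1 + rho * q n) @[n --> \oo] --> (1 : R).
  by rewrite -[X in _ --> X]addr0; apply: cvgD cq'; exact: cvg_cst.
have c1V : (1 + rho * q n)^-1 @[n --> \oo] --> (1 : R).
  by rewrite -[X in _ --> X]invr1; apply: cvgV => //; exact: oner_neq0.
have s0 : 1 + a2 != 0 by rewrite gt_eqF//; lra.
have cA : A @ \oo --> 1 + a2.
  have -> : A = (fun n => (1 + a2) * (1 - rho * q n) / (1 + rho * q n)).
    by apply/funext => n; exact: AE.
  rewrite -[X in _ --> X]mulr1; apply: cvgM c1V.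
  rewrite -[X in _ --> X]mulr1; apply: cvgMl_tmp; rewrite -[X in _ --> X]subr0.
  by apply: cvgB cq'; exact: cvg_cst.
(* q n / q n.+1 is the exponential of 2 h times the gap, and the gap tends to pi. *)
have cquot : quotient n @[n --> \oo] --> expR (2 * pi * h).
  have -> : quotient = (fun n => expR (2 * (lambda n.+1 - lambda n) * h) * ((1 + rho * q n.+1) / (1 + rho * q n))).
    apply/funext => n; rewrite /quotient !AB.
    have -> : expR (2 * (lambda n.+1 - lambda n) * h) = q n / q n.+1.
      by rewrite -expRN -expRD; congr expR; ring.
    by field; rewrite !q_neq0 !rq_neq0 rho0.
  rewrite -[X in _ --> X]mulr1; apply: cvgM.
    apply: continuous_cvg; first exact: continuous_expR.
    apply: cvgMr_tmp; apply: cvgMl_tmp; exact: zeros_gap_cvg.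
  rewrite -[X in _ --> X]mulr1; apply: cvgM c1V.
  by rewrite (@cvg_shiftS _ (fun n => 1 + rho * q n)).
(* The factor exp (2 lambda n h) cancels q n. As rho > -1, the limit - 2 rho stays below 2, which
   makes 2 - Alim nonzero; solving rho = (a2 - a1) / (2 + a1 + a2) for a1 gives (iii). *)
have cs : scaled n @[n --> \oo] --> - 2 * rho.
  have -> : scaled = (fun n => - 2 * rho / (1 + rho * q n)).
    apply/funext => n; rewrite /scaled AB.
    have -> : expR (2 * lambda n * h) = (q n)^-1 by rewrite -expRN opprK.
    by field; rewrite s0 q_neq0 rq_neq0.
  by rewrite -[X in _ --> X]mulr1; exact: cvgMl_tmp c1V.
have lE : Alim = - 2 * rho by apply/cvg_lim.
have p0 := pi_gt0 R.
split.
- split; first by apply/cvg_ex; exists (1 + a2).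
  by rewrite (cvg_lim _ cA)//; ring.
- split; first by apply/cvg_ex; eexists; exact: cquot.
  have -> : limn quotient = expR (2 * pi * h) by apply/cvg_lim.
  by rewrite expRK mul1r mulKf// mulf_neq0// lt0r_neq0.
- split; first by apply/cvg_ex; eexists; exact: cs.
    by rewrite lE gt_eqF//; lra.
  rewrite lE /rho; field; rewrite !gt_eqF//; lra.
Qed.

(** * Integrals of real functions *)

Section real_integrals.
Context d (T : measurableType d) (R : realType) (mu : {measure set T -> \bar R}).
Implicit Types (D A : set T) (f g : T -> R).

Lemma integrable_mul_bounded D f g (C : R) : measurable D ->
  mu.-integrable D (EFin \o f) -> measurable_fun D g ->
  (forall x, D x -> `|g x| <= C) ->
  mu.-integrable D (fun x => (f x * g x)%:E).
Proof.
move=> mD fi mg gC.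
apply: (@eq_integrable _ _ _ mu D mD ((EFin \o f) \* (EFin \o g))%E) => //.
apply: integrableMl => //.
exists C; split; first exact: num_real.
by move=> r Cr x /= Dx; exact: le_trans (gC x Dx) (ltW Cr).
Qed.

Lemma integrable_mul_support A f g (C : R) : measurable A ->
  mu.-integrable A (EFin \o f) -> measurable_fun setT g ->
  (forall x, `|g x| <= C) -> (forall x, ~ A x -> g x = 0) ->
  mu.-integrable setT (fun x => (f x * g x)%:E).
Proof.
move=> mA fi mg gC g0.
have : mu.-integrable A (fun x => (f x * g x)%:E).
  by apply: (@integrable_mul_bounded _ _ _ C) => //; exact: measurable_funTS.
move/(integrable_mkcond _ mA).
apply: eq_integrable => // x _; rewrite patchE; case: ifPn => // /negP.
by rewrite inE => /g0 ->; rewrite mulr0.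
Qed.

Lemma Rintegral_support D A f : A `<=` D ->
  (forall x, D x -> ~ A x -> f x = 0) ->
  \int[mu]_(x in D) f x = \int[mu]_(x in A) f x.
Proof.
move=> AD f0; rewrite Rintegral_mkcond [RHS]Rintegral_mkcond.
congr fine; apply: eq_integral => x _; congr EFin; rewrite !patchE.
case: ifPn => [|/negP]; rewrite inE => Dx.
  case: ifPn => [//|/negP]; rewrite inE => Ax; exact: f0.
by case: ifPn => [|//]; rewrite inE => /AD.
Qed.

Lemma Rdominated_cvg D (f_ : nat -> T -> R) f g : measurable D ->
  (forall n, measurable_fun D (f_ n)) ->
  (forall x, D x -> f_ n x @[n --> \oo] --> f x) ->
  mu.-integrable D (EFin \o g) ->
  (forall n x, D x -> `|f_ n x| <= g x) ->
  mu.-integrable D (EFin \o f) /\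
  \int[mu]_(x in D) f_ n x @[n --> \oo] --> \int[mu]_(x in D) f x.
Proof.
move=> mD mf cf gi fg.
have mf' : measurable_fun D f by apply: (measurable_fun_cvg mf).
have [|||||fi _ cI] := @dominated_convergence _ _ _ mu D mD (fun n x => (f_ n x)%:E)
  (EFin \o f) (EFin \o g).
- by move=> n; exact/measurable_EFinP.
- exact/measurable_EFinP.
- by apply: aeW => x Dx; apply: cvg_EFin; [exact: nearW|exact: cf].
- exact: gi.
- by apply: aeW => x n Dx; rewrite /= lee_fin fg.
split => //.
by apply: fine_cvg; rewrite fineK//; exact: integrable_fin_num.
Qed.

Lemma Rintegral_abs_le D f g : measurable D ->
  mu.-integrable D (EFin \o g) -> measurable_fun D f ->
  (forall x, D x -> `|f x| <= g x) ->
  `|\int[mu]_(x in D) f x| <= \int[mu]_(x in D) g x.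
Proof.
move=> mD gi mf fg.
have fi : mu.-integrable D (EFin \o f).
  apply: (le_integrable mD _ _ gi); first exact/measurable_EFinP.
  by move=> x Dx /=; rewrite lee_fin (le_trans (fg x Dx))// ler_norm.
apply: (le_trans (le_normr_Rintegral mD fi)).
apply: le_Rintegral => //; exact: integrable_norm.
Qed.

Lemma eq_Rintegral_ae D f g : measurable D ->
  mu.-integrable D (EFin \o f) -> measurable_fun D g ->
  {ae mu, forall x, D x -> f x = g x} ->
  mu.-integrable D (EFin \o g) /\
  \int[mu]_(x in D) f x = \int[mu]_(x in D) g x.
Proof.
move=> mD fi mg fg.
have mf : measurable_fun D f by apply/measurable_EFinP; exact: measurable_int fi.
have fg' : ae_eq mu D (EFin \o f) (EFin \o g).
  by apply: filterS fg => x /= fgx /fgx ->.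
split.
  apply/integrableP; split; first exact/measurable_EFinP.
  have /integrableP[_] := fi.
  rewrite (ae_eq_integral (abse \o (EFin \o g)))//.
  - by do 2 apply: measurableT_comp => //.
  - by do 2 apply: measurableT_comp => //.
  - by apply: filterS fg => x /= h Dx; rewrite h.
congr fine; apply: ae_eq_integral => //; exact/measurable_EFinP.
Qed.

Lemma ae_imply (P Q : T -> Prop) : (forall x, P x -> Q x) ->
  {ae mu, forall x, P x} -> {ae mu, forall x, Q x}.
Proof.
move=> PQ [N [mN N0 PN]]; exists N; split => //.
by apply: subset_trans PN => x /=; exact: contra_not (PQ x).
Qed.
End real_integrals.

(** * Cut-off functions *)

Lemma is_derive_pospart_sqr (R : realType) (x : R) :
  is_derive x 1 (fun t : R => Num.max 0 t ^+ 2) (2 * Num.max 0 x).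
Proof.
have [x0|x0|->] := ltgtP x 0.
- rewrite mulr0; have h : is_derive x 1 (cst (0 : R)) (0 : R) := is_derive_cst _ _ _.
  apply: near_eq_is_derive h.
  near=> t; have : t < 0 by near: t; exact: lt_nbhsl.
  by move=> t0; rewrite /= max_l ?expr0n// ltW.
- have h : is_derive x 1 (fun t : R => t ^+ 2) (2 * x).
    by apply: is_derive_eq; rewrite /GRing.scale/=; ring.
  apply: near_eq_is_derive h.
  near=> t; have : 0 < t by near: t; exact: lt_nbhsr.
  by move=> t0; rewrite /= max_r// ltW.
(* At 0 the square of max (0, t) is max (0, t) t, so max (0, t) itself is a continuous slope
   function. *)
- rewrite mulr0; apply/is_derive1_caratheodory; exists (fun t => Num.max 0 t).
  split => [t||].
  + rewrite maxxx expr0n subr0 subr0/=; have [|] := leP 0 t; first by rewrite expr2.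
    by rewrite expr2 !mul0r.
  + by apply: (@continuous_max _ _ (cst 0) id) => //; exact: cst_continuous.
  + by rewrite maxxx.
Unshelve. all: end_near. Qed.

(** The quadratic spline rising from 0 to 1 on [0, 1]: its derivative is the tent of height 2 on
    that interval. C^1 is all that test functions require, and the piecewise polynomial form leaves
    the bounds to arithmetic. *)
Definition smoothstep (R : realType) (t : R) : R :=
  2 * Num.max 0 t ^+ 2 - 4 * Num.max 0 (t - 2^-1) ^+ 2 + 2 * Num.max 0 (t - 1) ^+ 2.

Definition dsmoothstep (R : realType) (t : R) : R :=
  4 * Num.max 0 t - 8 * Num.max 0 (t - 2^-1) + 4 * Num.max 0 (t - 1).

Lemma is_derive_smoothstep (R : realType) (x : R) :
  is_derive x 1 (@smoothstep R) (dsmoothstep x).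
Proof.
have shift (a : R) : is_derive x 1 (fun t : R => Num.max 0 (t - a) ^+ 2) (2 * Num.max 0 (x - a)).
  have h0 := is_derive_pospart_sqr (x - a).
  have h1 : is_derive x 1 (fun t : R => t - a) 1.
    by apply: is_derive_eq; rewrite subr0.
  have := @is_derive1_comp _ _ (fun t : R => t - a) x _ _ h0 h1.
  by rewrite mulr1.
have h0 := is_derive_pospart_sqr x; have h1 := shift (2^-1); have h2 := shift 1.
by rewrite /smoothstep /dsmoothstep; apply: is_derive_eq; rewrite /GRing.scale/=; ring.
Qed.

Lemma continuous_dsmoothstep (R : realType) : continuous (@dsmoothstep R).
Proof.
have c (a : R) : continuous (fun t : R => Num.max 0 (t - a)).
  move=> x; apply: (@continuous_max _ _ (cst 0) (fun t : R => t - a)).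
    exact: cst_continuous.
  by apply: cvgB => //; exact: cvg_cst.
have c0 : continuous (fun t : R => Num.max 0 t).
  by move=> x; apply: (@continuous_max _ _ (cst 0) id) => //; exact: cst_continuous.
move=> x; apply: cvgD; [apply: cvgB|]; apply: cvgMl_tmp; [exact: c0|exact: c|exact: c].
Qed.

Ltac smoothstep_cases t :=
  rewrite /smoothstep /dsmoothstep; have [?|?] := leP 0 t; have [?|?] := leP 0 (t - 2^-1);
  have [?|?] := leP 0 (t - 1).

Lemma smoothstep0 (R : realType) (t : R) : t <= 0 -> smoothstep t = 0.
Proof. by move=> t0; smoothstep_cases t; nra. Qed.

Lemma smoothstep1 (R : realType) (t : R) : 1 <= t -> smoothstep t = 1.
Proof. by move=> t0; smoothstep_cases t; nra. Qed.

Lemma dsmoothstep0 (R : realType) (t : R) : t <= 0 \/ 1 <= t -> dsmoothstep t = 0.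
Proof. by case=> t0; smoothstep_cases t; lra. Qed.

Lemma smoothstep_bound (R : realType) (t : R) : `|smoothstep t| <= 1.
Proof. by rewrite ler_norml; smoothstep_cases t; apply/andP; split; nra. Qed.

Lemma dsmoothstep_bound (R : realType) (t : R) : `|dsmoothstep t| <= 2.
Proof. by rewrite ler_norml; smoothstep_cases t; apply/andP; split; lra. Qed.

(** Oriented downwards: 1 up to b, 0 from b + e on. As e tends to 0 it approximates the indicator of
    ]-oo, b], and - [dstep] is a mollifier on [b, b + e]. *)
Definition step (R : realType) (b e z : R) : R := smoothstep ((b + e - z) / e).

Definition dstep (R : realType) (b e z : R) : R := - dsmoothstep ((b + e - z) / e) / e.

Lemma is_derive_step (R : realType) (b e z : R) :
  is_derive z 1 (step b e) (dstep b e z).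
Proof.
have h0 := is_derive_smoothstep ((b + e - z) / e).
have h1 : is_derive z 1 (fun t : R => (b + e - t) / e) (- e^-1).
  by apply: is_derive_eq; rewrite /GRing.scale/=; ring.
have := @is_derive1_comp _ _ (fun t : R => (b + e - t) / e) z _ _ h0 h1.
by rewrite /dstep mulrN mulNr.
Qed.

Lemma continuous_dstep (R : realType) (b e : R) : continuous (dstep b e).
Proof.
move=> z; apply: cvgM; last exact: cvg_cst.
apply: cvgN; apply: (@continuous_comp _ _ _ (fun t : R => (b + e - t) / e)).
  by apply: cvgM; [apply: cvgB => //|]; exact: cvg_cst.
exact: continuous_dsmoothstep.
Qed.

Lemma step1 (R : realType) (b e z : R) : 0 < e -> z <= b -> step b e z = 1.
Proof. by move=> e0 zb; apply: smoothstep1; rewrite ler_pdivlMr//; lra. Qed.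

Lemma step0 (R : realType) (b e z : R) : 0 < e -> b + e <= z -> step b e z = 0.
Proof. by move=> e0 zb; apply: smoothstep0; rewrite ler_pdivrMr//; lra. Qed.

Lemma dstep0 (R : realType) (b e z : R) : 0 < e -> z <= b \/ b + e <= z ->
  dstep b e z = 0.
Proof.
move=> e0 zb; rewrite /dstep dsmoothstep0 ?oppr0 ?mul0r//; case: zb => zb.
  by right; rewrite ler_pdivlMr//; lra.
by left; rewrite ler_pdivrMr//; lra.
Qed.

Lemma dstep_bound (R : realType) (b e z : R) : 0 < e -> `|dstep b e z| <= 2 / e.
Proof.
move=> e0; rewrite normrM normrN normfV (gtr0_norm e0).
by rewrite ler_pM2r ?invr_gt0// dsmoothstep_bound.
Qed.

Lemma continuous_step (R : realType) (b e : R) : continuous (step b e).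
Proof.
move=> z; have h := is_derive_step b e z.
exact/differentiable_continuous/derivable1_diffP/ex_derive.
Qed.

Lemma integral_dstep (R : realType) (b e : R) : 0 < e ->
  \int[leb1 R]_(z in `[b, b + e]) dstep b e z = -1.
Proof.
move=> e0; rewrite /Rintegral (@continuous_FTC2 _ (dstep b e) (step b e)).
- by rewrite step0// step1//= sub0r.
- by rewrite ltrDl.
- by apply: continuous_subspaceT; exact: continuous_dstep.
- split.
  + by move=> x _; have h := is_derive_step b e x; exact: ex_derive.
  + exact/cvg_at_right_filter/continuous_step.
  + exact/cvg_at_left_filter/continuous_step.
- by move=> x _; have h := is_derive_step b e x; rewrite derive1E derive_val.
Qed.

(** * Weak derivatives on the line *)

(** Integrability on left half-lines rather than on compact sets: the functions in z are extended by
    0 to z <= 0, and their primitives can then start at -oo. *)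
Definition locint (R : realType) (F : R -> R) : Prop :=
  forall N : R, (leb1 R).-integrable `]-oo, N] (EFin \o F).

Lemma locint_measurable (R : realType) (F : R -> R) : locint F -> measurable_fun setT F.
Proof.
move=> Fi.
rewrite (_ : setT = \bigcup_n (`]-oo, n%:R]%classic : set R)); last first.
  apply/seteqP; split => // x _; exists (Num.bound `|x|) => //=.
  by rewrite in_itv/= (le_trans (ler_norm x))// ltW// archi_boundP.
apply/measurable_fun_bigcup => // n.
by apply/measurable_EFinP; exact: measurable_int (Fi n%:R).
Qed.

(** - [dstep] has mass 1, height at most 2 / e and support in [b, b + e], so the error is controlled
    by the mean oscillation of F around b. *)
Lemma cvg_integral_dstep (R : realType) (F : R -> R) (b : R) :
  locint F -> lebesgue_pt F b ->
  \int[leb1 R]_z (F z * dstep b n.+1%:R^-1 z) @[n --> \oo] --> - F b.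
Proof.
move=> Fi Fb; apply/cvgrPdist_le => /= e e0.
(* The ball of radius 2 d has measure 4 d, so an average below e / 8 bounds the integral by d e / 2;
   the height 2 / d of [dstep] turns this into e. *)
have e80 : 0 < e / 8 by rewrite divr_gt0.
have h0 : \forall r \near (0 : R)^'+, (davg F b r < (e / 8)%:E)%E.
  apply: (Fb [set x | (x < (e / 8)%:E)%E]); apply: open_nbhs_nbhs; split.
    exact: open_ereal_lt_ereal.
  by rewrite /= lte_fin.
have h1 : \forall n \near \oo, (davg F b (2 / n.+1%:R) < (e / 8)%:E)%E.
  have [r /= r0 hr] := h0.
  near=> n; apply: hr => /=; last by rewrite divr_gt0.
  rewrite sub0r normrN gtr0_norm ?divr_gt0//.
  rewrite ltr_pdivrMr// mulrC -ltr_pdivrMr//.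
  by apply: (lt_le_trans (_ : 2 / r < n%:R)); [near: n; exact: nbhs_infty_gtr|rewrite ler_nat].
apply: filterS h1 => n.
set d := n.+1%:R^-1; have d0 : 0 < d by rewrite invr_gt0.
rewrite -/d => dav.
pose A := `[b, b + d]%classic : set R.
have mA : (measurable : set (set (measurableTypeR R))) A by exact: measurable_itv.
have iA : (leb1 R).-integrable A (EFin \o F).
  by apply: integrableS (Fi (b + d)) => // z /=; rewrite !in_itv/= => /andP[].
have muA : (leb1 R A < +oo)%E.
  by rewrite /A/= lebesgue_measure_itv/= lte_fin ltrDl d0 -EFinB ltry.
have iAc : (leb1 R).-integrable A (EFin \o cst (F b)).
  apply: measurable_bounded_integrable => //.
  by exists `|F b|; split; [exact: num_real|move=> r rb x _ /=; exact: ltW].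
have md : measurable_fun A (dstep b d).
  by apply: measurable_funTS; apply: continuous_measurable_fun; exact: continuous_dstep.
have idm : (leb1 R).-integrable A (EFin \o (dstep b d)).
  apply: measurable_bounded_integrable => //.
  exists (2 / d); split; [exact: num_real|move=> r rb x _ /=].
  by apply: (le_trans (dstep_bound _ _ d0)); exact: ltW.
have iF0 : (leb1 R).-integrable A (EFin \o (fun z => F z - F b)).
  by have := integrableB mA iA iAc; exact: eq_integrable.
rewrite (@Rintegral_support _ _ _ (leb1 R) setT A) => //; last first.
  move=> x _; rewrite /A/= in_itv/= => /negP; rewrite negb_and -!ltNge => xA.
  rewrite dstep0 ?mulr0//; by move: xA => /orP[] /ltW; [left|right].
have -> : - F b = F b * \int[leb1 R]_(z in A) dstep b d z.
  by rewrite integral_dstep// mulrN1.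
rewrite -RintegralZl// -RintegralB//; first last.
- by apply: (@integrable_mul_bounded _ _ _ _ _ _ _ (2 / d)) => // x _; exact: dstep_bound.
- apply: (@integrable_mul_bounded _ _ _ _ _ (cst (F b)) _ (2 / d)) => // x _; exact: dstep_bound.
have h2 : `|\int[leb1 R]_(x in A) (F b * dstep b d x - F x * dstep b d x)| <=
   \int[leb1 R]_(x in A) (2 / d * `|F x - F b|).
  apply: Rintegral_abs_le => //.
  - have := integrableZl mA (2 / d) (integrable_norm iF0).
    by apply: eq_integrable.
  - have mF : measurable_fun A F by apply/measurable_EFinP; exact: measurable_int iA.
    by apply: measurable_funB; apply: measurable_funM => //; exact: measurable_cst.
  - move=> x _; rewrite -mulrBl normrM distrC mulrC ler_wpM2r// dstep_bound//.
apply: (le_trans h2); rewrite RintegralZl//; last exact: integrable_norm iF0.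
have h3 : ((\int[leb1 R]_(x in A) `|F x - F b|)%:E <= (d * (e / 2))%:E)%E.
  rewrite fineK; last by apply: integrable_fin_num => //; exact: integrable_norm iF0.
  move: dav; rewrite /davg /iavg lebesgue_measure_ball; last by rewrite divr_ge0// ltW.
  rewrite inver ifF; last by apply/negbTE; rewrite mulrn_eq0/= mulf_neq0// gt_eqF.
  rewrite lte_pdivrMl; last by rewrite pmulrn_rgt0// mulr_gt0.
  move=> /ltW dav; apply: (@le_trans _ _ ((2 * d *+ 2)%:E * (e / 8)%:E)%E); last first.
    by rewrite -EFinM lee_fin mulr2n; lra.
  apply: le_trans dav.
  apply: ge0_subset_integral => //.
  - exact: measurable_ball.
  - apply/measurable_EFinP; apply: measurableT_comp => //.
    apply: measurable_funTS; apply: measurable_funB => //.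
    exact: locint_measurable.
  - move=> x; rewrite /A/= in_itv/= => /andP[bx xb]; rewrite /ball/= ler0_norm ?subr_le0//.
    by rewrite opprB; lra.
rewrite lee_fin in h3.
rewrite mulrAC ler_pdivrMr// -ler_pdivlMl// (le_trans h3)//.
by rewrite (_ : d * (e / 2) = 2^-1 * (e * d)) //; ring.
Unshelve. all: end_near. Qed.

Lemma cvg_integral_step (R : realType) (G : R -> R) (b : R) :
  locint G ->
  \int[leb1 R]_z (G z * step b n.+1%:R^-1 z) @[n --> \oo] -->
  \int[leb1 R]_(z in `]-oo, b]) G z.
Proof.
move=> Gi; rewrite Rintegral_mkcond.
pose g := Num.norm \o (G \_ `]-oo, b + 1]).
have mG := locint_measurable Gi.
have [|||||_] := @Rdominated_cvg _ _ _ (leb1 R) setT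
  (fun n z => G z * step b n.+1%:R^-1 z) (G \_ `]-oo, b]) g; last exact.
- exact: measurableT.
- move=> n; apply: measurable_funM => //.
  by apply: continuous_measurable_fun; exact: continuous_step.
- move=> z _; rewrite patchE; case: ifPn => [|/negP]; rewrite inE/= in_itv/=.
    move=> zb; apply: cvg_near_cst; apply: nearW => n.
    by rewrite step1 ?mulr1// invr_gt0.
  move=> /negP; rewrite -ltNge => bz.
  apply: cvg_near_cst; near=> n; rewrite step0 ?mulr0 ?invr_gt0//.
  rewrite -lerBrDl -[leRHS]invrK lef_pV2 ?posrE ?invr_gt0 ?subr_gt0//.
  apply: (le_trans (_ : _ <= n%:R)); [near: n; exact: nbhs_infty_ger|by rewrite ler_nat].
- apply: integrable_norm.
  have /(integrable_mkcond _) := Gi (b + 1).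
  by move=> /(_ (measurable_itv _)); rewrite -restrict_EFin.
- move=> n z _; rewrite /g /= patchE; case: ifPn => [|/negP]; rewrite inE/= in_itv/=.
    by move=> _; rewrite normrM ler_piMr// smoothstep_bound.
  move=> /negP; rewrite -ltNge => bz; rewrite step0 ?mulr0 ?normr0 ?invr_gt0//.
  by apply: (le_trans _ (ltW bz)); rewrite lerD2l invf_le1 ?ler1n.
Unshelve. all: end_near. Qed.

Definition C1_compact (R : realType) (psi dpsi : R -> R) (a b : R) : Prop :=
  [/\ forall z : R, is_derive z 1 psi (dpsi z), continuous dpsi &
      forall z, ~ (a <= z <= b) -> psi z = 0].

(** A single step is 1 towards -oo; subtracting a second one makes the support compact. *)
Lemma C1_compact_step (R : realType) (a b e d : R) : 0 < e -> 0 < d ->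
  C1_compact (fun z => step b e z - step a d z) (fun z => dstep b e z - dstep a d z)
    (Num.min a b) (Num.max (a + d) (b + e)).
Proof.
move=> e0 d0; split.
- move=> z; have h1 := is_derive_step b e z; have h2 := is_derive_step a d z.
  exact: is_derive_eq.
- by move=> z; apply: cvgB; exact: continuous_dstep.
- move=> z /negP; rewrite negb_and -!ltNge lt_min gt_max => /orP[|] /andP[za zb].
    by rewrite !step1 ?subrr ?ltW.
  by rewrite !step0 ?subrr ?ltW.
Qed.

Lemma locint_mul (R : realType) (F g : R -> R) (C N : R) : locint F ->
  measurable_fun setT g -> (forall z, `|g z| <= C) -> (forall z, N < z -> g z = 0) ->
  (leb1 R).-integrable setT (fun z => (F z * g z)%:E).
Proof.
move=> Fi mg gC gN; apply: (@integrable_mul_support _ _ _ (leb1 R) `]-oo, N] _ _ C) => //.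
by move=> x /=; rewrite in_itv/= => /negP; rewrite -ltNge; exact: gN.
Qed.

Lemma locint_locally (R : realType) (F : R -> R) : locint F ->
  locally_integrable [set: R] F.
Proof.
move=> Fi; split.
- exact: locint_measurable.
- exact: openT.
- move=> K _ cK.
  have [M [_ hM]] := compact_bounded cK.
  have KM : K `<=` `]-oo, (`|M| + 1)].
    move=> x Kx; rewrite /= in_itv/= (le_trans (ler_norm _))// hM//.
    by rewrite (le_lt_trans (ler_norm M))// ltrDl.
  have /integrableP[_] := Fi (`|M| + 1).
  apply: le_lt_trans; apply: ge0_subset_integral => //.
  + by apply: compact_measurable.
  + do 2 apply: measurableT_comp => //; apply: measurable_funTS; exact: locint_measurable.
Qed.

Lemma ae_lebesgue_pt (R : realType) (F : R -> R) : locint F ->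
  {ae leb1 R, forall z, lebesgue_pt F z}.
Proof. by move=> Fi; exact/lebesgue_differentiation/locint_locally. Qed.

(** The test function is a step at b of width 1 / (n + 1) minus a fixed function [chi]. As the width
    shrinks, the derivative of the step picks out F b and the step itself integrates G up to b. *)
Lemma weak_primitive_limit (R : realType) (F G : R -> R) (b c : R) (chi dchi : R -> R) (N C : R) :
  locint F -> locint G -> lebesgue_pt F b ->
  measurable_fun setT chi -> measurable_fun setT dchi ->
  (forall z, `|chi z| <= C) -> (forall z, `|dchi z| <= C) ->
  (forall z, N < z -> chi z = 0) -> (forall z, N < z -> dchi z = 0) ->
  (\forall n \near \oo,
    \int[leb1 R]_z (F z * (dstep b n.+1%:R^-1 z - dchi z) +
                   G z * (step b n.+1%:R^-1 z - chi z)) = c) ->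
  F b = - c + \int[leb1 R]_(z in `]-oo, b]) G z -
       \int[leb1 R]_z (F z * dchi z + G z * chi z).
Proof.
move=> Fi Gi Fb mc mdc cC dcC cN dcN hc.
have i1 := locint_mul Fi mdc dcC dcN.
have i2 := locint_mul Gi mc cC cN.
have l1 := cvg_integral_dstep Fi Fb.
have l2 := @cvg_integral_step _ G b Gi.
have l3 : \int[leb1 R]_z (F z * dstep b n.+1%:R^-1 z) + \int[leb1 R]_z (G z * step b n.+1%:R^-1 z)
  - \int[leb1 R]_z (F z * dchi z + G z * chi z) @[n --> \oo] --> c.
  apply: cvg_near_cst; apply: filterS hc => n <-.
  have n0 : 0 < n.+1%:R^-1 :> R by rewrite invr_gt0.
  have i3 : (leb1 R).-integrable setT (fun z => (F z * dstep b n.+1%:R^-1 z)%:E).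
    apply: (@locint_mul _ _ _ (2 / n.+1%:R^-1) (b + n.+1%:R^-1)) => //.
    - by apply: continuous_measurable_fun; exact: continuous_dstep.
    - by move=> z; exact: dstep_bound.
    - by move=> z bz; rewrite dstep0//; right; exact: ltW.
  have i4 : (leb1 R).-integrable setT (fun z => (G z * step b n.+1%:R^-1 z)%:E).
    apply: (@locint_mul _ _ _ 1 (b + n.+1%:R^-1)) => //.
    - by apply: continuous_measurable_fun; exact: continuous_step.
    - by move=> z; exact: smoothstep_bound.
    - by move=> z bz; rewrite step0//; exact: ltW.
  rewrite -RintegralD// -RintegralB//.
  - by apply: eq_Rintegral => z _; ring.
  - exact: integrableD i3 i4.
  - exact: integrableD i1 i2.
set K := \int[leb1 R]_z (F z * dchi z + G z * chi z) in l3 *.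
have l4 : \int[leb1 R]_z (F z * dstep b n.+1%:R^-1 z) + \int[leb1 R]_z (G z * step b n.+1%:R^-1 z)
  - K @[n --> \oo] --> - F b + \int[leb1 R]_(z in `]-oo, b]) G z - K.
  by apply: cvgB; [exact: cvgD l1 l2|exact: cvg_cst].
have -> : c = - F b + \int[leb1 R]_(z in `]-oo, b]) G z - K by exact: cvg_unique l3 l4.
by ring.
Qed.

(** The lemma of du Bois-Reymond. The fixed step is placed at 1, so test functions stay supported in
    z > 0; its contribution does not depend on b and is the constant c. *)
Lemma weak_primitive (R : realType) (F G : R -> R) : locint F -> locint G ->
  (forall psi dpsi a b, 0 < a -> C1_compact psi dpsi a b ->
     \int[leb1 R]_z (F z * dpsi z + G z * psi z) = 0) ->
  exists c, {ae leb1 R, forall z, 0 < z -> F z = c + \int[leb1 R]_(t in `]-oo, z]) G t}.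
Proof.
move=> Fi Gi FG0.
exists (- \int[leb1 R]_z (F z * dstep 1 1 z + G z * step 1 1 z)).
have := ae_lebesgue_pt Fi.
apply: filterS; first exact: (ae_filter_ringOfSetsType (leb1 R)).
move=> b Fb b0.
rewrite (@weak_primitive_limit _ F G b 0 (step 1 1) (dstep 1 1) 2 2)//.
- ring.
- by apply: continuous_measurable_fun; exact: continuous_step.
- by apply: continuous_measurable_fun; exact: continuous_dstep.
- by move=> z; rewrite (le_trans (smoothstep_bound _))// ler1n.
- by move=> z; rewrite (le_trans (dstep_bound _ _ _))// divr1.
- by move=> z z2; rewrite step0// ltW.
- by move=> z z2; rewrite dstep0//; right; rewrite ltW.
- apply: nearW => n; have n0 : 0 < n.+1%:R^-1 :> R by rewrite invr_gt0.
  apply: (FG0 _ _ (Num.min 1 b)); first by rewrite lt_min b0 ltr01.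
  exact: C1_compact_step.
Qed.

(** Test functions may now cross z = 0. The fixed step descends inside [-2, -1], where F and G
    vanish, so it contributes nothing and the constant is the boundary value F0. *)
Lemma weak_primitive_boundary (R : realType) (F G : R -> R) (F0 : R) :
  locint F -> locint G -> (forall z, z <= 0 -> F z = 0) -> (forall z, z <= 0 -> G z = 0) ->
  (forall psi dpsi a b, C1_compact psi dpsi a b ->
     \int[leb1 R]_z (F z * dpsi z + G z * psi z) = - (F0 * psi 0)) ->
  {ae leb1 R, forall z, 0 < z -> F z = F0 + \int[leb1 R]_(t in `]-oo, z]) G t}.
Proof.
move=> Fi Gi Fn Gn FG0.
have := ae_lebesgue_pt Fi.
apply: filterS; first exact: (ae_filter_ringOfSetsType (leb1 R)).
move=> b Fb b0.
rewrite (@weak_primitive_limit _ F G b (- F0) (step (-2) 1) (dstep (-2) 1) 2 2)//.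
- rewrite (@Rintegral_support _ _ _ (leb1 R) setT set0)//.
    by rewrite Rintegral_set0; ring.
  move=> z _ _; have [z0|z0] := leP z 0; first by rewrite Fn// Gn// !mul0r addr0.
  rewrite step0//; last by lra.
  by rewrite dstep0 ?mulr0 ?addr0//; right; lra.
- by apply: continuous_measurable_fun; exact: continuous_step.
- by apply: continuous_measurable_fun; exact: continuous_dstep.
- by move=> z; rewrite (le_trans (smoothstep_bound _))// ler1n.
- by move=> z; rewrite (le_trans (dstep_bound _ _ _))// divr1.
- by move=> z z2; rewrite step0//; lra.
- by move=> z z2; rewrite dstep0//; right; lra.
- apply: nearW => n; have n0 : 0 < n.+1%:R^-1 :> R by rewrite invr_gt0.
  rewrite (FG0 _ _ _ _ (@C1_compact_step _ (-2) b _ 1 n0 ltr01)).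
  by rewrite step1 ?ltW// step0// ?subr0 ?mulr1//; lra.
Qed.

Lemma locint_mul_bounded (R : realType) (F g : R -> R) (C : R) : locint F ->
  measurable_fun setT g -> (forall z, `|g z| <= C) -> locint (fun z => F z * g z).
Proof.
move=> Fi mg gC N.
apply: (@integrable_mul_bounded _ _ _ (leb1 R) _ _ _ C) => //.
exact: measurable_funTS.
Qed.

Lemma locint_continuous (R : realType) (f : R -> R) : continuous f ->
  locint (fun z => if 0 < z then f z else 0).
Proof.
move=> cf N.
have mf : measurable_fun setT (fun z : R => if 0 < z then f z else 0).
  apply: measurable_fun_ifT => //; last exact: continuous_measurable_fun.
  exact: measurable_fun_ltr.
have : (leb1 R).-integrable `[0, N] (EFin \o f).
  apply: continuous_compact_integrable; first exact: segment_compact.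
  exact: continuous_subspaceT.
have m0 : measurable (`[0, N]%classic : set (measurableTypeR R)) by exact: measurable_itv.
move=> /(integrable_mkcond _ m0) h.
have mI : measurable (`]-oo, N]%classic : set (measurableTypeR R)) by exact: measurable_itv.
apply/(integrable_mkcond _ mI); apply: le_integrable h => //.
  apply/(measurable_restrictT _ mI); apply/measurable_EFinP.
  exact: measurable_funTS.
move=> x _; rewrite !patchE; case: ifPn => [|_]; last by rewrite abse0 abse_ge0.
rewrite inE/= in_itv/= => xN; case: ifPn => x0; last by rewrite normr0 abse_ge0.
by rewrite ifT// inE/= in_itv/= xN ltW.
Qed.

Lemma continuous_primitive (R : realType) (f : R -> R) : locint f ->
  (forall z, z <= 0 -> f z = 0) ->
  continuous (fun z => \int[leb1 R]_(t in `]-oo, z]) f t).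
Proof.
move=> fi f0 z.
pose a := - (`|z| + 1); pose b := `|z| + 1.
have a0 : a < 0 by rewrite oppr_lt0 ltr_pwDr.
have ab : a <= b by rewrite (le_trans (ltW a0))// addr_ge0.
have eqI y : a <= y -> \int[leb1 R]_(t in `]-oo, y]) f t = \int[leb1 R]_(t in `[a, y]) f t.
  move=> ay; apply: Rintegral_support; first by move=> x /=; rewrite !in_itv/= => /andP[].
  move=> x /=; rewrite !in_itv/= => xy /negP; rewrite xy andbT -ltNge => xa.
  by rewrite f0// ltW// (lt_trans xa).
have fab : (leb1 R).-integrable `[a, b] (EFin \o f).
  by apply: integrableS (fi b) => // x /=; rewrite !in_itv/= => /andP[].
have := parameterized_integral_continuous ab fab.
have zab : z \in `]a, b[%R.
  by rewrite in_itv/= /a /b ltr_pwDr ?ler_norm// ltrNl ltr_pwDr// -normrN ler_norm.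
move=> /(continuous_subspaceW (@subset_itv_oo_cc _ _ a b)).
rewrite continuous_open_subspace; last exact: itv_open.
move=> /(_ z); rewrite inE/= => /(_ zab) cz.
rewrite /continuous_at eqI; last by move: zab; rewrite in_itv/= => /andP[/ltW].
apply: cvg_trans cz; apply: near_eq_cvg.
near=> y; rewrite eqI//; near: y.
by apply: filterS (near_in_itvoo zab) => y; rewrite in_itv/= => /andP[/ltW].
Unshelve. all: end_near. Qed.

Lemma is_derive_primitive (R : realType) (f : R -> R) (z : R) : locint f ->
  {for z, continuous f} ->
  is_derive z 1 (fun z => \int[leb1 R]_(t in `]-oo, z]) f t) (f z).
Proof.
move=> fi cf.
have h : (leb1 R).-integrable [set` Interval -oo%O (BRight (z + 1))] (EFin \o f).
  exact: fi.
have zz : z < z + 1 by rewrite ltrDl.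
have [|d dE] := continuous_FTC1 zz h _ cf.
  by rewrite ltNyr.
rewrite derive1E in dE; exact: (DeriveDef d dE).
Qed.

Lemma ae_primitive_eq (R : realType) (f g : R -> R) (z : R) : locint f ->
  measurable_fun setT g -> (forall z, z <= 0 -> f z = 0) -> (forall z, z <= 0 -> g z = 0) ->
  {ae leb1 R, forall z, 0 < z -> f z = g z} ->
  \int[leb1 R]_(t in `]-oo, z]) f t = \int[leb1 R]_(t in `]-oo, z]) g t.
Proof.
move=> fi mg f0 g0 fg.
have [|||_ ->//] := @eq_Rintegral_ae _ _ _ (leb1 R) `]-oo, z]%classic f g _ (fi z).
- exact: measurable_itv.
- exact: measurable_funTS.
- apply: filterS fg; first exact: (ae_filter_ringOfSetsType (leb1 R)).
  by move=> x h _; have [x0|/h //] := leP x 0; rewrite f0// g0.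
Qed.

(** Testing with steps shows that every primitive of F vanishes; Lebesgue differentiation then
    returns F. *)
Lemma weak_zero (R : realType) (F : R -> R) : locint F -> (forall z, z <= 0 -> F z = 0) ->
  (forall psi dpsi a b, C1_compact psi dpsi a b ->
     \int[leb1 R]_z (F z * psi z) = 0) ->
  {ae leb1 R, forall z, F z = 0}.
Proof.
move=> Fi F0 Fpsi.
have prim0 b : \int[leb1 R]_(t in `]-oo, b]) F t = 0.
  have h := @cvg_integral_step _ F b Fi.
  apply: cvg_unique h _ => //; apply: cvg_near_cst; apply: nearW => n.
  have n0 : 0 < n.+1%:R^-1 :> R by rewrite invr_gt0.
  rewrite -(Fpsi _ _ _ _ (@C1_compact_step _ (-2) b _ 1 n0 ltr01)).
  apply: eq_Rintegral => z _; have [z0|z0] := leP z 0; first by rewrite F0// !mul0r.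
  by rewrite [step (-2) 1 z]step0 ?subr0//; lra.
have := FTC1Ny Fi (locint_locally Fi).
apply: filterS; first exact: (ae_filter_ringOfSetsType (leb1 R)).
move=> z [_ <-]; under eq_fun do rewrite prim0.
exact: derive1_cst.
Qed.

Lemma locintZ (R : realType) (f : R -> R) (k : R) : locint f -> locint (fun z => k * f z).
Proof.
move=> fi N.
have mI : measurable (`]-oo, N]%classic : set (measurableTypeR R)) by exact: measurable_itv.
by have := integrableZl mI k (fi N); exact: eq_integrable.
Qed.

Lemma locintB (R : realType) (f g : R -> R) : locint f -> locint g ->
  locint (fun z => f z - g z).
Proof.
move=> fi gi N.
have mI : measurable (`]-oo, N]%classic : set (measurableTypeR R)) by exact: measurable_itv.
by have := integrableB mI (fi N) (gi N); exact: eq_integrable.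
Qed.

(** * The two-layer transmission problem for one mode *)

Definition gam (R : realType) (h s1 s2 z : R) : R := if h <= z then s1 else s2.

Lemma measurable_gam (R : realType) (h s1 s2 : R) : measurable_fun setT (gam h s1 s2).
Proof. by apply: measurable_fun_ifT => //; exact: measurable_fun_ler. Qed.

Lemma gam_bound (R : realType) (h s1 s2 z : R) : `|gam h s1 s2 z| <= `|s1| + `|s2|.
Proof. by rewrite /gam; case: ifPn => _; rewrite ?lerDl ?lerDr. Qed.

Lemma gamV (R : realType) (h s1 s2 z : R) : (gam h s1 s2 z)^-1 = gam h s1^-1 s2^-1 z.
Proof. by rewrite /gam; case: ifPn. Qed.

Lemma gam_continuous (R : realType) (h s1 s2 z : R) : z != h ->
  {for z, continuous (gam h s1 s2)}.
Proof.
move=> zh; have [zlt|zgt|/eqP] := ltgtP z h; last by rewrite (negbTE zh).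
- apply: cvg_near_cst; near=> y; rewrite /gam (lt_geF zlt) lt_geF//.
  by near: y; exact: lt_nbhsl.
- apply: cvg_near_cst; near=> y; rewrite /gam (ltW zgt) ltW//.
  by near: y; exact: lt_nbhsr.
Unshelve. all: end_near. Qed.

Lemma pos_continuous (R : realType) (f : R -> R) (z : R) : 0 < z ->
  {for z, continuous f} -> {for z, continuous (fun z : R => if 0 < z then f z else 0)}.
Proof.
move=> z0 cf; rewrite /prop_for /continuous_at z0; apply: cvg_trans cf; apply: near_eq_cvg.
near=> y; rewrite ifT//; near: y; exact: lt_nbhsr.
Unshelve. all: end_near. Qed.

(* W and P are the continuous representatives of the coefficient U and of the
   flux gam * G3; the weak equations make each a primitive of a multiple of the other. *)
Lemma weak_to_classical (R : realType) (lam s1 s2 h U0 : R) (U G G3 : R -> R) :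
  0 < s1 -> 0 < s2 ->
  locint U -> locint G -> locint G3 ->
  (forall z, z <= 0 -> U z = 0) -> (forall z, z <= 0 -> G z = 0) ->
  (forall z, z <= 0 -> G3 z = 0) ->
  (forall psi dpsi a b, C1_compact psi dpsi a b ->
     \int[leb1 R]_z (U z * dpsi z + G3 z * psi z) = - (U0 * psi 0)) ->
  (forall psi dpsi a b, 0 < a -> C1_compact psi dpsi a b ->
     \int[leb1 R]_z (gam h s1 s2 z * (G3 z * dpsi z + G z * psi z)) = 0) ->
  (forall psi dpsi a b, C1_compact psi dpsi a b ->
     \int[leb1 R]_z ((lam ^+ 2 * U z - G z) * psi z) = 0) ->
  exists W P : R -> R,
  [/\ continuous W, continuous P, W 0 = U0,
      {ae leb1 R, forall z, 0 < z -> U z = W z /\ gam h s1 s2 z * G3 z = P z} &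
      forall z, 0 < z -> z != h -> is_derive z 1 W (P z / gam h s1 s2 z) /\
        is_derive z 1 P (lam ^+ 2 * (gam h s1 s2 z * W z))].
Proof.
move=> s10 s20 Ui Gi G3i Un Gn G3n wa wb wc.
pose g := gam h s1 s2.
have g0 z : g z != 0 by rewrite /g /gam; case: ifPn => _; rewrite gt_eqF.
have mg := measurable_gam h s1 s2.
have gC := gam_bound h s1 s2.
pose I f (z : R) := \int[leb1 R]_(t in `]-oo, z]) f t.
have UGi : locint (fun z => lam ^+ 2 * U z - G z) by apply: locintB => //; exact: locintZ.
(* The horizontal part of the divergence is lam^2 U, with no derivative in z involved. *)
have GU : {ae leb1 R, forall z, lam ^+ 2 * U z - G z = 0}.
  apply: weak_zero UGi _ wc => z z0; by rewrite Un// Gn// mulr0 subr0.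
have aeU := weak_primitive_boundary Ui G3i Un G3n wa.
pose W z := U0 + I G3 z.
have gi f : locint f -> locint (fun z => f z * g z).
  by move=> fi; exact: locint_mul_bounded fi mg gC.
have [c aeP] : exists c, {ae leb1 R, forall z, 0 < z -> G3 z * g z = c + I (fun t => G t * g t) z}.
  apply: weak_primitive; [exact: gi|exact: gi|].
  move=> psi dpsi a b a0 hpsi; rewrite -(wb _ _ _ _ a0 hpsi).
  by apply: eq_Rintegral => z _; rewrite -/g; ring.
have cW : continuous W.
  by move=> z; apply: cvgD; [exact: cvg_cst|exact: continuous_primitive].
(* Bootstrap: G g is replaced by lam^2 W g, equal to it almost everywhere on z > 0 and continuous
   off h. Its primitive P is thus differentiable off h, and [f3] does the same for W. *)
pose f2 z := lam ^+ 2 * ((if 0 < z then W z else 0) * g z).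
have f2i : locint f2 by apply/locintZ/gi/locint_continuous.
have f2n z : z <= 0 -> f2 z = 0 by move=> z0; rewrite /f2 ltNge z0/= mul0r mulr0.
pose P z := c + I f2 z.
have cP : continuous P.
  by move=> z; apply: cvgD; [exact: cvg_cst|exact: continuous_primitive].
have aeF := ae_filter_ringOfSetsType (leb1 R).
have {}aeP : {ae leb1 R, forall z, 0 < z -> G3 z * g z = P z}.
  apply: filterS aeP => z + z0 => /(_ z0) ->; congr (c + _).
  apply: ae_primitive_eq => //.
  - exact: gi.
  - exact: locint_measurable.
  - by move=> t t0; rewrite Gn// mul0r.
  - apply: filterS2 GU aeU => t /eqP; rewrite subr_eq0 => /eqP <- + t0 => /(_ t0) ->.
    by rewrite /f2 t0 -/(I G3 t) -/(W t); ring.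
pose f3 z := (if 0 < z then P z else 0) * gam h s1^-1 s2^-1 z.
have f3i : locint f3.
  apply: locint_mul_bounded; first exact: locint_continuous.
  - exact: measurable_gam.
  - by move=> z; exact: gam_bound.
have WE z : W z = U0 + I f3 z.
  congr (U0 + _); apply: ae_primitive_eq => //.
  - exact: locint_measurable.
  - by move=> t t0; rewrite /f3 ltNge t0/= mul0r.
  - apply: filterS aeP => t + t0 => /(_ t0) h3.
    by rewrite /f3 t0 -gamV -h3 mulfK.
exists W, P; split => //.
- rewrite /W /I (@Rintegral_support _ _ _ (leb1 R) `]-oo, 0]%classic set0)//.
    by rewrite Rintegral_set0 addr0.
  by move=> x /=; rewrite in_itv/= => x0 _; exact: G3n.
- apply: filterS2 aeU aeP => z h1 h2 z0; split; first exact: h1.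
  by rewrite mulrC h2.
- move=> z z0 zh; split.
  + have -> : W = (fun z => U0 + I f3 z) by apply/funext.
    have cf3 : {for z, continuous f3}.
      apply: cvgM; last exact: gam_continuous.
      by apply: pos_continuous => //; exact: cP.
    have h3 := is_derive_primitive f3i cf3.
    have -> : P z / gam h s1 s2 z = f3 z by rewrite /f3 z0 gamV.
    by have := is_deriveD (is_derive_cst U0 z (1 : R)) h3; rewrite add0r; exact.
  + have cf2 : {for z, continuous f2}.
      apply: cvgMl_tmp; apply: cvgM; last exact: gam_continuous.
      by apply: pos_continuous => //; exact: cW.
    have h2 := is_derive_primitive f2i cf2.
    have -> : lam ^+ 2 * (gam h s1 s2 z * W z) = f2 z by rewrite /f2 z0 [W z * _]mulrC.
    by have := is_deriveD (is_derive_cst c z (1 : R)) h2; rewrite add0r; exact.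
Qed.

(** E (z) exp (- k z) has zero derivative inside the interval. Mere continuity at the ends suffices,
    which matters since they will be the bottom and the interface. *)
Lemma exp_mode (R : realType) (E : R -> R) (k a b : R) : a <= b -> continuous E ->
  (forall z, a < z < b -> is_derive z 1 E (k * E z)) ->
  E b = E a * expR (k * (b - a)).
Proof.
rewrite le_eqVlt => /predU1P[<- _ _|ab cE dE]; first by rewrite subrr mulr0 expR0 mulr1.
pose f := fun z : R => E z * expR (- k * z).
have df (z : R) : z \in `]a, b[ -> is_derive z 1 f 0.
  rewrite in_itv/= => zab; have h1 := dE z zab.
  have h2 : is_derive z 1 (fun z : R => - k * z) (- k).
    by apply: is_derive_eq; rewrite /GRing.scale/= mulr1.
  by apply: is_derive_eq; rewrite /GRing.scale/=; ring.
have cf : {within `[a, b], continuous f}.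
  apply: continuous_subspaceT => z; apply: cvgM; first exact: cE.
  apply: continuous_cvg; first exact: continuous_expR.
  by apply: cvgMl_tmp.
have [c _] := MVT ab df cf.
rewrite mul0r => /eqP; rewrite subr_eq0 /f => /eqP fab.
have -> : expR (k * (b - a)) = expR (- k * a) * expR (k * b).
  by rewrite -expRD; congr expR; ring.
rewrite mulrA -fab -mulrA -expRD mulNr addNr expR0 mulr1 //.
Qed.

Lemma linear_dominates_exp (R : realType) (S lam h C : R) : 0 < lam -> 0 < h ->
  (forall N, h <= N -> 1 <= N -> `|S| * expR (lam * (N - h)) * N <= C * (1 + 2 * N)) ->
  S = 0.
Proof.
move=> lam0 h0 H; apply/eqP; rewrite -normr_eq0 eq_le normr_ge0 andbT leNgt.
apply/negP => S0.
(* At this N the inequality exp x >= 1 + x makes the factor |S| exp (lam (N - h)) exceed 3 |C|,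
   while C (1 + 2 N) <= 3 |C| N because N >= 1. *)
pose N := h + 1 + 3 * `|C| / (`|S| * lam).
have q0 : 0 <= 3 * `|C| / (`|S| * lam).
  by rewrite divr_ge0 ?mulr_ge0// ?ltW.
have hN : h <= N by rewrite /N; lra.
have N1 : 1 <= N by rewrite /N; lra.
have := H N hN N1; rewrite leNgt => /negP; apply.
have e1 : 1 + lam * (N - h) <= expR (lam * (N - h)) by exact: expR_ge1Dx.
have e2 : `|S| * (1 + lam * (N - h)) * N <= `|S| * expR (lam * (N - h)) * N.
  by rewrite ler_wpM2r//; [lra|rewrite ler_wpM2l].
apply: lt_le_trans e2.
have -> : `|S| * (1 + lam * (N - h)) = `|S| + `|S| * lam + 3 * `|C|.
  by rewrite /N; field; rewrite !gt_eqF.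
have : C <= `|C| by exact: ler_norm.
have := normr_ge0 C.
set c := `|C|; set s := `|S|; move=> c0 Cc.
have s0 : 0 < s by [].
have : 0 < s * N by rewrite mulr_gt0//; lra.
have : 0 < s * lam * N by rewrite !mulr_gt0//; lra.
nra.
Qed.

(** On ]N, 2 N[, of length N, the combination is at least |S| exp (lam (N - h)) in absolute value,
    whereas its integral is at most a constant times 1 + 2 N. The factor [K] dominates both
    coefficients of U + G / lam. *)
Lemma growing_mode_vanishes (R : realType) (lam h S C : R) (U G : R -> R) :
  0 < lam -> 0 < h -> locint U -> locint G ->
  (forall N, 0 < N -> \int[leb1 R]_(z in `]-oo, N]) (`|U z| + `|G z|) <= C * (1 + N)) ->
  {ae leb1 R, forall z, h < z -> U z + G z / lam = S * expR (lam * (z - h))} ->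
  S = 0.
Proof.
move=> lam0 h0 Ui Gi grow aeS.
pose K := 1 + lam^-1.
have K1 : 1 <= K by rewrite lerDl invr_ge0 ltW.
have K0 : 0 <= K := le_trans ler01 K1.
have K2 : lam^-1 <= K by rewrite lerDr.
apply: (@linear_dominates_exp _ _ lam h (K * C)) => // N hN N1.
have N0 : 0 < N by exact: lt_le_trans N1.
pose k := `|S| * expR (lam * (N - h)).
have k0 : 0 <= k by rewrite mulr_ge0// expR_ge0.
pose g z := K * (`|U z| + `|G z|).
have g0 z : 0 <= g z by apply: mulr_ge0 => //; exact: addr_ge0.
have gi : (leb1 R).-integrable `]-oo, (2 * N)] (EFin \o g).
  have mI : measurable (`]-oo, (2 * N)]%classic : set (measurableTypeR R)) by exact: measurable_itv.
  have := integrableZl mI K (integrableD mI (integrable_norm (Ui (2 * N))) (integrable_norm (Gi (2 * N)))).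
  by apply: eq_integrable.
have sub : `]N, (2 * N)[ `<=` `]-oo, (2 * N)] by move=> z /=; rewrite !in_itv/= => /andP[_ /ltW].
have mJ : measurable (`]N, (2 * N)[%classic : set (measurableTypeR R)) by exact: measurable_itv.
have mI : measurable (`]-oo, (2 * N)]%classic : set (measurableTypeR R)) by exact: measurable_itv.
have aeF := ae_filter_ringOfSetsType (leb1 R).
have mU := locint_measurable Ui; have mG := locint_measurable Gi.
have mg : measurable_fun setT g.
  apply: measurable_funM => //; apply: measurable_funD; exact: measurableT_comp.
pose J : set R := `]N, (2 * N)[%classic.
pose I : set R := `]-oo, (2 * N)]%classic.
have h1 : (\int[leb1 R]_(z in J) k%:E <= \int[leb1 R]_(z in J) (g z)%:E)%E.
  apply: ae_ge0_le_integral => //.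
  - by move=> z _; rewrite lee_fin.
  - by apply/measurable_EFinP; exact: measurable_funTS.
  - apply: filterS aeS => z +; rewrite /J/= in_itv/= => hz /andP[Nz _].
    rewrite lee_fin; have {}hz := hz (le_lt_trans hN Nz).
    have : k <= `|U z + G z / lam|.
      rewrite hz normrM (ger0_norm (expR_ge0 _)) ler_wpM2l// ler_expR.
      by rewrite ler_pM2l// lerD2r ltW.
    move/le_trans; apply; apply: (le_trans (ler_normD _ _)).
    rewrite /g mulrDr normrM normfV (gtr0_norm lam0).
    by rewrite lerD ?ler_peMl// mulrC ler_wpM2r.
have h2 : (\int[leb1 R]_(z in J) (g z)%:E <= \int[leb1 R]_(z in I) (g z)%:E)%E.
  apply: ge0_subset_integral => //.
  - by apply/measurable_EFinP; exact: measurable_funTS.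
  - by move=> z _; rewrite lee_fin.
have := le_trans h1 h2; rewrite integral_cst//= lebesgue_measure_itv/= lte_fin.
rewrite ifT; last lra.
rewrite -[X in (_ <= X)%E -> _]fineK; last by apply: integrable_fin_num.
rewrite -EFinB -EFinM lee_fin (_ : 2 * N - N = N); last by ring.
move=> /le_trans; apply.
rewrite -[fine _]/(\int[leb1 R]_(z in `]-oo, (2 * N)]) g z) RintegralZl//; last first.
  have := integrableD mI (integrable_norm (Ui (2 * N))) (integrable_norm (Gi (2 * N))).
  by apply: eq_integrable.
by rewrite -mulrA ler_wpM2l//; apply: grow; rewrite mulr_gt0.
Qed.

Lemma ae_continuous_eq (R : realType) (f g : R -> R) :
  (forall z, 0 < z -> {for z, continuous f}) -> continuous g ->
  {ae leb1 R, forall z, 0 < z -> f z = g z} -> forall z, 0 < z -> f z = g z.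
Proof.
move=> cf cg [N [mN N0 fgN]] z z0; apply/eqP; rewrite -subr_eq0; apply/negP => /negP fg.
have cfg : (f t - g t) @[t --> z] --> f z - g z by apply: cvgB; [exact: cf|exact: cg].
have : \forall t \near z, N t.
  near=> t; apply: fgN => /= h.
  have t0 : 0 < t by near: t; exact: lt_nbhsr.
  have : f t - g t != 0.
    near: t.
    have : \forall y \near f z - g z, y != 0.
      by apply: open_nbhs_nbhs; split => //; exact: open_neq.
    by move/cfg.
  by rewrite h// subrr eqxx.
move=> [e /= e0 eN].
have : (leb1 R (ball z e) <= leb1 R N)%E.
  by apply: le_measure => //; rewrite inE//; exact: measurable_ball.
rewrite N0 lebesgue_measure_ball; last exact: ltW.
by rewrite lee_fin leNgt pmulrn_rgt0// e0.
Unshelve. all: end_near. Qed.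

(** Up to the factor lam, W + P / (lam s2) and W - P / (lam s2) isolate the growing and the decaying
    exponential below h; at the bottom they are lam U0 + d and lam U0 - d. The identity says that
    their ratio at h is the reflection coefficient (s2 - s1) / (s2 + s1). It is kept free of
    division, hence also valid for s1 = s2. *)
Lemma mode_ratio (R : realType) (lam s1 s2 h U0 d C : R) (U G G3 w : R -> R) :
  0 < lam -> 0 < s1 -> 0 < s2 -> 0 < h ->
  locint U -> locint G -> locint G3 ->
  (forall z, z <= 0 -> U z = 0) -> (forall z, z <= 0 -> G z = 0) ->
  (forall z, z <= 0 -> G3 z = 0) ->
  (forall psi dpsi a b, C1_compact psi dpsi a b ->
     \int[leb1 R]_z (U z * dpsi z + G3 z * psi z) = - (U0 * psi 0)) ->
  (forall psi dpsi a b, 0 < a -> C1_compact psi dpsi a b ->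
     \int[leb1 R]_z (gam h s1 s2 z * (G3 z * dpsi z + G z * psi z)) = 0) ->
  (forall psi dpsi a b, C1_compact psi dpsi a b ->
     \int[leb1 R]_z ((lam ^+ 2 * U z - G z) * psi z) = 0) ->
  (forall N, 0 < N -> \int[leb1 R]_(z in `]-oo, N]) (`|U z| + `|G3 z|) <= C * (1 + N)) ->
  {within `[0, +oo[, continuous w} ->
  {ae leb1 R, forall z, 0 < z -> w z = U z} ->
  (w t - w 0) / t @[t --> 0^'+] --> d ->
  (lam * U0 + d) * expR (lam * h) * (s1 + s2) =
  (lam * U0 - d) * expR (- (lam * h)) * (s2 - s1).
Proof.
move=> lam0 s10 s20 h0 Ui Gi G3i Un Gn G3n wa wb wc grow cw aew dw.
have lam1 : lam != 0 by rewrite gt_eqF.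
have s11 : s1 != 0 by rewrite gt_eqF.
have s21 : s2 != 0 by rewrite gt_eqF.
have [W [P [cW cP W0 aeWP dWP]]] :=
  weak_to_classical s10 s20 Ui Gi G3i Un Gn G3n wa wb wc.
have aeF := ae_filter_ringOfSetsType (leb1 R).
(* On a layer where gam = s, the combination W + P / (k s) with k = +-lam solves E' = k E. *)
have comb (s k : R) (a b : R) : 0 <= a -> a <= b -> k ^+ 2 = lam ^+ 2 -> k != 0 -> s != 0 ->
    (forall z, a < z < b -> z != h /\ gam h s1 s2 z = s) ->
    W b + P b / (k * s) = (W a + P a / (k * s)) * expR (k * (b - a)).
  move=> a0 ab k2 k0 s0 hs.
  apply: (@exp_mode _ (fun z => W z + P z / (k * s))) => //.
    move=> z; apply: cvgD; first exact: cW.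
    by apply: cvgM; [exact: cP|exact: cvg_cst].
  move=> z zab; have [zh gz] := hs z zab.
  have z0 : 0 < z by apply: le_lt_trans a0 _; case/andP: zab.
  have [h1 h2] := dWP z z0 zh.
  apply: is_derive_eq; rewrite /GRing.scale/= gz -k2; field; rewrite s0 k0 //.
have low z (k : R) : 0 <= z <= h -> k ^+ 2 = lam ^+ 2 -> k != 0 ->
    W z + P z / (k * s2) = (U0 + P 0 / (k * s2)) * expR (k * z).
  move=> /andP[z0 zh] k2 k0; rewrite (comb s2 k 0 z)// ?W0 ?subr0//.
  move=> y /andP[_ yz]; have yh := lt_le_trans yz zh.
  by rewrite lt_eqF// /gam lt_geF.
have high z : h <= z ->
    W z + P z / (lam * s1) = (W h + P h / (lam * s1)) * expR (lam * (z - h)).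
  move=> hz; rewrite (comb s1 lam h z)//; first exact: ltW.
  by move=> y /andP[hy _]; rewrite gt_eqF// /gam ltW.
(* Square integrability at infinity selects the decaying exponential in the upper layer. *)
have S0 : W h + P h / (lam * s1) = 0.
  apply: (growing_mode_vanishes lam0 h0 Ui G3i grow).
  apply: filterS aeWP => z + hz => /(_ (lt_trans h0 hz))[-> PE].
  rewrite -high ?ltW// -PE /gam ltW//; field; by rewrite s11 lam1.
have hh : 0 <= h <= h by rewrite lexx ltW.
have lp z zh := low z lam zh erefl lam1.
have lamN : - lam != 0 by rewrite oppr_eq0.
have lm z zh := low z (- lam) zh (sqrrN _) lamN.
have [cwo cw0] := (continuous_within_itvcyP 0 w).1 cw.
have wW z : 0 < z -> w z = W z.
  apply: ae_continuous_eq => //.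
  - by move=> {}z z0; apply: cwo; rewrite in_itv/= z0.
  - by apply: filterS2 aew aeWP => y h1 h2 y0; rewrite h1//; exact: (h2 y0).1.
have w0 : w 0 = W 0.
  apply: cvg_unique cw0 _ => //.
  have : W z @[z --> 0^'+] --> W 0 by exact/cvg_at_right_filter/cW.
  apply: cvg_trans; apply: near_eq_cvg; near=> t; apply/esym/wW.
  by near: t; exact: nbhs_right_gt.
(* The differential equations for W and P hold only for z > 0. This explicit solution on [0, h], the
   half sum of the two combinations, is smooth across 0 and gives the one-sided derivative there. *)
pose e := fun z : R => 2^-1 * ((U0 + P 0 / (lam * s2)) * expR (lam * z) +
  (U0 + P 0 / (- lam * s2)) * expR (- lam * z)).
have We z : 0 <= z <= h -> W z = e z.
  move=> zh; have h1 := lp z zh; have h2 := lm z zh.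
  rewrite /e -h1 -h2 ?oppr_eq0//; field; by rewrite lam1 s21.
have de : is_derive (0 : R) 1 e (P 0 / s2).
  have h1 (k : R) : is_derive (0 : R) 1 (fun z : R => expR (k * z)) k.
    have h2 : is_derive (0 : R) 1 (fun z : R => k * z) k.
      by apply: is_derive_eq; rewrite /GRing.scale/= mulr1.
    have := @is_derive1_comp _ expR (fun z : R => k * z) 0 _ _ (is_derive_expR _) h2.
    by rewrite mulr0 expR0 mul1r.
  have h2 := h1 lam; have h3 := h1 (- lam).
  by apply: is_derive_eq; rewrite /GRing.scale/=; field; rewrite lam1 s21.
have dE : d = P 0 / s2.
  apply: cvg_unique dw _ => //.
  case: de => de <-.
  have h1 : t^-1 *: (e (t *: 1 + 0) - e 0) @[t --> 0^'+] --> 'D_1 e 0.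
    apply: cvg_trans de; apply: cvg_app.
    move=> B [r /= r0 Br]; exists r => //= t tr t0; apply: Br => //.
    by rewrite gt_eqF.
  apply: cvg_trans h1; apply: near_eq_cvg; near=> t.
  have t0 : 0 < t by near: t; exact: nbhs_right_gt.
  have th : t <= h by near: t; exact: nbhs_right_le.
  have W0e : W 0 = e 0 by apply: We; rewrite lexx ltW.
  have Wte : W t = e t by apply: We; rewrite ltW.
  rewrite w0 wW// W0e Wte.
  by rewrite /GRing.scale/= mulr1 addr0 mulrC.
(* Decay above h, read at the interface: the flux there is - lam s1 W h, and it is the same from
   below. *)
have Ph : P h = - (lam * s1) * W h.
  have := S0; rewrite addrC => /eqP; rewrite addr_eq0 => /eqP h1.
  by rewrite -[LHS](divfK (_ : lam * s1 != 0)) ?mulf_neq0// h1; ring.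
(* Both amplitudes are transported to h and expressed by W h alone, with factors 1 - s1 / s2 and 1 +
   s1 / s2. *)
have h1 : (lam * U0 + d) * expR (lam * h) = lam * (W h * (1 - s1 / s2)).
  have -> : (lam * U0 + d) * expR (lam * h) = lam * ((U0 + P 0 / (lam * s2)) * expR (lam * h)).
    by rewrite dE; field; rewrite lam1 s21.
  by rewrite -lp// Ph; field; rewrite lam1 s21.
rewrite -(mulNr lam h).
have h2 : (lam * U0 - d) * expR (- lam * h) = lam * (W h * (1 + s1 / s2)).
  have -> : (lam * U0 - d) * expR (- lam * h) = lam * ((U0 + P 0 / (- lam * s2)) * expR (- lam * h)).
    by rewrite dE; field; rewrite lam1 s21.
  by rewrite -lm// Ph; field; rewrite lam1 s21.
by rewrite h1 h2; field.
Unshelve. all: end_near. Qed.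

(** * Product test functions *)

Section basis_derivatives.
Variable R : realType.

Lemma is_derive_line (V : normedModType R) (phi : V -> R) (p v : V) (g : R -> R) (x d : R) :
  (forall t : R, phi (t *: v + p) = g (t + x)) ->
  is_derive x 1 g d -> is_derive p v phi d.
Proof.
move=> phig [dg <-].
have E : (fun t : R => t^-1 *: (phi (t *: v + p) - phi p)) =
         (fun t : R => t^-1 *: (g (t *: 1 + x) - g x)).
  apply/funext => t; have -> : t *: (1 : R) = t by rewrite /GRing.scale/= mulr1.
  by rewrite phig; have := phig 0; rewrite scale0r !add0r => ->.
have dphi : derivable phi p v by rewrite /derivable E.
by apply: DeriveDef => //; rewrite /derive E.
Qed.

Let X (p : R * R * R) := p.1.1.
Let Y (p : R * R * R) := p.1.2.
Let Z (p : R * R * R) := p.2.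

(** One shape for all test functions: m = n = 1 gives a radial function times psi, and taking the
    identity for m or n gives the horizontal partial derivatives of such a function. The radial
    factor is a function of x^2 + y^2, so no differentiability problem occurs on the axis. *)
Definition prod_fun (m n F psi : R -> R) (p : R * R * R) : R :=
  m p.1.1 * n p.1.2 * F (p.1.1 ^+ 2 + p.1.2 ^+ 2) * psi p.2.

Definition dprod_fun (m dm n dn F dF psi dpsi : R -> R) (i : nat) (p : R * R * R) : R :=
  let: (x, y, z) := p in let s := x ^+ 2 + y ^+ 2 in
  if i == 0%N then (dm x * F s + m x * (2 * x * dF s)) * n y * psi z else
  if i == 1%N then (dn y * F s + n y * (2 * y * dF s)) * m x * psi z else
  m x * n y * F s * dpsi z.

Lemma is_derive_prod_fun (m dm n dn F dF psi dpsi : R -> R) (i : 'I_3) p :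
  (forall x : R, is_derive x 1 m (dm x)) -> (forall x : R, is_derive x 1 n (dn x)) ->
  (forall x : R, is_derive x 1 F (dF x)) -> (forall x : R, is_derive x 1 psi (dpsi x)) ->
  is_derive p (basis3 R i) (prod_fun m n F psi) (dprod_fun m dm n dn F dF psi dpsi i p).
Proof.
move=> Dm Dn DF Dpsi; case: p => -[x y] z.
case: i => -[|[|[|//]]] i3; rewrite /basis3 /dprod_fun /=.
- apply: (@is_derive_line _ _ _ _ (fun t => m t * n y * F (t ^+ 2 + y ^+ 2) * psi z) x).
    move=> t; rewrite /prod_fun/= /GRing.scale/= !mulr1 !mulr0 !add0r //.
  have h1 := Dm x; have h2 := DF (x ^+ 2 + y ^+ 2).
  have h3 : is_derive x 1 (fun t : R => t ^+ 2 + y ^+ 2) (2 * x).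
    by apply: is_derive_eq; rewrite /GRing.scale/=; ring.
  have h4 := @is_derive1_comp _ _ (fun t : R => t ^+ 2 + y ^+ 2) x _ _ h2 h3.
  by apply: is_derive_eq; rewrite /GRing.scale/= /comp; ring.
- apply: (@is_derive_line _ _ _ _ (fun t => m x * n t * F (x ^+ 2 + t ^+ 2) * psi z) y).
    move=> t; rewrite /prod_fun/= /GRing.scale/= !mulr1 !mulr0 !add0r //.
  have h1 := Dn y; have h2 := DF (x ^+ 2 + y ^+ 2).
  have h3 : is_derive y 1 (fun t : R => x ^+ 2 + t ^+ 2) (2 * y).
    by apply: is_derive_eq; rewrite /GRing.scale/=; ring.
  have h4 := @is_derive1_comp _ _ (fun t : R => x ^+ 2 + t ^+ 2) y _ _ h2 h3.
  by apply: is_derive_eq; rewrite /GRing.scale/= /comp; ring.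
- apply: (@is_derive_line _ _ _ _ (fun t => m x * n y * F (x ^+ 2 + y ^+ 2) * psi t) z).
    move=> t; rewrite /prod_fun/= /GRing.scale/= !mulr1 !mulr0 !add0r //.
Qed.

Lemma continuous_comp3 (f : R -> R) (g : R * R * R -> R) : continuous f -> continuous g ->
  continuous (fun p => f (g p)).
Proof. by move=> cf cg p; apply: continuous_comp; [exact: cg|exact: cf]. Qed.

Lemma continuous_mul3 (f g : R * R * R -> R) : continuous f -> continuous g ->
  continuous (fun p => f p * g p).
Proof. by move=> cf cg p; apply: cvgM; [exact: cf|exact: cg]. Qed.

Lemma continuous_add3 (f g : R * R * R -> R) : continuous f -> continuous g ->
  continuous (fun p => f p + g p).
Proof. by move=> cf cg p; apply: cvgD; [exact: cf|exact: cg]. Qed.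

Lemma continuous_coord : [/\ continuous X, continuous Y & continuous Z].
Proof.
split => p.
- by apply: (@continuous_comp _ _ _ fst fst); [exact: cvg_fst|exact: cvg_fst].
- by apply: (@continuous_comp _ _ _ fst snd); [exact: cvg_fst|exact: cvg_snd].
- exact: cvg_snd.
Qed.

Lemma is_derive_continuous (f df : R -> R) : (forall x : R, is_derive x 1 f (df x)) ->
  continuous f.
Proof.
by move=> Df x; have h := Df x; exact/differentiable_continuous/derivable1_diffP/ex_derive.
Qed.

Lemma continuous_sqr_sum : continuous (fun p : R * R * R => p.1.1 ^+ 2 + p.1.2 ^+ 2).
Proof.
have [cX cY _] := continuous_coord.
by apply: continuous_add3; [apply: (continuous_comp3 (@exprn_continuous _ 2) cX)|
  apply: (continuous_comp3 (@exprn_continuous _ 2) cY)].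
Qed.

Lemma test_function_prod (m dm n dn F dF psi dpsi : R -> R) (rho a b : R) (U : set (R * R * R)) :
  (forall x : R, is_derive x 1 m (dm x)) -> (forall x : R, is_derive x 1 n (dn x)) ->
  (forall x : R, is_derive x 1 F (dF x)) ->
  continuous dm -> continuous dn -> continuous dF ->
  C1_compact psi dpsi a b -> (forall s, rho < s -> F s = 0) ->
  (forall p, p.1.1 ^+ 2 + p.1.2 ^+ 2 <= rho -> a <= p.2 <= b -> U p) ->
  test_function U (prod_fun m n F psi).
Proof.
move=> Dm Dn DF cdm cdn cdF [Dpsi cdpsi psi0] F0 KU.
have [cX cY cZ] := continuous_coord.
have cs := continuous_sqr_sum.
have cm := continuous_comp3 (is_derive_continuous Dm) cX.
have cn := continuous_comp3 (is_derive_continuous Dn) cY.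
have cF := continuous_comp3 (is_derive_continuous DF) cs.
have cp := continuous_comp3 (is_derive_continuous Dpsi) cZ.
have cst c : continuous (fun _ : R * R * R => c : R) by exact: cst_continuous.
split.
- by apply: continuous_mul3 => //; apply: continuous_mul3 => //; exact: continuous_mul3.
- move=> i; have D p := is_derive_prod_fun i p Dm Dn DF Dpsi.
  split=> [p|]; first by have h := D p; exact: ex_derive.
  have -> : (fun p => 'D_(basis3 R i) (prod_fun m n F psi) p) = dprod_fun m dm n dn F dF psi dpsi i.
    by apply/funext => p; have h := D p; rewrite derive_val.
  have cdm' := continuous_comp3 cdm cX.
  have cdn' := continuous_comp3 cdn cY.
  have cdF' := continuous_comp3 cdF cs.
  have cdp' := continuous_comp3 cdpsi cZ.
  have c2X := continuous_mul3 (cst 2) cX.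
  have c2Y := continuous_mul3 (cst 2) cY.
  case: i {D} => -[|[|[|//]]] i3.
  + rewrite (_ : dprod_fun _ _ _ _ _ _ _ _ _ = (fun p : R * R * R =>
      (dm p.1.1 * F (p.1.1 ^+ 2 + p.1.2 ^+ 2) + m p.1.1 * (2 * p.1.1 * dF (p.1.1 ^+ 2 + p.1.2 ^+ 2))) *
      n p.1.2 * psi p.2)); last first.
      by apply/funext => -[[x y] z].
    do 2 apply: continuous_mul3 => //; apply: continuous_add3; apply: continuous_mul3 => //.
    exact: continuous_mul3.
  + rewrite (_ : dprod_fun _ _ _ _ _ _ _ _ _ = (fun p : R * R * R =>
      (dn p.1.2 * F (p.1.1 ^+ 2 + p.1.2 ^+ 2) + n p.1.2 * (2 * p.1.2 * dF (p.1.1 ^+ 2 + p.1.2 ^+ 2))) *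
      m p.1.1 * psi p.2)); last first.
      by apply/funext => -[[x y] z].
    do 2 apply: continuous_mul3 => //; apply: continuous_add3; apply: continuous_mul3 => //.
    exact: continuous_mul3.
  + rewrite (_ : dprod_fun _ _ _ _ _ _ _ _ _ = (fun p : R * R * R =>
      m p.1.1 * n p.1.2 * F (p.1.1 ^+ 2 + p.1.2 ^+ 2) * dpsi p.2)); last first.
      by apply/funext => -[[x y] z].
    by do 3 apply: continuous_mul3 => //.
- exists [set p | p.1.1 ^+ 2 + p.1.2 ^+ 2 <= rho /\ a <= p.2 <= b]; split.
  (* Then rho <= c^2 whatever the size of rho, so a cube of half-side c contains the horizontal part
     of the support. *)
  + pose c := `|rho| + 1.
    have cc : compact (`[- c, c]%classic `*` `[- c, c]%classic `*` `[a, b]%classic : set (R * R * R)).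
      by do 2 (apply: compact_setX; last exact: segment_compact); exact: segment_compact.
    apply: subclosed_compact cc _.
    * rewrite (_ : mkset _ = (fun p : R * R * R => p.1.1 ^+ 2 + p.1.2 ^+ 2) @^-1` [set x | x <= rho] `&`
        Z @^-1` `[a, b]%classic); last first.
        by apply/seteqP; split => p /=; rewrite in_itv.
      apply: closedI; apply: preimage_closed => //; try exact: closed_le.
      exact: itv_closed.
    * move=> [[x y] z] /= [s_le zab]; rewrite !in_itv/= zab.
      have x2 := sqr_ge0 x; have y2 := sqr_ge0 y.
      have cr : rho <= c ^+ 2.
        by rewrite /c; move: (ler_norm rho) (normr_ge0 rho); nra.
      have c0 : 0 <= c by rewrite addr_ge0.
      have B (t : R) : t ^+ 2 <= rho -> - c <= t <= c.
        move=> t2; rewrite -ler_norml -(ler_sqr) ?nnegrE// real_normK ?num_real//.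
        exact: le_trans cr.
      by rewrite !B//; move: s_le x2 y2; lra.
  + by move=> p [h1 h2]; exact: KU.
  + move=> p /not_andP[/negP|]; rewrite /prod_fun.
      by rewrite -ltNge => /F0 ->; rewrite mulr0 mul0r.
    by move/psi0 ->; rewrite mulr0.
Qed.

End basis_derivatives.

(** * Horizontal slices *)

(* The product measure under a name that can carry a sigma-finite instance,
   which the Fubini theorems on the triple product require. *)
Definition lebesgue2 (R : realType) : set (measurableTypeR R * measurableTypeR R) -> \bar R :=
  (leb1 R \x leb1 R)%E.

HB.instance Definition _ (R : realType) := Measure.copy (@lebesgue2 R) (leb1 R \x leb1 R)%E.

Lemma sigma_finite_lebesgue2 (R : realType) : sigma_finite setT (@lebesgue2 R).
Proof.
have /sigma_finiteP[F [TF ndF Foo]] := sigma_finiteT (leb1 R).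
exists (fun n => F n `*` F n).
  rewrite -setXTT TF predeqE => -[x y]; split.
    move=> [/= [n _ Fnx] [k _ Gky]]; exists (maxn n k) => //; split.
    - by move: x Fnx; exact/subsetPset/ndF/leq_maxl.
    - by move: y Gky; exact/subsetPset/ndF/leq_maxr.
  by move=> [n _ []/= ? ?]; split; exists n.
move=> k; have [? ?] := Foo k.
split; first exact: measurableX.
by rewrite /lebesgue2 product_measure1E// lte_mul_pinfty// ge0_fin_numE.
Qed.

HB.instance Definition _ (R : realType) :=
  Measure_isSigmaFinite.Build _ _ _ (@lebesgue2 R) (@sigma_finite_lebesgue2 R).

Section slices.
Variable R : realType.
Local Notation T2 := (measurableTypeR R * measurableTypeR R)%type.
Local Notation T3 := (measurableTypeR R * measurableTypeR R * measurableTypeR R)%type.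

Lemma sqr_sum_lt1 (x y : R) : x ^+ 2 + y ^+ 2 < 1 -> `|x| <= 1.
Proof.
move=> xy; rewrite -(@ler_pXn2r _ 2) ?nnegrE// real_normK ?num_real// expr1n.
by have := sqr_ge0 y; lra.
Qed.

Lemma measurable_sqr_sum : measurable_fun setT (fun q : T2 => q.1 ^+ 2 + q.2 ^+ 2).
Proof.
by apply: measurable_funD; apply: measurable_funX; [exact: measurable_fst|exact: measurable_snd].
Qed.

Lemma measurable_disk : measurable (@disk R : set T2).
Proof.
rewrite (_ : @disk R = setT `&` (fun q : T2 => q.1 ^+ 2 + q.2 ^+ 2) @^-1` `]-oo, 1[%classic).
  by apply: measurable_sqr_sum => //; exact: measurable_itv.
by apply/seteqP; split => q /=; rewrite /disk/= in_itv/= => // -[].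
Qed.

Lemma measurable_cylinder : measurable (@cylinder R : set T3).
Proof.
rewrite (_ : @cylinder R = @disk R `*` `]0, +oo[%classic).
  by apply: measurableX; [exact: measurable_disk|exact: measurable_itv].
by apply/seteqP; split => q /=; rewrite /cylinder/= in_itv/= andbT.
Qed.

(** Contains the part of the cylinder below height N; only the linear growth of its measure in N
    matters. *)
Definition box (N : R) : set T3 := `[-1, 1]%classic `*` `[-1, 1]%classic `*` `[0, N]%classic.

Lemma measurable_box N : measurable (box N).
Proof. by do 2 (apply: measurableX; last exact: measurable_itv); exact: measurable_itv. Qed.

Lemma box_measure N : 0 <= N -> leb3 R (box N) = (4 * N)%:E.
Proof.
move=> N0; rewrite product_measure1E; last 2 first.
- by apply: measurableX; exact: measurable_itv.
- exact: measurable_itv.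
rewrite [X in (X * _)%E](_ : _ = 4%:E).
  rewrite /= lebesgue_measure_itv/= lte_fin; case: ltP => [_|N0'].
    by rewrite oppr0 adde0 EFinM.
  have -> : N = 0 by apply/le_anti; rewrite N0' N0.
  by rewrite mulr0 mule0.
rewrite /= product_measure1E; try exact: measurable_itv.
rewrite /= lebesgue_measure_itv/= lte_fin ifT; last lra.
by rewrite -EFinB -EFinM; congr EFin; ring.
Qed.

Lemma cylinder_box (p : T3) (N : R) : cylinder p -> p.2 <= N -> box N p.
Proof.
move=> [pd p0] pN; split => /=; last by rewrite in_itv/= ltW.
split => /=; rewrite in_itv/= -ler_norml; first exact: sqr_sum_lt1 pd.
by apply: (@sqr_sum_lt1 _ p.1.1); rewrite addrC.
Qed.

Lemma integrable_indic_box N : 0 <= N -> (leb3 R).-integrable setT (EFin \o \1_(box N)).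
Proof.
move=> N0; apply/integrableP; split.
  by apply/measurable_EFinP; exact: measurable_indic (measurable_box N).
under eq_integral do rewrite /= ger0_norm ?indic_ge0//.
rewrite integral_indic//; last exact: measurable_box.
by rewrite setIT; have := box_measure N0 => /= ->; rewrite ltry.
Qed.

Variable k : T3 -> R.
Hypothesis ksq : square_integrable (leb3 R) (@cylinder R) k.

Definition ext : T3 -> R := k \_ (@cylinder R).

Lemma ext0 p : ~ cylinder p -> ext p = 0.
Proof. by move=> np; rewrite /ext patchE ifF//; apply/negP; rewrite inE. Qed.

Lemma measurable_ext : measurable_fun setT ext.
Proof.
apply/(measurable_restrictT _ measurable_cylinder).
exact: ksq.1.
Qed.

(** Uses |t| <= 1 + t^2 in place of the Cauchy-Schwarz inequality. The first term integrates to 4 N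
    and the second to a constant, which is the source of the linear growth in N. *)
Definition dominant (N : R) (p : T3) : R := \1_(box N) p + ext p ^+ 2.

Lemma integrable_ext_sqr : (leb3 R).-integrable setT (fun p => (ext p ^+ 2)%:E).
Proof.
have h : (leb3 R).-integrable (@cylinder R) (fun p => (k p ^+ 2)%:E).
  apply/integrableP; split.
    by apply/measurable_EFinP; apply: measurable_funX; exact: ksq.1.
  by under eq_integral do rewrite /= ger0_norm ?sqr_ge0//; exact: ksq.2.
have /integrable_mkcond := h => /(_ measurable_cylinder).
apply: eq_integrable => // p _; rewrite /ext !patchE.
by case: ifPn => // _; rewrite expr0n.
Qed.

Lemma integrable_dominant N : 0 <= N -> (leb3 R).-integrable setT (EFin \o dominant N).
Proof.
move=> N0; have := integrableD measurableT (integrable_indic_box N0) integrable_ext_sqr.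
exact: eq_integrable.
Qed.

Lemma dominant_ge0 N p : 0 <= dominant N p.
Proof. by rewrite addr_ge0 ?sqr_ge0 ?indic_ge0. Qed.

Lemma dominantP N p : p.2 <= N -> `|ext p| <= dominant N p.
Proof.
move=> pN; have [cp|ncp] := pselect (cylinder p); last first.
  by rewrite ext0// normr0 dominant_ge0.
rewrite /dominant indicE mem_set/=; last exact: cylinder_box.
by rewrite -(real_normK (num_real (ext p))); have := normr_ge0 (ext p); nra.
Qed.

Variables (b : T2 -> R) (B : R).
Hypothesis mb : measurable_fun setT b.
Hypothesis B0 : 0 <= B.
Hypothesis bB : forall q, disk q -> `|b q| <= B.

(** The integral is real-valued, hence defined for every z, with a default value where the slice is
    not integrable; such z form a null set. *)
Definition slice (z : R) : R := \int[leb2 R]_q (ext (q, z) * b q).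

Lemma slice0 z : z <= 0 -> slice z = 0.
Proof.
move=> z0; rewrite /slice (@Rintegral_support _ _ _ (leb2 R) setT set0) ?Rintegral_set0//.
by move=> q _ _; rewrite ext0 ?mul0r// => -[_] /=; rewrite ltNge z0.
Qed.

Lemma ext_mul_dominated (psi : R -> R) (C N : R) p : 0 <= C ->
  (forall z, `|psi z| <= C) -> (forall z, N < z -> psi z = 0) ->
  `|ext p * (b p.1 * psi p.2)| <= B * C * dominant N p.
Proof.
move=> C0 psiC psiN; have [pN|Np] := leP p.2 N; last first.
  by rewrite psiN// !mulr0 normr0 !mulr_ge0// dominant_ge0.
have [cp|ncp] := pselect (cylinder p); last first.
  by rewrite ext0// mul0r normr0 !mulr_ge0// dominant_ge0.
rewrite normrM mulrC ler_pM// ?dominantP//.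
by rewrite normrM ler_pM// bB; case: cp.
Qed.

Lemma integrable_ext_mul (psi : R -> R) (C N : R) : 0 <= N -> 0 <= C ->
  measurable_fun setT psi -> (forall z, `|psi z| <= C) -> (forall z, N < z -> psi z = 0) ->
  (leb3 R).-integrable setT (fun p => (ext p * (b p.1 * psi p.2))%:E).
Proof.
move=> N0 C0 mpsi psiC psiN.
have mf : measurable_fun setT (fun p : T3 => ext p * (b p.1 * psi p.2)).
  apply: measurable_funM; first exact: measurable_ext.
  apply: measurable_funM; first exact: measurableT_comp mb measurable_fst.
  exact: measurableT_comp mpsi measurable_snd.
have := integrableZl measurableT (B * C) (integrable_dominant N0).
apply: le_integrable => //; first exact/measurable_EFinP.
move=> p _; apply: (@le_trans _ _ (B * C * dominant N p)%:E).
  by rewrite lee_fin ext_mul_dominated.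
by rewrite lee_fin ler_norm.
Qed.

(** The cylinder has infinite volume, so a square integrable function need not be integrable on it;
    Fubini is applied below height N. *)
Definition cut (N z : R) : R := if z <= N then 1 else 0.

Lemma measurable_cut N : measurable_fun setT (cut N).
Proof. by apply: measurable_fun_ifT => //; exact: measurable_fun_ler. Qed.

Lemma cut_bound N z : `|cut N z| <= 1.
Proof. by rewrite /cut; case: ifP; rewrite ?normr1 ?normr0. Qed.

Lemma cut0 N z : N < z -> cut N z = 0.
Proof. by move=> Nz; rewrite /cut leNgt Nz. Qed.

Definition cutf (N : R) (p : T3) : \bar R := (ext p * (b p.1 * cut N p.2))%:E.

Lemma integrable_cutf N : 0 <= N -> (leb3 R).-integrable setT (cutf N).
Proof.
move=> N0; apply: (integrable_ext_mul N0 ler01); [exact: measurable_cut|exact: cut_bound|exact: cut0].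
Qed.

Lemma fine_fubini_cutf N z : z <= N ->
  slice z = fine (fubini_G (@lebesgue2 R) (cutf N) z).
Proof.
move=> zN; rewrite /slice /fubini_G; congr fine; apply: eq_integral => q _.
by rewrite /cutf /= /cut zN mulr1.
Qed.

Lemma fubini_G_le (f : T3 -> \bar R) : (leb3 R).-integrable setT f ->
  (\int[leb1 R]_z `|fubini_G (@lebesgue2 R) f z| <= \int[leb3 R]_p `|f p|)%E.
Proof.
move=> fi; have mf := measurable_int _ fi.
have mF : measurable_fun setT (abse \o f) by exact: measurableT_comp.
have f0 p : (0 <= (abse \o f) p)%E by exact: abse_ge0.
have := @fubini_tonelli2 _ _ _ _ R (@lebesgue2 R) (leb1 R) (abse \o f) mF f0.
rewrite -/(leb3 R) => ->.
apply: ge0_le_integral => //.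
- apply: measurableT_comp => //.
  exact: (@measurable_fubini_G _ _ _ _ R (@lebesgue2 R) (leb1 R) f fi).
- exact: (@measurable_fun_fubini_tonelli_G _ _ _ _ R (@lebesgue2 R) (abse \o f) mF f0).
- move=> z _; apply: le_abse_integral => //.
  by apply: (measurableT_comp mf); exact: pair2_measurable.
Qed.

Lemma integrable_fubini_cutf N : 0 <= N ->
  (leb1 R).-integrable setT (fubini_G (@lebesgue2 R) (cutf N)).
Proof.
move=> N0; have /integrableP[_ foo] := integrable_cutf N0.
apply/integrableP; split.
  exact: (@measurable_fubini_G _ _ _ _ R (@lebesgue2 R) (leb1 R) (cutf N) (integrable_cutf N0)).
exact: le_lt_trans (fubini_G_le (integrable_cutf N0)) foo.
Qed.

Lemma locint_slice : locint slice.
Proof.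
move=> N; have [N0|N0] := leP 0 N; last first.
  have mI : measurable (`]-oo, N]%classic : set (measurableTypeR R)) by exact: measurable_itv.
  apply: (@eq_integrable _ _ _ (leb1 R) _ mI (cst 0%E)); last exact: integrable0.
  move=> z; rewrite inE/= in_itv/= => zN; rewrite slice0//.
  by rewrite (le_trans zN)// ltW.
have mI : measurable (`]-oo, N]%classic : set (measurableTypeR R)) by exact: measurable_itv.
have iG := integrable_fubini_cutf N0.
have iG' : (leb1 R).-integrable `]-oo, N] (fubini_G (@lebesgue2 R) (cutf N)).
  exact: integrableS iG.
apply: (@eq_integrable _ _ _ (leb1 R) _ mI (fun z => (fine (fubini_G (@lebesgue2 R) (cutf N) z))%:E)).
  by move=> z; rewrite inE/= in_itv/= => zN; rewrite -fine_fubini_cutf.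
apply: le_integrable iG' => //.
  apply/measurable_EFinP; apply: measurableT_comp => //.
  by apply: measurable_funTS; exact: measurable_int iG.
by move=> z _; case: (fubini_G _ _ z) => [r||]//=; rewrite ?normr0 leey.
Qed.

Lemma slice_growth N : 0 <= N ->
  \int[leb1 R]_(z in `]-oo, N]) `|slice z| <=
  B * (4 * N + \int[leb3 R]_p (ext p ^+ 2)).
Proof.
move=> N0; rewrite -lee_fin.
have mI : measurable (`]-oo, N]%classic : set (measurableTypeR R)) by exact: measurable_itv.
have iG := integrable_fubini_cutf N0.
rewrite fineK; last first.
  by apply: integrable_fin_num => //; exact: integrable_norm (locint_slice N).
apply: (@le_trans _ _ (\int[leb1 R]_z `|fubini_G (@lebesgue2 R) (cutf N) z|)%E).
  apply: (@le_trans _ _ (\int[leb1 R]_(z in `]-oo, N]%classic) `|fubini_G (@lebesgue2 R) (cutf N) z|)%E).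
    apply: ge0_le_integral => //.
    - apply/measurable_EFinP; apply: measurableT_comp => //.
      apply: measurable_funTS; exact: locint_measurable locint_slice.
    - apply: measurableT_comp => //; apply: measurable_funTS; exact: measurable_int iG.
    - move=> z /=; rewrite in_itv/= => zN; rewrite (fine_fubini_cutf zN).
      by case: (fubini_G _ _ z) => [r||]//=; rewrite ?normr0 leey.
  apply: ge0_subset_integral => //.
  by apply: measurableT_comp => //; exact: measurable_int iG.
apply: (le_trans (fubini_G_le (integrable_cutf N0))).
apply: (@le_trans _ _ (\int[leb3 R]_p (B * dominant N p)%:E)%E).
  apply: ge0_le_integral => //.
  - by apply: measurableT_comp => //; exact: measurable_int (integrable_cutf N0).
  - have := integrableZl measurableT B (integrable_dominant N0).
    by move/measurable_int.
  - move=> p _; rewrite /cutf lee_fin.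
    by rewrite -[B]mulr1 (ext_mul_dominated p ler01 (cut_bound N) (@cut0 N)).
have -> : (\int[leb3 R]_p (B * dominant N p)%:E)%E = (B%:E * \int[leb3 R]_p (dominant N p)%:E)%E.
  by rewrite -integralZl//; exact: integrable_dominant.
rewrite EFinM lee_wpmul2l ?lee_fin//.
rewrite (_ : (\int[leb3 R]_p (dominant N p)%:E)%E =
   (\int[leb3 R]_p (\1_(box N) p)%:E + \int[leb3 R]_p (ext p ^+ 2)%:E)%E); last first.
  rewrite -integralD//; first exact: integrable_indic_box.
  exact: integrable_ext_sqr.
rewrite integral_indic//; last exact: measurable_box.
rewrite setIT; have := box_measure N0 => /= ->; rewrite EFinD leeD2l// fineK//.
by apply: integrable_fin_num => //; exact: integrable_ext_sqr.
Qed.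

Lemma integral_slice (psi : R -> R) (C N : R) : 0 <= N -> 0 <= C ->
  measurable_fun setT psi -> (forall z, `|psi z| <= C) -> (forall z, N < z -> psi z = 0) ->
  \int[leb3 R]_(p in @cylinder R) (k p * (b p.1 * psi p.2)) =
  \int[leb1 R]_z (slice z * psi z).
Proof.
move=> N0 C0 mpsi psiC psiN.
have fi := integrable_ext_mul N0 C0 mpsi psiC psiN.
pose f (p : T3) := (ext p * (b p.1 * psi p.2))%:E.
transitivity (fine (\int[leb3 R]_p f p)).
  rewrite Rintegral_mkcond; congr fine; apply: eq_integral => p _; congr EFin.
  by rewrite /ext !patchE; case: ifPn; rewrite ?mul0r.
have <- := @integral21_prod_meas1 _ _ _ _ R (@lebesgue2 R) (leb1 R) f fi.
congr fine; apply: ae_eq_integral => //.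
- exact: (@measurable_fubini_G _ _ _ _ R (@lebesgue2 R) (leb1 R) f fi).
- apply/measurable_EFinP; apply: measurable_funM => //.
  exact: locint_measurable locint_slice.
- have h : {ae leb1 R, forall z, (@lebesgue2 R).-integrable setT (fun q => f (q, z))}.
    exact: (@ae_integrable2 _ _ _ _ R (@lebesgue2 R) (leb1 R) f fi).
  suff : {ae leb1 R, forall z, setT z -> fubini_G (@lebesgue2 R) f z = (slice z * psi z)%:E} by [].
  apply: ae_imply h => z iz _; rewrite /fubini_G /f/=.
  (* Where psi z = 0 the slice may fail to be integrable, but both sides vanish; elsewhere division
     by psi z recovers its integrability. *)
  have [p0|p0] := eqVneq (psi z) 0.
    by rewrite p0 mulr0; under eq_integral do rewrite !mulr0; rewrite integral0.
  have ib : (@lebesgue2 R).-integrable setT (fun q => (ext (q, z) * b q)%:E).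
    have := integrableZl measurableT (psi z)^-1 iz.
    apply: eq_integrable => // q _; rewrite /f/= -EFinM; congr EFin.
    by rewrite mulrCA [b q * _]mulrC [(psi z)^-1 * _]mulrA mulVf// mul1r.
  rewrite /slice /Rintegral EFinM fineK; last exact: integrable_fin_num.
  rewrite -integralZr//; apply: eq_integral => q _.
  by rewrite -EFinM mulrA.
Qed.

(** Countably many heights n exhaust the half-line, so the null sets add up to a null set. The
    result justifies polar coordinates on almost every slice. *)
Lemma ae_integrable_slice :
  {ae leb1 R, forall z, (leb2 R).-integrable setT (fun q : T2 => (ext (q, z) * b q)%:E)}.
Proof.
have h (n : nat) : {ae leb1 R, forall z, (@lebesgue2 R).-integrable setT (fun q => cutf n%:R (q, z))}.
  exact: (@ae_integrable2 _ _ _ _ R (@lebesgue2 R) (leb1 R) _ (integrable_cutf (ler0n _ n))).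
apply: ae_imply (ae_foralln h) => z iz.
have [n zn] : exists n : nat, z <= n%:R.
  exists (Num.bound `|z|); exact: (le_trans (ler_norm z) (ltW (archi_boundP (normr_ge0 z)))).
apply: eq_integrable (iz n) => // q _.
by rewrite /cutf /= /cut zn mulr1.
Qed.

End slices.

(** * Reduction to a single mode *)

Section reduction.
Variable R : realType.
Local Notation T2 := (measurableTypeR R * measurableTypeR R)%type.
Local Notation T3 := (measurableTypeR R * measurableTypeR R * measurableTypeR R)%type.

Lemma integrable_cylinder (k : T3 -> R) (b : T2 -> R) (psi : R -> R) (B C N : R) :
  square_integrable (leb3 R) (@cylinder R) k ->
  measurable_fun setT b -> 0 <= B -> (forall q, disk q -> `|b q| <= B) ->
  0 <= N -> 0 <= C ->
  measurable_fun setT psi -> (forall z, `|psi z| <= C) -> (forall z, N < z -> psi z = 0) ->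
  (leb3 R).-integrable (@cylinder R) (fun p => (k p * (b p.1 * psi p.2))%:E).
Proof.
move=> ksq mb B0 bB N0 C0 mpsi psiC psiN.
apply/(integrable_mkcond _ (@measurable_cylinder R)).
have := integrable_ext_mul ksq mb B0 bB N0 C0 mpsi psiC psiN.
apply: eq_integrable => // p _; rewrite /ext !patchE.
by case: ifPn; rewrite ?mul0r.
Qed.

Lemma bes_bounded (m : nat) (mu : R) :
  exists2 B, 0 <= B & forall s : R, 0 <= s <= 1 -> `|bes m (mu * s)| <= B.
Proof.
have cb : continuous (fun s : R => bes m (mu * s)).
  move=> s; apply: (@continuous_comp _ _ _ ( *%R mu)); first exact: cvgMl_tmp.
  exact: (is_derive_continuous (is_derive_bes m)).
have := continuous_compact (continuous_subspaceT cb) (@segment_compact R 0 1).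
move=> /compact_bounded[M [_ hM]].
exists (`|M| + 1); first by rewrite addr_ge0.
move=> s s01; apply: hM; first by rewrite (le_lt_trans (ler_norm M))// ltrDl.
by exists s.
Qed.

Lemma C1_compact_bounded (psi dpsi : R -> R) (a b : R) : C1_compact psi dpsi a b ->
  exists2 C, 0 <= C & forall z, `|psi z| <= C /\ `|dpsi z| <= C.
Proof.
move=> [Dpsi cdpsi psi0].
have cpsi := is_derive_continuous Dpsi.
(* The margin 1 around [a, b] ensures that beyond it psi vanishes on a neighbourhood, so [dpsi]
   vanishes too. *)
have bnd (f : R -> R) : continuous f -> exists2 C, 0 <= C & forall z, a - 1 <= z <= b + 1 -> `|f z| <= C.
  move=> cf; have := continuous_compact (continuous_subspaceT cf) (@segment_compact R (a - 1) (b + 1)).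
  move=> /compact_bounded[M [_ hM]].
  exists (`|M| + 1); first by rewrite addr_ge0.
  move=> s s01; apply: hM; first by rewrite (le_lt_trans (ler_norm M))// ltrDl.
  by exists s.
have [C1 C10 hC1] := bnd _ cpsi; have [C2 C20 hC2] := bnd _ cdpsi.
exists (C1 + C2); first by rewrite addr_ge0.
move=> z; have [zab|zab] := boolP (a - 1 <= z <= b + 1).
  by rewrite (le_trans (hC1 z zab)) ?lerDl// (le_trans (hC2 z zab)) ?lerDr.
have z0 : psi z = 0.
  apply: psi0 => /andP[h1 h2]; move: zab; rewrite negb_and -!ltNge => /orP[|]; lra.
have dz0 : dpsi z = 0.
  have h := Dpsi z; rewrite -(@derive_val _ _ _ _ _ _ _ h).
  have E : \forall y \near z, 0 = psi y.
    move: zab; rewrite negb_and -!ltNge => /orP[za|zb].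
      near=> y; rewrite psi0// => /andP[h1 h2].
      have : y < a - 1 by near: y; exact: lt_nbhsl.
      lra.
    near=> y; rewrite psi0// => /andP[h1 h2].
    have : b + 1 < y by near: y; exact: lt_nbhsr.
    lra.
  by rewrite -(near_eq_derive _ E) derive_cst.
by rewrite z0 dz0 normr0 addr_ge0.
Unshelve. all: end_near. Qed.

Lemma C1_compact_support (psi dpsi : R -> R) (a b : R) : C1_compact psi dpsi a b ->
  forall z, `|b| + 1 < z -> psi z = 0 /\ dpsi z = 0.
Proof.
move=> [Dpsi cdpsi psi0] z bz.
have nb y : `|b| < y -> psi y = 0.
  move=> y0; apply: psi0 => /andP[_ yb].
  by have := le_lt_trans (le_trans yb (ler_norm b)) y0; rewrite ltxx.
split; first by apply: nb; apply: lt_trans bz; rewrite ltrDl.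
have h := Dpsi z; rewrite -(@derive_val _ _ _ _ _ _ _ h).
have E : \forall y \near z, 0 = psi y.
  near=> y; rewrite nb//; near: y; apply: lt_nbhsr; apply: lt_trans bz; by rewrite ltrDl.
by rewrite -(near_eq_derive _ E) derive_cst.
Unshelve. all: end_near. Qed.

Variable lam : R.
Hypothesis lam0 : 0 < lam.
Hypothesis Jlam : besselJ 0 lam = 0.

Let mu : R := (lam / 2) ^+ 2.
Let Phi (s : R) : R := bes 0 (mu * s).
Let dPhi (s : R) : R := - mu * bes 1 (mu * s).

(* The mode J_0 (lam |q|), followed by its two partial derivatives. *)
Let mode (q : T2) : R := Phi (q.1 ^+ 2 + q.2 ^+ 2).
Let mode1 (q : T2) : R := q.1 * (2 * dPhi (q.1 ^+ 2 + q.2 ^+ 2)).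
Let mode2 (q : T2) : R := q.2 * (2 * dPhi (q.1 ^+ 2 + q.2 ^+ 2)).

Lemma is_derive_bes_scale m (k s : R) :
  is_derive s 1 (fun s => bes m (k * s)) (- k * bes m.+1 (k * s)).
Proof.
have h1 : is_derive s 1 (fun s : R => k * s) k.
  by apply: is_derive_eq; rewrite /GRing.scale/= mulr1.
have := @is_derive1_comp _ (@bes R m) (fun s => k * s) s _ _ (is_derive_bes m (k * s)) h1.
by rewrite mulNr [_ * k]mulrC -mulNr.
Qed.

Lemma is_derive_Phi (s : R) : is_derive s 1 Phi (dPhi s).
Proof. exact: is_derive_bes_scale. Qed.

Lemma is_derive_dPhi (s : R) : is_derive s 1 dPhi (mu ^+ 2 * bes 2 (mu * s)).
Proof.
have h := is_derive_bes_scale 1 mu s.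
by apply: is_derive_eq; rewrite /GRing.scale/=; ring.
Qed.

Lemma Phi1 : Phi 1 = 0.
Proof. by move: Jlam; rewrite besselJE expr0 mul1r /Phi mulr1. Qed.

Lemma disk_sqr_sum (q : T2) : disk q -> 0 <= q.1 ^+ 2 + q.2 ^+ 2 <= 1.
Proof. by rewrite /disk/= => /ltW ->; rewrite addr_ge0 ?sqr_ge0. Qed.

Lemma mode_bounds : exists2 B, 0 <= B &
  [/\ measurable_fun setT mode, measurable_fun setT mode1, measurable_fun setT mode2 &
   [/\ forall q, disk q -> `|mode q| <= B, forall q, disk q -> `|mode1 q| <= B,
    forall q, disk q -> `|mode2 q| <= B &
    forall s, 0 <= s <= 1 -> `|Phi s| <= B /\ `|2 * dPhi s| <= B]].
Proof.
have [C0 C00 hC0] := bes_bounded 0 mu; have [C1 C10 hC1] := bes_bounded 1 mu.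
have mu0 : 0 <= mu by exact: sqr_ge0.
have m20 : 0 <= 2 * mu by apply: mulr_ge0.
have m2C : 0 <= 2 * mu * C1 by apply: mulr_ge0.
pose B := C0 + 2 * mu * C1.
have B0 : 0 <= B by apply: addr_ge0.
have PB s : 0 <= s <= 1 -> `|Phi s| <= B /\ `|2 * dPhi s| <= B.
  move=> s01; split; first by rewrite (le_trans (hC0 s s01))// /B lerDl.
  rewrite /dPhi mulrA mulrN mulNr normrN normrM (ger0_norm m20).
  by apply: (@le_trans _ _ (2 * mu * C1)); rewrite /B ?lerDr// ler_wpM2l// hC1.
have mPhi : measurable_fun setT Phi.
  by apply: continuous_measurable_fun; exact: (is_derive_continuous is_derive_Phi).
have mdPhi : measurable_fun setT dPhi.
  by apply: continuous_measurable_fun; exact: (is_derive_continuous is_derive_dPhi).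
have mP : measurable_fun setT mode
  by have := measurableT_comp mPhi (measurable_sqr_sum (R := R)); exact.
have mdP : measurable_fun setT (fun q : T2 => 2 * dPhi (q.1 ^+ 2 + q.2 ^+ 2)).
  apply: measurable_funM => //.
  by have := measurableT_comp mdPhi (measurable_sqr_sum (R := R)); exact.
exists B => //; split => //.
- by apply: measurable_funM => //; exact: measurable_fst.
- by apply: measurable_funM => //; exact: measurable_snd.
split => // q qd.
- by have [] := PB _ (disk_sqr_sum qd).
- rewrite normrM -[B]mul1r ler_pM// ?(PB _ (disk_sqr_sum qd)).2//.
  exact: sqr_sum_lt1 qd.
- rewrite normrM -[B]mul1r ler_pM// ?(PB _ (disk_sqr_sum qd)).2//.
  by apply: (@sqr_sum_lt1 _ _ q.1); rewrite addrC.
Qed.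

Lemma integrable_mode_sqr : (leb2 R).-integrable (@disk R) (fun q => (mode q ^+ 2)%:E).
Proof.
have [B B0 [mm _ _ [mB _ _ _]]] := mode_bounds.
apply: (@measurable_bounded_integrable _ _ _ (leb2 R) (fun q => mode q ^+ 2)).
- exact: measurable_disk.
- apply: (@le_lt_trans _ _ (leb2 R (`[-1, 1]%classic `*` `[-1, 1]%classic))).
    apply: le_measure; rewrite ?inE; first exact: measurable_disk.
      by apply: measurableX; exact: measurable_itv.
    move=> q qd; have cq : cylinder (q, 1 : R) by split => //=.
    by have [] := cylinder_box cq (lexx _).
  rewrite /= product_measure1E; try exact: measurable_itv.
  rewrite /= lebesgue_measure_itv/= lte_fin ifT; last lra.
  by rewrite -EFinB -EFinM ltry.
- by apply: measurable_funTS; apply: measurable_funX.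
- exists (B ^+ 2); split; first exact: num_real.
  move=> r rb q /= qd; apply: le_trans (ltW rb).
  by rewrite normrX lerXn2r ?nnegrE// mB.
Qed.

(** * Weak equations for the coefficient functions *)

Variables (u : T3 -> R) (g : 'I_3 -> T3 -> R) (f : R * R -> R).
Hypothesis usq : square_integrable (leb3 R) (@cylinder R) u.
Hypothesis gsq : forall i, square_integrable (leb3 R) (@cylinder R) (g i).
Hypothesis fdata : dirichlet_data u g f.
Hypothesis fmode : forall q, disk q -> f q = mode q.

Let i0 : 'I_3 := Ordinal (isT : (0 < 3)%N).
Let i1 : 'I_3 := Ordinal (isT : (1 < 3)%N).
Let i2 : 'I_3 := Ordinal (isT : (2 < 3)%N).
(* U and G3 are the coefficients of u and of its vertical derivative on the mode;
   G pairs the horizontal gradient of u with that of the mode. *)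
Let U := slice u mode.
Let G3 := slice (g i2) mode.
Let G z := slice (g i0) mode1 z + slice (g i1) mode2 z.

(* A C^1 cut-off equal to 1 on the unit disk makes the modes admissible test functions. *)
Let chi (s : R) : R := step 1 1 s.

Lemma cutoff_derive (F dF : R -> R) : (forall s : R, is_derive s 1 F (dF s)) -> continuous dF ->
  exists dF1 : R -> R,
  [/\ forall s : R, is_derive s 1 (fun s => F s * chi s) (dF1 s), continuous dF1,
      forall s, s < 1 -> F s * chi s = F s /\ dF1 s = dF s &
      forall s, 2 < s -> F s * chi s = 0].
Proof.
move=> DF cdF; exists (fun s => dF s * chi s + F s * dstep 1 1 s); split.
- move=> s; have h1 := DF s; have h2 := is_derive_step 1 1 s.
  by apply: is_derive_eq; rewrite /GRing.scale/=; ring.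
- move=> s; apply: cvgD; apply: cvgM.
  + exact: cdF.
  + exact: continuous_step.
  + exact: (is_derive_continuous DF).
  + exact: continuous_dstep.
- move=> s s1; rewrite /chi step1 ?ltW// !mulr1 dstep0 ?mulr0 ?addr0//.
  by left; exact: ltW.
- by move=> s s2; rewrite /chi step0 ?mulr0//; lra.
Qed.

(** The vertical Gauss-Green identity tested with the mode times psi. The trace on the bottom is the
    mode itself, whence its squared norm. *)
Lemma weak_vertical (psi dpsi : R -> R) (a b : R) : C1_compact psi dpsi a b ->
  \int[leb1 R]_z (U z * dpsi z + G3 z * psi z) =
  - ((\int[leb2 R]_(q in @disk R) (mode q ^+ 2)) * psi 0).
Proof.
move=> hpsi; have [C C0 hC] := C1_compact_bounded hpsi.
have hN := C1_compact_support hpsi.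
pose N := `|b| + 1; have N0 : 0 <= N by rewrite addr_ge0.
have [B B0 [mm _ _ [mB _ _ _]]] := mode_bounds.
have mpsi : measurable_fun setT psi.
  by case: hpsi => Dpsi _ _; apply: continuous_measurable_fun; exact: (is_derive_continuous Dpsi).
have mdpsi : measurable_fun setT dpsi.
  by case: hpsi => _ cdpsi _; exact: continuous_measurable_fun.
have cdPhi := is_derive_continuous is_derive_dPhi.
have [dF1 [DF cdF Fin Fout]] := cutoff_derive is_derive_Phi cdPhi.
pose phi := prod_fun (cst 1) (cst 1) (fun s => Phi s * chi s) psi.
have D1 (x : R) : is_derive x 1 (cst (1 : R)) (cst 0 x) by exact: is_derive_cst.
have ccst (c : R) : continuous (fun _ : R => c) by exact: cst_continuous.
have tphi : test_function setT phi.
  exact: (test_function_prod D1 D1 DF (ccst 0) (ccst 0) cdF hpsi Fout).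
have := fdata i2 tphi.
have -> : - (basis3 R i2).2 = -1 by [].
rewrite mulN1r.
have Dphi p := is_derive_prod_fun i2 p D1 D1 DF (let: And3 h _ _ := hpsi in h).
have pin p : cylinder p -> phi p = mode p.1 * psi p.2.
  by move=> [pd _]; rewrite /phi /prod_fun /= !mul1r (Fin _ pd).1.
have dpin p : cylinder p -> 'D_(basis3 R i2) phi p = mode p.1 * dpsi p.2.
  move=> [pd _]; have h := Dphi p; rewrite derive_val /dprod_fun.
  by case: p pd {h} => -[x y] z pd /=; rewrite !mul1r (Fin _ pd).1.
have -> : \int[leb3 R]_(p in @cylinder R)
      (u p * 'D_(basis3 R i2) phi p + g i2 p * phi p) =
   \int[leb3 R]_(p in @cylinder R) (u p * (mode p.1 * dpsi p.2) + g i2 p * (mode p.1 * psi p.2)).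
  by apply: eq_Rintegral => p; rewrite inE => pc; rewrite pin// dpin.
have psiC z := (hC z).1; have dpsiC z := (hC z).2.
have psiN z (h : N < z) := (hN z h).1; have dpsiN z (h : N < z) := (hN z h).2.
have mcyl := @measurable_cylinder R.
rewrite RintegralD//; last 2 first.
- exact: (integrable_cylinder usq mm B0 mB N0 C0 mdpsi dpsiC dpsiN).
- exact: (integrable_cylinder (gsq _) mm B0 mB N0 C0 mpsi psiC psiN).
rewrite (integral_slice usq mm B0 mB N0 C0 mdpsi dpsiC dpsiN).
rewrite (integral_slice (gsq _) mm B0 mB N0 C0 mpsi psiC psiN).
rewrite -RintegralD//; last 2 first.
- exact: (locint_mul (locint_slice usq mm B0 mB) mdpsi dpsiC dpsiN).
- exact: (locint_mul (locint_slice (gsq _) mm B0 mB) mpsi psiC psiN).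
move=> ->; congr (- _).
transitivity (\int[leb2 R]_(q in @disk R) (mode q ^+ 2 * psi 0)).
  apply: eq_Rintegral => q; rewrite inE => qd.
  by rewrite /phi /prod_fun/= !mul1r (Fin _ qd).1 -/(mode q) fmode// mulrA.
rewrite RintegralZr//; first exact: measurable_disk.
exact: integrable_mode_sqr.
Qed.

(* Minus the Laplacian of the mode is lam^2 times the mode. *)
Lemma weak_radial (psi dpsi : R -> R) (a b : R) : C1_compact psi dpsi a b ->
  \int[leb1 R]_z ((lam ^+ 2 * U z - G z) * psi z) = 0.
Proof.
move=> hpsi; have [C C0 hC] := C1_compact_bounded hpsi.
have hN := C1_compact_support hpsi.
pose N := `|b| + 1; have N0 : 0 <= N by rewrite addr_ge0.
have [B B0 [mm mm1 mm2 [mB m1B m2B PB]]] := mode_bounds.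
have [C2 C20 hC2] := bes_bounded 2 mu.
have mpsi : measurable_fun setT psi.
  by case: hpsi => Dpsi _ _; apply: continuous_measurable_fun; exact: (is_derive_continuous Dpsi).
pose F (s : R) := 2 * dPhi s; pose dF (s : R) := 2 * (mu ^+ 2 * bes 2 (mu * s)).
have DF (s : R) : is_derive s 1 F (dF s).
  have := @is_deriveZ _ _ _ dPhi 2 s 1 _ (is_derive_dPhi s); exact.
have cdF : continuous dF.
  move=> s; do 2 apply: cvgMl_tmp.
  exact: (is_derive_continuous (is_derive_bes_scale 2 mu)).
have [dF1 [DF1 cdF1 Fin Fout]] := cutoff_derive DF cdF.
have D1 (x : R) : is_derive x 1 (cst (1 : R)) (cst 0 x) by exact: is_derive_cst.
have Did (x : R) : is_derive x 1 (@id R) (cst 1 x) by exact: is_derive_id.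
have ccst (c : R) : continuous (fun _ : R => c) by exact: cst_continuous.
pose phi0 := prod_fun id (cst 1) (fun s => F s * chi s) psi.
pose phi1 := prod_fun (cst 1) id (fun s => F s * chi s) psi.
have t0 : test_function setT phi0.
  exact: (test_function_prod Did D1 DF1 (ccst 1) (ccst 0) cdF1 hpsi Fout).
have t1 : test_function setT phi1.
  exact: (test_function_prod D1 Did DF1 (ccst 0) (ccst 1) cdF1 hpsi Fout).
(* [c fst] and [c snd] are the second partial derivatives of the mode in x and in y. *)
pose c (x : T2 -> R) (q : T2) := F (q.1 ^+ 2 + q.2 ^+ 2) + x q * (2 * x q * dF (q.1 ^+ 2 + q.2 ^+ 2)).
have [Dpsi _ _] := hpsi.
have in0 p : cylinder p -> phi0 p = mode1 p.1 * psi p.2 /\ 'D_(basis3 R i0) phi0 p = c fst p.1 * psi p.2.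
  move=> [pd _]; split; first by rewrite /phi0 /prod_fun /= mulr1 (Fin _ pd).1.
  have h := is_derive_prod_fun i0 p Did D1 DF1 Dpsi; rewrite derive_val /dprod_fun /c.
  by case: p pd {h} => -[x y] z pd /=; rewrite !mulr1 mul1r (Fin _ pd).1 (Fin _ pd).2.
have in1 p : cylinder p -> phi1 p = mode2 p.1 * psi p.2 /\ 'D_(basis3 R i1) phi1 p = c snd p.1 * psi p.2.
  move=> [pd _]; split; first by rewrite /phi1 /prod_fun /= mul1r (Fin _ pd).1.
  have h := is_derive_prod_fun i1 p D1 Did DF1 Dpsi; rewrite derive_val /dprod_fun /c.
  by case: p pd {h} => -[x y] z pd /=; rewrite !mulr1 mul1r (Fin _ pd).1 (Fin _ pd).2.
have mF : measurable_fun setT (fun q : T2 => F (q.1 ^+ 2 + q.2 ^+ 2)).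
  have mF' : measurable_fun setT F by apply: continuous_measurable_fun; exact: (is_derive_continuous DF).
  by have := measurableT_comp mF' (measurable_sqr_sum (R := R)); exact.
have mdF : measurable_fun setT (fun q : T2 => dF (q.1 ^+ 2 + q.2 ^+ 2)).
  have mF' : measurable_fun setT dF by exact: continuous_measurable_fun.
  by have := measurableT_comp mF' (measurable_sqr_sum (R := R)); exact.
have mc (x : T2 -> R) : measurable_fun setT x -> measurable_fun setT (c x).
  move=> mx; apply: measurable_funD => //; apply: measurable_funM => //.
  by apply: measurable_funM => //; apply: measurable_funM.
pose B' := B + 2 * (2 * (mu ^+ 2 * C2)).
have B'0 : 0 <= B' by rewrite addr_ge0// mulr_ge0// mulr_ge0// mulr_ge0// sqr_ge0.
have cB (x : T2 -> R) q : `|x q| <= 1 -> disk q -> `|c x q| <= B'.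
  move=> x1 qd; apply: (le_trans (ler_normD _ _)); apply: lerD; first exact: (PB _ (disk_sqr_sum qd)).2.
  rewrite mulrA [x q * _]mulrCA -mulrA normrM ger0_norm// ler_wpM2l//.
  rewrite normrM -[leRHS]mul1r ler_pM//; first by rewrite normrM -[leRHS]mulr1 ler_pM.
  rewrite /dF normrM ger0_norm// ler_wpM2l// normrM ger0_norm ?sqr_ge0// ler_wpM2l ?sqr_ge0//.
  by apply: hC2; exact: disk_sqr_sum.
have c0B q : disk q -> `|c fst q| <= B' by move=> qd; apply: cB => //; exact: sqr_sum_lt1 qd.
have c1B q : disk q -> `|c snd q| <= B'.
  by move=> qd; apply: cB => //; apply: (@sqr_sum_lt1 _ _ q.1); rewrite addrC.
have mc0 := mc _ measurable_fst; have mc1 := mc _ measurable_snd.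
have psiC z := (hC z).1; have psiN z (h : N < z) := (hN z h).1.
have mcyl := @measurable_cylinder R.
(* The test functions do not vanish on the lateral wall, yet no lateral term appears: this is the
   condition u = 0 there. The bottom contributes nothing since its normal is vertical. *)
have e0 := fdata i0 t0; have e1 := fdata i1 t1.
have I0 := integrable_cylinder usq mc0 B'0 c0B N0 C0 mpsi psiC psiN.
have I1 := integrable_cylinder usq mc1 B'0 c1B N0 C0 mpsi psiC psiN.
have J0 := integrable_cylinder (gsq i0) mm1 B0 m1B N0 C0 mpsi psiC psiN.
have J1 := integrable_cylinder (gsq i1) mm2 B0 m2B N0 C0 mpsi psiC psiN.
have I := integrable_cylinder usq mm B0 mB N0 C0 mpsi psiC psiN.
have {}e0 : \int[leb3 R]_(p in @cylinder R) (u p * (c fst p.1 * psi p.2) + g i0 p * (mode1 p.1 * psi p.2)) = 0.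
  transitivity (- (basis3 R i0).2 * \int[leb2 R]_(q in @disk R) (f q * phi0 (q, 0))).
    by rewrite -e0; apply: eq_Rintegral => p; rewrite inE => /in0[-> ->].
  by rewrite [- _](_ : _ = 0) ?mul0r// /basis3/= oppr0.
have {}e1 : \int[leb3 R]_(p in @cylinder R) (u p * (c snd p.1 * psi p.2) + g i1 p * (mode2 p.1 * psi p.2)) = 0.
  transitivity (- (basis3 R i1).2 * \int[leb2 R]_(q in @disk R) (f q * phi1 (q, 0))).
    by rewrite -e1; apply: eq_Rintegral => p; rewrite inE => /in1[-> ->].
  by rewrite [- _](_ : _ = 0) ?mul0r// /basis3/= oppr0.
(* Bessel's equation in the form [bes0_recurrence], with lam^2 = 4 mu. *)
have lap q : c fst q + c snd q = - lam ^+ 2 * mode q.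
  rewrite /c /F /dF /mode /dPhi /Phi bes0_recurrence.
  by rewrite /mu; field.
have E : \int[leb3 R]_(p in @cylinder R) (- lam ^+ 2 * (u p * (mode p.1 * psi p.2))) +
  (\int[leb3 R]_(p in @cylinder R) (g i0 p * (mode1 p.1 * psi p.2)) +
   \int[leb3 R]_(p in @cylinder R) (g i1 p * (mode2 p.1 * psi p.2))) = 0.
  move: e0 e1; rewrite !RintegralD// => e0 e1.
  rewrite (_ : \int[leb3 R]_(p in @cylinder R) (- lam ^+ 2 * (u p * (mode p.1 * psi p.2))) =
    \int[leb3 R]_(p in @cylinder R) (u p * (c fst p.1 * psi p.2)) +
    \int[leb3 R]_(p in @cylinder R) (u p * (c snd p.1 * psi p.2))).
    by rewrite addrACA e0 e1 addr0.
  rewrite -RintegralD//; apply: eq_Rintegral => p _.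
  by rewrite -mulrDr -mulrDl lap; ring.
move: E; rewrite RintegralZl//.
rewrite (integral_slice usq mm B0 mB N0 C0 mpsi psiC psiN).
rewrite (integral_slice (gsq _) mm1 B0 m1B N0 C0 mpsi psiC psiN).
rewrite (integral_slice (gsq _) mm2 B0 m2B N0 C0 mpsi psiC psiN) => E.
have K := locint_mul (locint_slice usq mm B0 mB) mpsi psiC psiN.
have K1 := locint_mul (locint_slice (gsq i0) mm1 B0 m1B) mpsi psiC psiN.
have K2 := locint_mul (locint_slice (gsq i1) mm2 B0 m2B) mpsi psiC psiN.
apply: oppr_inj; rewrite oppr0 -[RHS]E -RintegralZl// -!RintegralD//; last 2 first.
- by have := integrableZl measurableT (- lam ^+ 2) K; exact.
- by have := integrableD measurableT K1 K2; exact.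
rewrite -mulN1r -RintegralZl//; last first.
  have := integrableD measurableT (integrableZl measurableT (lam ^+ 2) K)
    (integrableZl measurableT (-1) (integrableD measurableT K1 K2)).
  apply: eq_integrable => // z _; rewrite /=; congr EFin.
  by rewrite /U /G; ring.
by apply: eq_Rintegral => z _; rewrite /U /G; ring.
Qed.

(* The mode vanishes on the lateral boundary, so cutting it off at distance e from
   there with slope O(1/e) keeps its gradient bounded. *)
Lemma inner_cutoff : exists F_ dF_ : nat -> R -> R, exists2 B, 0 <= B &
  [/\ forall n (s : R), is_derive s 1 (F_ n) (dF_ n s), forall n, continuous (dF_ n),
      forall n, exists2 rho, rho < 1 & forall s, rho < s -> F_ n s = 0,
      forall n s, 0 <= s <= 1 -> `|F_ n s| <= B /\ `|2 * dF_ n s| <= B &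
      forall s, s < 1 -> \forall n \near \oo, F_ n s = Phi s /\ dF_ n s = dPhi s].
Proof.
have [B B0 [_ _ _ [_ _ _ PB]]] := mode_bounds.
pose e (n : nat) : R := n.+1%:R^-1 / 2.
have e0 n : 0 < e n by rewrite divr_gt0// invr_gt0.
have e1 n : e n * 2 <= 1 by rewrite /e divfK// invf_le1// ler1n.
pose S n := step (1 - 2 * e n) (e n); pose dS n := dstep (1 - 2 * e n) (e n).
have cdPhi := is_derive_continuous is_derive_dPhi.
have cPhi := is_derive_continuous is_derive_Phi.
(* The mean value theorem from s to 1, where Phi vanishes because lam is a zero of J_0. *)
have Phi_lip s : 0 <= s <= 1 -> `|Phi s| <= B * (1 - s).
  move=> /andP[s0 s1].
  have [|c /andP[sc c1]] := @MVT_segment _ Phi dPhi s 1 s1 (fun x _ => is_derive_Phi x).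
    exact: continuous_subspaceT.
  rewrite Phi1 sub0r => /(congr1 Num.norm); rewrite normrN => ->.
  rewrite normrM [`|1 - s|]ger0_norm ?subr_ge0// ler_wpM2r ?subr_ge0//.
  move: sc c1; rewrite !bnd_simp => sc c1.
  have [|_] := PB c; first by rewrite (le_trans s0 sc) c1.
  rewrite normrM ger0_norm// => h; apply: le_trans h; by rewrite ler_peMl// ler1n.
(* In the layer s >= 1 - 2 e one has |Phi| <= 2 e B and |dS| <= 2 / e, so |Phi dS| <= 4 B. Doubling
   this and adding |2 dPhi S| <= B gives 9 B. *)
exists (fun n s => Phi s * S n s), (fun n s => dPhi s * S n s + Phi s * dS n s), (9 * B).
  by rewrite mulr_ge0.
split.
- move=> n s; have h1 := is_derive_Phi s; have h2 := is_derive_step (1 - 2 * e n) (e n) s.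
  by apply: is_derive_eq; rewrite /GRing.scale/= /dS; ring.
- move=> n s; apply: cvgD; apply: cvgM; [exact: cdPhi|exact: continuous_step|exact: cPhi|exact: continuous_dstep].
- move=> n; exists (1 - e n); first by have := e0 n; lra.
  by move=> s hs; rewrite /S step0 ?mulr0//; lra.
- move=> n s s01; have [P1 P2] := PB s s01; have S1 : `|S n s| <= 1 by exact: smoothstep_bound.
  split.
    apply: (@le_trans _ _ (B * 1)); first by rewrite normrM; exact: ler_pM.
    by rewrite mulr1 ler_peMl// ler1n.
  have K : `|Phi s * dS n s| <= 4 * B.
    have [hs|hs] := leP s (1 - 2 * e n).
      by rewrite /dS dstep0 ?mulr0 ?normr0 ?mulr_ge0//; left.
    rewrite normrM (@le_trans _ _ ((B * (2 * e n)) * (2 / e n)))//.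
      apply: ler_pM => //; last exact: dstep_bound.
      apply: (le_trans (Phi_lip s s01)); apply: ler_wpM2l => //; lra.
    rewrite le_eqVlt; apply/orP; left; apply/eqP; have := lt0r_neq0 (e0 n) => h; by field.
  rewrite mulrDr mulrA (le_trans (ler_normD _ _))// normrM.
  have : `|2 * dPhi s| * `|S n s| <= B * 1 by rewrite ler_pM.
  rewrite [X in _ + X]normrM [`|2|]ger0_norm//; lra.
- move=> s s1; have s1' : 0 < 1 - s by rewrite subr_gt0.
  near=> n; have hs : s <= 1 - 2 * e n.
    suff : n.+1%:R^-1 < 1 - s.
      move=> h; rewrite /e [2 * _]mulrC divfK//.
      by rewrite lerBrDr addrC -lerBrDr ltW.
    near: n; exact: near_infty_natSinv_lt (PosNum s1').
  by rewrite /S /dS step1// dstep0 ?mulr1 ?mulr0 ?addr0//; left.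
Unshelve. all: end_near. Qed.

Lemma cvg_cylinder (k : T3 -> R) (b_ : nat -> T2 -> R) (b : T2 -> R) (psi : R -> R) (B C N : R) :
  square_integrable (leb3 R) (@cylinder R) k ->
  (forall n, measurable_fun setT (b_ n)) -> 0 <= B ->
  (forall n q, disk q -> `|b_ n q| <= B) ->
  0 <= N -> 0 <= C ->
  measurable_fun setT psi -> (forall z, `|psi z| <= C) -> (forall z, N < z -> psi z = 0) ->
  (forall q, disk q -> \forall n \near \oo, b_ n q = b q) ->
  \int[leb3 R]_(p in @cylinder R) (k p * (b_ n p.1 * psi p.2)) @[n --> \oo] -->
  \int[leb3 R]_(p in @cylinder R) (k p * (b p.1 * psi p.2)).
Proof.
move=> ksq mb B0 bB N0 C0 mpsi psiC psiN bb.
have mk : measurable_fun (@cylinder R) k := ksq.1.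
have c1 (q : T2) : disk q -> `|cst (1 : R) q| <= 1 by rewrite normr1.
have I : (leb3 R).-integrable (@cylinder R) (fun p => (k p * (cst 1 p.1 * cut N p.2))%:E).
  apply: (integrable_cylinder ksq _ ler01 c1 N0 ler01); first exact: measurable_cst.
  - exact: measurable_cut.
  - exact: cut_bound.
  - exact: cut0.
have I' := integrableZl (@measurable_cylinder R) (B * C) (integrable_norm I).
have [|||||_] := @Rdominated_cvg _ _ _ (leb3 R) (@cylinder R)
  (fun n p => k p * (b_ n p.1 * psi p.2)) (fun p => k p * (b p.1 * psi p.2))
  (fun p => B * C * `|k p * (cst 1 p.1 * cut N p.2)|); last exact.
- exact: measurable_cylinder.
- move=> n; apply: measurable_funM => //; apply: measurable_funTS; apply: measurable_funM.
    exact: measurableT_comp (mb n) measurable_fst.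
  exact: measurableT_comp mpsi measurable_snd.
- move=> p [pd _]; apply: (@cvg_near_cst _ _ _ _ _ _); near=> n.
  by have -> : b_ n p.1 = b p.1 by near: n; exact: bb.
- exact: I'.
- move=> n p [pd p0]; rewrite /= mul1r /cut.
  have [pN|Np] := leP p.2 N; last by rewrite psiN// !mulr0 normr0 mulr0.
  rewrite mulr1 normrM mulrC ler_wpM2r// normrM ler_pM//; exact: bB.
Unshelve. all: end_near. Qed.

Variable gamma : R -> R.
Hypothesis mgamma : measurable_fun setT gamma.
Hypothesis gamma_bnd : exists2 K, 0 <= K & forall z, `|gamma z| <= K.
Hypothesis gdiv : forall phi : R * R * R -> R, test_function (@cylinder R) phi ->
  \int[leb3 R]_(p in @cylinder R)
    (gamma p.2 * \sum_(i < 3) g i p * 'D_(basis3 R i) phi p) = 0.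

(** The equation is tested with inner cut-offs of the mode. Their gradients are bounded and
    eventually constant at each point of the disk, so dominated convergence replaces them by the
    mode. *)
Lemma weak_divergence (psi dpsi : R -> R) (a b : R) : 0 < a -> C1_compact psi dpsi a b ->
  \int[leb1 R]_z (gamma z * (G3 z * dpsi z + G z * psi z)) = 0.
Proof.
move=> a0 hpsi; have [C C0 hC] := C1_compact_bounded hpsi.
have hN := C1_compact_support hpsi; have [K K0 hK] := gamma_bnd.
pose N := `|b| + 1; have N0 : 0 <= N by rewrite addr_ge0.
have [B B0 [mm mm1 mm2 [mB m1B m2B _]]] := mode_bounds.
have [F [dF [B' B'0 [DF cdF F0 FB FE]]]] := inner_cutoff.
have [Dpsi cdpsi psi0] := hpsi.
(* The conductivity depends on z alone and is absorbed into the vertical factors, which need only be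
   bounded and measurable. *)
pose ps z := gamma z * psi z; pose dps z := gamma z * dpsi z.
have mps : measurable_fun setT ps.
  apply: measurable_funM => //.
  by apply: continuous_measurable_fun; exact: (is_derive_continuous Dpsi).
have mdps : measurable_fun setT dps.
  by apply: measurable_funM => //; exact: continuous_measurable_fun.
have KC0 : 0 <= K * C by exact: mulr_ge0.
have psC z : `|ps z| <= K * C by rewrite normrM ler_pM// (hC z).1.
have dpsC z : `|dps z| <= K * C by rewrite normrM ler_pM// (hC z).2.
have psN z : N < z -> ps z = 0 by move=> /hN[h _]; rewrite /ps h mulr0.
have dpsN z : N < z -> dps z = 0 by move=> /hN[_ h]; rewrite /dps h mulr0.
pose b0 n (q : T2) : R := q.1 * (2 * dF n (q.1 ^+ 2 + q.2 ^+ 2)).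
pose b1 n (q : T2) : R := q.2 * (2 * dF n (q.1 ^+ 2 + q.2 ^+ 2)).
pose b2 n (q : T2) : R := F n (q.1 ^+ 2 + q.2 ^+ 2).
have mdF n : measurable_fun setT (fun q : T2 => 2 * dF n (q.1 ^+ 2 + q.2 ^+ 2)).
  apply: measurable_funM => //.
  have m : measurable_fun setT (dF n) by exact: continuous_measurable_fun.
  by have := measurableT_comp m (measurable_sqr_sum (R := R)); exact.
have mb0 n : measurable_fun setT (b0 n) by apply: measurable_funM => //; exact: measurable_fst.
have mb1 n : measurable_fun setT (b1 n) by apply: measurable_funM => //; exact: measurable_snd.
have mb2 n : measurable_fun setT (b2 n).
  have m : measurable_fun setT (F n).
    by apply: continuous_measurable_fun; exact: (is_derive_continuous (DF n)).
  by have := measurableT_comp m (measurable_sqr_sum (R := R)); exact.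
have b0B n q : disk q -> `|b0 n q| <= B'.
  move=> qd; rewrite normrM -[leRHS]mul1r ler_pM//; first exact: sqr_sum_lt1 qd.
  exact: (FB n _ (disk_sqr_sum qd)).2.
have b1B n q : disk q -> `|b1 n q| <= B'.
  move=> qd; rewrite normrM -[leRHS]mul1r ler_pM//; first by apply: (@sqr_sum_lt1 _ _ q.1); rewrite addrC.
  exact: (FB n _ (disk_sqr_sum qd)).2.
have b2B n q : disk q -> `|b2 n q| <= B' by move=> qd; exact: (FB n _ (disk_sqr_sum qd)).1.
have E0 q : disk q -> \forall n \near \oo, b0 n q = mode1 q.
  by move=> /FE; apply: filterS => n [_]; rewrite /b0 => ->.
have E1 q : disk q -> \forall n \near \oo, b1 n q = mode2 q.
  by move=> /FE; apply: filterS => n [_]; rewrite /b1 => ->.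
have E2 q : disk q -> \forall n \near \oo, b2 n q = mode q.
  by move=> /FE; apply: filterS => n [F1 _]; rewrite /b2 F1.
have L0 := cvg_cylinder (gsq i0) mb0 B'0 b0B N0 KC0 mps psC psN E0.
have L1 := cvg_cylinder (gsq i1) mb1 B'0 b1B N0 KC0 mps psC psN E1.
have L2 := cvg_cylinder (gsq i2) mb2 B'0 b2B N0 KC0 mdps dpsC dpsN E2.
have mcyl := @measurable_cylinder R.
have Z n : \int[leb3 R]_(p in @cylinder R) (g i0 p * (b0 n p.1 * ps p.2)) +
   \int[leb3 R]_(p in @cylinder R) (g i1 p * (b1 n p.1 * ps p.2)) +
   \int[leb3 R]_(p in @cylinder R) (g i2 p * (b2 n p.1 * dps p.2)) = 0.
  have [rho rho1 Frho] := F0 n.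
  have D1 (x : R) : is_derive x 1 (cst (1 : R)) (cst 0 x) by exact: is_derive_cst.
  have ccst (c : R) : continuous (fun _ : R => c) by exact: cst_continuous.
  pose phi := prod_fun (cst 1) (cst 1) (F n) psi.
  have tphi : test_function (@cylinder R) phi.
    apply: (test_function_prod D1 D1 (DF n) (ccst 0) (ccst 0) (cdF n) hpsi Frho).
    move=> p prho /andP[ap _]; split; first exact: le_lt_trans prho rho1.
    exact: lt_le_trans ap.
  have J0 := integrable_cylinder (gsq i0) (mb0 n) B'0 (b0B n) N0 KC0 mps psC psN.
  have J1 := integrable_cylinder (gsq i1) (mb1 n) B'0 (b1B n) N0 KC0 mps psC psN.
  have J2 := integrable_cylinder (gsq i2) (mb2 n) B'0 (b2B n) N0 KC0 mdps dpsC dpsN.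
  rewrite -RintegralD// -RintegralD//; last by have := integrableD mcyl J0 J1; exact.
  rewrite -[RHS](gdiv tphi); apply: eq_Rintegral => p _.
  rewrite !big_ord_recl big_ord0.
  have h i := is_derive_prod_fun i p D1 D1 (DF n) Dpsi.
  have Di i : 'D_(basis3 R i) phi p = _ := @derive_val _ _ _ _ _ _ _ (h i).
  rewrite !Di /dprod_fun /b0 /b1 /b2 /ps /dps.
  case: p {h Di} => -[x y] z /=.
  have -> : ord0 = i0 by exact: val_inj.
  have -> : lift i0 ord0 = i1 by exact: val_inj.
  have -> : lift i0 (lift ord0 ord0) = i2 by exact: val_inj.
  by ring.
have : 0 = lim ((fun n : nat => (0 : R)) @ \oo) by rewrite lim_cst.
rewrite -(_ : (fun n => \int[leb3 R]_(p in @cylinder R) (g i0 p * (b0 n p.1 * ps p.2)) +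
   \int[leb3 R]_(p in @cylinder R) (g i1 p * (b1 n p.1 * ps p.2)) +
   \int[leb3 R]_(p in @cylinder R) (g i2 p * (b2 n p.1 * dps p.2))) = (fun n : nat => (0 : R))); last first.
  by apply/funext => n; exact: Z.
rewrite (cvg_lim _ (cvgD (cvgD L0 L1) L2))//.
rewrite (integral_slice (gsq _) mm1 B0 m1B N0 KC0 mps psC psN).
rewrite (integral_slice (gsq _) mm2 B0 m2B N0 KC0 mps psC psN).
rewrite (integral_slice (gsq _) mm B0 mB N0 KC0 mdps dpsC dpsN) => E.
have K1 := locint_mul (locint_slice (gsq i0) mm1 B0 m1B) mps psC psN.
have K2 := locint_mul (locint_slice (gsq i1) mm2 B0 m2B) mps psC psN.
have K3 := locint_mul (locint_slice (gsq i2) mm B0 mB) mdps dpsC dpsN.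
rewrite [RHS]E -RintegralD// -RintegralD//; last by have := integrableD measurableT K1 K2; exact.
by apply: eq_Rintegral => z _; rewrite /ps /dps /G /G3; ring.
Qed.

Lemma radial_mode_ratio (h s1 s2 d : R) (w : R -> R) : 0 < h -> 0 < s1 -> 0 < s2 ->
  gamma = gam h s1 s2 ->
  {within `[0, +oo[, continuous w} -> {ae leb1 R, forall z, 0 < z -> w z = U z} ->
  (w t - w 0) / t @[t --> 0^'+] --> d ->
  (lam * \int[leb2 R]_(q in @disk R) (mode q ^+ 2) + d) * expR (lam * h) * (s1 + s2) =
  (lam * \int[leb2 R]_(q in @disk R) (mode q ^+ 2) - d) * expR (- (lam * h)) * (s2 - s1).
Proof.
move=> h0 s10 s20 gammaE cw aew dw.
have [B B0 [mm mm1 mm2 [mB m1B m2B _]]] := mode_bounds.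
have Ui := locint_slice usq mm B0 mB; have G3i := locint_slice (gsq i2) mm B0 mB.
have K1 := locint_slice (gsq i0) mm1 B0 m1B; have K2 := locint_slice (gsq i1) mm2 B0 m2B.
have Gi : locint G.
  move=> N; have mI : measurable (`]-oo, N]%classic : set (measurableTypeR R)) by exact: measurable_itv.
  by have := integrableD mI (K1 N) (K2 N); exact.
pose E (k : T3 -> R) := \int[leb3 R]_p (ext k p ^+ 2).
have E0 k : 0 <= E k by apply: Rintegral_ge0 => p _; exact: sqr_ge0.
(* The two growth bounds add up to B (8 N + E u + E (g i2)), with 8 twice the constant of the box;
   this is at most the stated constant times 1 + N. *)
apply: (@mode_ratio R lam s1 s2 h _ d (B * (8 + E u + E (g i2))) U G G3 w) => //.
- by move=> z z0; exact: slice0.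
- by move=> z z0; rewrite /G !slice0// addr0.
- by move=> z z0; exact: slice0.
- by move=> psi dpsi a b; exact: weak_vertical.
- by move=> psi dpsi a b a0 hpsi; rewrite -gammaE; exact: weak_divergence hpsi.
- by move=> psi dpsi a b; exact: weak_radial.
- move=> N N0; have N0' := ltW N0.
  have mI : measurable (`]-oo, N]%classic : set (measurableTypeR R)) by exact: measurable_itv.
  rewrite RintegralD//; last 2 first.
  + by have := integrable_norm (Ui N); exact.
  + by have := integrable_norm (G3i N); exact.
  have := slice_growth usq mm B0 mB N0'; have := slice_growth (gsq i2) mm B0 mB N0'.
  rewrite -/(E u) -/(E (g i2)) -/U -/G3 => h1 h2.
  apply: (le_trans (lerD h2 h1)); rewrite -mulrDr -mulrA; apply: ler_wpM2l => //.
  rewrite -subr_ge0.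
  rewrite (_ : _ - _ = 8 + (E u + E (g i2)) * N); last by ring.
  by rewrite addr_ge0// mulr_ge0// addr_ge0.
Qed.

End reduction.

(** * Polar coordinates *)

Section polar.
Variable R : realType.
Local Notation T2 := (measurableTypeR R * measurableTypeR R)%type.

(** c times the image of Lebesgue measure under x |-> c x agrees with Lebesgue measure on half-open
    intervals, hence on all measurable sets. *)
Lemma ge0_integral_scale (c : R) (f : R -> \bar R) : 0 < c ->
  measurable_fun [set: measurableTypeR R] f -> (forall x, (0 <= f x)%E) ->
  (\int[leb1 R]_x f (c * x)%R = c^-1%:E * \int[leb1 R]_x f x)%E.
Proof.
move=> c0 mf f0; have c0' := lt0r_neq0 c0.
pose phi (x : measurableTypeR R) : measurableTypeR R := c * x.
have mphi : measurable_fun setT phi by exact: measurable_funM.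
pose phi_mixin := isMeasurableFun.Build _ _ _ _ _ mphi.
pose phi' : {mfun measurableTypeR R >-> measurableTypeR R} := HB.pack phi phi_mixin.
have scale A : measurable A -> leb1 R A = mscale (NngNum (ltW c0)) (pushforward (leb1 R) phi') A.
  apply: lebesgue_measure_unique => _ [[a b] _ <-].
  pose I : set (measurableTypeR R) := `]a / c, b / c]%classic.
  transitivity (c%:E * leb1 R I)%E.
    rewrite /= !lebesgue_measure_itv/= !lte_fin ltr_pM2r ?invr_gt0//.
    case: ifP => _; last by rewrite mule0.
    by rewrite -!EFinB -EFinM; congr EFin; field.
  congr (_ * leb1 R _)%E; rewrite /I.
  by apply/seteqP; split => x /=; rewrite !in_itv/= /phi ltr_pdivrMr// ler_pdivlMr// mulrC.
have -> : (\int[leb1 R]_x f x = c%:E * \int[leb1 R]_x f (c * x)%R)%E.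
  have <- := @ge0_integral_pushforward _ _ _ _ R phi mphi (leb1 R) setT f measurableT mf (fun x _ => f0 x).
  have := @ge0_integral_mscale _ _ R (pushforward (leb1 R) phi') setT measurableT (NngNum (ltW c0)) f mf (fun x _ => f0 x).
  move=> /= <-; apply: eq_measure_integral => A mA _; exact: scale.
by rewrite muleA -EFinM mulVf// mul1e.
Qed.

Lemma ge0_integral_even (f : R -> \bar R) :
  measurable_fun [set: measurableTypeR R] f -> (forall x, (0 <= f x)%E) ->
  (forall x, f (- x)%R = f x) ->
  (\int[leb1 R]_x f x = 2%:E * \int[leb1 R]_(x in `[0%R, +oo[) f x)%E.
Proof.
move=> mf f0 fN.
have mfs (D : set (measurableTypeR R)) : measurable_fun D f by exact: measurable_funTS.
have -> : [set: measurableTypeR R] = `]-oo, 0%R[%classic `|` `[0%R, +oo[%classic.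
  by apply/seteqP; split => x //= _; rewrite !in_itv/= andbT; case: (ltP x 0); [left|right].
rewrite ge0_integral_setU//=.
- have -> : (\int[leb1 R]_(x in `]-oo, 0%R[) f x = \int[leb1 R]_(x in `[0%R, +oo[) f x)%E.
    rewrite ge0_integration_by_substitution0// (integral_itv_bndo_bndc (mfs _)).
    by apply: eq_integral => x _; rewrite fN.
  by rewrite -mule2n mule_natl.
- by apply/disj_setPS => x /=; rewrite !in_itv/= andbT => -[x0]; rewrite leNgt x0.
Qed.

Lemma integral_oneDsqr : (\int[leb1 R]_t (1 + t ^+ 2)^-1%:E = pi%:E)%E.
Proof.
rewrite (@ge0_integral_even (fun t => (1 + t ^+ 2)^-1%:E)).
- by rewrite integral0y_oneDsqr -EFinM mulrCA divff ?mulr1// pnatr_eq0.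
- apply/measurable_EFinP; apply: continuous_measurable_fun; exact: continuous_oneDsqrV.
- by move=> t; rewrite lee_fin invr_ge0 addr_ge0// sqr_ge0.
- by move=> t; rewrite sqrrN.
Qed.

Lemma measurable_abs_mul (g : T2 -> \bar R) : measurable_fun setT g ->
  measurable_fun setT (fun p : T2 => (g (p.1, `|p.1| * p.2)%R * `|p.1|%:E)%E).
Proof.
move=> mg; have mabs : measurable_fun setT (fun p : T2 => `|p.1|).
  by apply: measurableT_comp => //; exact: measurable_fst.
apply: emeasurable_funM; last exact/measurable_EFinP.
have m : measurable_fun setT (fun p : T2 => (p.1, `|p.1| * p.2) : T2).
  apply/measurable_fun_pairP; split; first exact: measurable_fst.
  by apply: measurable_funM => //; exact: measurable_snd.
exact: (measurableT_comp mg m).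
Qed.

(** No angle is used. With y = |x| t the radius is |x| sqrt (1 + t^2), and rescaling x splits off 1
    / (1 + t^2), whose integral is pi; the factor 2 comes from the symmetry x |-> - x. *)
Lemma ge0_integral_polar (f : R -> \bar R) :
  measurable_fun setT (fun q : T2 => f (Defs.radius q)) -> (forall r, (0 <= f r)%E) ->
  (\int[leb2 R]_q f (Defs.radius q) = (2 * pi)%:E * \int[leb1 R]_(r in `[0%R, +oo[) (f r * r%:E))%E.
Proof.
move=> mf f0.
(* On each vertical line substitute y = |x| t, then integrate in x first. *)
pose G (p : T2) := (f (Defs.radius (p.1, `|p.1| * p.2)%R) * `|p.1|%:E)%E.
have mG : measurable_fun setT G := measurable_abs_mul mf.
have G0 p : (0 <= G p)%E by rewrite mule_ge0// lee_fin.
pose H (x : R) := (f `|x|%R * `|x|%:E)%E.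
have mH : measurable_fun [set: measurableTypeR R] H.
  apply: emeasurable_funM; last by apply/measurable_EFinP; exact: normr_measurable.
  have m : measurable_fun setT (fun x : measurableTypeR R => f (Defs.radius (x, 0))).
    have := measurableT_comp mf (pair2_measurable (0 : measurableTypeR R)); exact.
  by move: m; congr measurable_fun; apply/funext => x; rewrite /Defs.radius/= expr0n addr0 sqrtr_sqr.
have H0 x : (0 <= H x)%E by rewrite mule_ge0// lee_fin.
rewrite (@fubini_tonelli1 _ _ _ _ R (leb1 R) (leb1 R) (fun q : T2 => f (Defs.radius q)) mf (fun q => f0 (Defs.radius q))).
transitivity (\int[leb1 R]_x \int[leb1 R]_t G (x, t))%E.
  apply: ae_eq_integral => //.
  - have := @measurable_fun_fubini_tonelli_F _ _ _ _ R (leb1 R)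
      (fun q : T2 => f (Defs.radius q)) mf (fun q => f0 (Defs.radius q)).
    exact.
  - by have := @measurable_fun_fubini_tonelli_F _ _ _ _ R (leb1 R) G mG G0; exact.
  (* On the line x = 0 the substitution degenerates; that line is negligible. *)
  - exists [set 0]; split; [exact: measurable_set1|exact: lebesgue_measure_set1|].
    move=> x /= nx; apply: contrapT => /eqP x0; apply: nx => _.
    have ax0 : 0 < `|x| by rewrite normr_gt0.
    rewrite /fubini_F.
    have mfx : measurable_fun [set: measurableTypeR R] (fun y => f (Defs.radius (x, y))).
      by have := measurableT_comp mf (pair1_measurable (x : measurableTypeR R)); exact.
    have Es := ge0_integral_scale ax0 mfx (fun y => f0 _).
    have mx : measurable_fun setT (fun t : measurableTypeR R => `|x| * t) by exact: measurable_funM.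
    have mfxx : measurable_fun setT (fun t : measurableTypeR R => f (Defs.radius (x, `|x| * t))).
      by have := measurableT_comp mfx mx; exact.
    rewrite /G /= (@ge0_integralZr _ _ _ (leb1 R) setT measurableT _ mfxx)//.
    by rewrite Es muleC muleA -EFinM mulfV ?mul1e// gt_eqF.
rewrite (@fubini_tonelli _ _ _ _ R (leb1 R) (leb1 R) G mG G0).
transitivity (\int[leb1 R]_t ((1 + t ^+ 2)^-1%:E * \int[leb1 R]_x H x))%E.
  apply: eq_integral => t _.
  have t0 : 0 < 1 + t ^+ 2 by rewrite ltr_pwDl// sqr_ge0.
  pose c := Num.sqrt (1 + t ^+ 2); have c0 : 0 < c by rewrite sqrtr_gt0.
  have cc : c^-1 * c^-1 = (1 + t ^+ 2)^-1 by rewrite -invfM -expr2 sqr_sqrtr// ltW.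
  rewrite -cc EFinM -muleA -(ge0_integral_scale c0 mH H0).
  rewrite -ge0_integralZl//; last 2 first.
  - have mc : measurable_fun setT (fun x : measurableTypeR R => c * x) by exact: measurable_funM.
    by have := measurableT_comp mH mc; exact.
  - by rewrite lee_fin invr_ge0 ltW.
  apply: eq_integral => x _; rewrite /G /H /=.
  have -> : Defs.radius (x, `|x| * t) = `|c * x|.
    rewrite /Defs.radius/= exprMn real_normK ?num_real// normrM (ger0_norm (ltW c0)).
    by rewrite -sqrtr_sqr -sqrtrM ?ltW//; congr Num.sqrt; ring.
  by rewrite muleCA -EFinM normrM (ger0_norm (ltW c0)) mulKf// lt0r_neq0.
rewrite ge0_integralZr//; last 3 first.
- by apply/measurable_EFinP; apply: continuous_measurable_fun; exact: continuous_oneDsqrV.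
- by move=> t _; rewrite lee_fin invr_ge0 addr_ge0// sqr_ge0.
- exact: integral_ge0.
rewrite integral_oneDsqr (ge0_integral_even mH H0); last by move=> x; rewrite /H normrN.
rewrite muleA -EFinM [pi * 2]mulrC; congr (_ * _)%E.
by apply: eq_integral => x; rewrite inE/= in_itv/= andbT => x0; rewrite /H ger0_norm.
Qed.

Lemma fine_muleBr (k : R) (x y : \bar R) : x \is a fin_num -> y \is a fin_num ->
  fine (k%:E * x - k%:E * y)%E = k * fine (x - y)%E.
Proof. by case: x y => [x||] [y||]//= _ _; ring. Qed.

(** Positive and negative parts are treated separately; finiteness of the plane integrals passes to
    the radial ones, so the difference is legitimate. *)
Lemma Rintegral_polar (f : R -> R) :
  (leb2 R).-integrable setT (fun q : T2 => (f (Defs.radius q))%:E) ->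
  \int[leb2 R]_q f (Defs.radius q) = 2 * pi * \int[leb1 R]_(r in `[0%R, +oo[) (f r * r).
Proof.
move=> fi; pose F := EFin \o f.
pose P r := maxe (F r) 0%E; pose N r := maxe (- F r)%E 0%E.
have P0 r : (0 <= P r)%E by rewrite /P le_max lexx orbT.
have N0 r : (0 <= N r)%E by rewrite /N le_max lexx orbT.
have mF : measurable_fun setT (fun q : T2 => F (Defs.radius q)) := measurable_int _ fi.
have mP : measurable_fun setT (fun q : T2 => P (Defs.radius q)).
  by apply: measurable_maxe => //; exact: measurable_cst.
have mN : measurable_fun setT (fun q : T2 => N (Defs.radius q)).
  by apply: measurable_maxe; [exact: measurableT_comp mF|exact: measurable_cst].
have EP : (\int[leb2 R]_q P (Defs.radius q) = \int[leb2 R]_q (fun q : T2 => (f (Defs.radius q))%:E)^\+ q)%E.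
  by apply: eq_integral => q _; rewrite funeposE.
have EN : (\int[leb2 R]_q N (Defs.radius q) = \int[leb2 R]_q (fun q : T2 => (f (Defs.radius q))%:E)^\- q)%E.
  by apply: eq_integral => q _; rewrite funenegE.
have Pfin : (\int[leb2 R]_q P (Defs.radius q))%E \is a fin_num.
  by rewrite EP; exact: integrable_pos_fin_num.
have Nfin : (\int[leb2 R]_q N (Defs.radius q))%E \is a fin_num.
  by rewrite EN; exact: integrable_neg_fin_num.
have pi20 : 0 < 2 * pi :> R by rewrite mulr_gt0// pi_gt0.
rewrite /Rintegral integralE -EP -EN.
move: Pfin Nfin; rewrite !ge0_integral_polar// => Pfin Nfin.
have fin_of (x : \bar R) : (0 <= x)%E -> ((2 * pi)%:E * x)%E \is a fin_num -> x \is a fin_num.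
  by case: x => //= _; rewrite mulry gtr0_sg// mul1e.
have I0 (g : R -> \bar R) : (forall r, 0 <= g r)%E ->
   (0 <= \int[leb1 R]_(r in `[0%R, +oo[) (g r * r%:E))%E.
  by move=> g0; apply: integral_ge0 => r /=; rewrite in_itv/= andbT => r0; rewrite mule_ge0.
have {}Pfin := fin_of _ (I0 _ P0) Pfin; have {}Nfin := fin_of _ (I0 _ N0) Nfin.
rewrite fine_muleBr//; congr (_ * fine _).
rewrite [RHS]integralE; congr (_ - _)%E; apply: eq_integral => r; rewrite inE/= in_itv/= andbT => r0.
- by rewrite funeposE /P /F/= -!EFin_max -EFinM maxr_pMl// mul0r.
- by rewrite funenegE /N /F/= -!EFin_max -EFinM maxr_pMl// mul0r mulNr.
Qed.

End polar.

(** * Reconstruction *)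

Section bridge.
Variable R : realType.
Local Notation T2 := (measurableTypeR R * measurableTypeR R)%type.
Local Notation T3 := (measurableTypeR R * measurableTypeR R * measurableTypeR R)%type.
Variables (lambda : nat -> R) (n : nat).
Hypothesis lambda0 : 0 < lambda n.
Hypothesis Jlambda : besselJ 0 (lambda n) = 0.

Let mode (q : T2) : R := bes 0 ((lambda n / 2) ^+ 2 * (q.1 ^+ 2 + q.2 ^+ 2)).
(** The squared norm of the mode on the disk. It combines the factor 2 pi of polar coordinates with
    the normalisation 2 / J_1^2 of the Fourier-Bessel coefficient. *)
Let K : R := pi * besselJ 1 (lambda n) ^+ 2.

Lemma modeE q : mode q = besselJ 0 (lambda n * Defs.radius q).
Proof.
rewrite besselJE expr0 mul1r /mode; congr (bes 0 _).
by rewrite /Defs.radius !expr_div_n exprMn sqr_sqrtr ?addr_ge0 ?sqr_ge0//; field.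
Qed.

Lemma disk_radius (q : T2) : disk q <-> Defs.radius q < 1.
Proof.
rewrite /disk/= /Defs.radius -{2}(sqrtr1 R) ltr_sqrt//.
Qed.

Lemma disk_bessel_coef (v : R -> R) (F : T2 -> R) :
  (forall q, disk q -> F q = v (Defs.radius q) * mode q) -> (forall q, ~ disk q -> F q = 0) ->
  (leb2 R).-integrable setT (EFin \o F) ->
  \int[leb2 R]_q F q = K * bessel_coef lambda v n.
Proof.
move=> Fin Fout Fi.
pose f r := if r < 1 then v r * besselJ 0 (lambda n * r) else 0.
have FE q : F q = f (Defs.radius q).
  rewrite /f; case: ifPn => [/disk_radius qd|/negP nq]; first by rewrite Fin// modeE.
  by rewrite Fout// => /disk_radius.
have fi : (leb2 R).-integrable setT (fun q : T2 => (f (Defs.radius q))%:E).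
  by apply: eq_integrable Fi => // q _; rewrite /= FE.
have -> : \int[leb2 R]_q F q = \int[leb2 R]_q f (Defs.radius q).
  by apply: eq_Rintegral => q _; rewrite FE.
rewrite (Rintegral_polar fi).
have -> : \int[leb1 R]_(r in `[0, +oo[) (f r * r) =
    \int[leb1 R]_(r in `]0, 1[) (v r * besselJ 0 (lambda n * r) * r).
  rewrite (@Rintegral_support _ _ _ (leb1 R) `[0, +oo[%classic `]0, 1[%classic).
  - by apply: eq_Rintegral => r; rewrite inE/= in_itv/= /f => /andP[_ ->].
  - by move=> r /=; rewrite !in_itv/= andbT => /andP[/ltW].
  - move=> r /=; rewrite !in_itv/= andbT /f => r0 /negP; rewrite negb_and -leNgt => /orP[r0'|nr].
      by have -> : r = 0 by [apply/le_anti; rewrite r0' r0]; rewrite mulr0.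
    by rewrite (negbTE nr) mul0r.
rewrite /bessel_coef /K; have := besselJ_zero1 lambda0 Jlambda => J1.
by field.
Qed.

End bridge.

(** The antiderivative is explicit, and at r = 1 only its J_1 term survives because J_0 (lam) =
    0. *)
Lemma integral_besselJ0_sqr (R : realType) (lam : R) : besselJ 0 lam = 0 ->
  (leb1 R).-integrable `]0, 1[ (fun r => (besselJ 0 (lam * r) * (besselJ 0 (lam * r) * r))%:E) /\
  \int[leb1 R]_(r in `]0, 1[) (besselJ 0 (lam * r) * (besselJ 0 (lam * r) * r)) =
  besselJ 1 lam ^+ 2 / 2.
Proof.
move=> Jlam; pose mu := (lam / 2) ^+ 2.
have JE r : besselJ 0 (lam * r) = bes 0 (mu * r ^+ 2).
  by rewrite besselJE expr0 mul1r /mu -exprMn; congr (bes 0 (_ ^+ 2)); ring.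
have Db m (r : R) : is_derive r 1 (fun r => bes m (mu * r ^+ 2)) (- mu * bes m.+1 (mu * r ^+ 2) * (2 * r)).
  have h1 : is_derive r 1 (fun r : R => r ^+ 2) (2 * r).
    by apply: is_derive_eq; rewrite /GRing.scale/=; ring.
  by have := @is_derive1_comp _ (fun s : R => bes m (mu * s)) (fun r : R => r ^+ 2) r _ _
    (is_derive_bes_scale m mu (r ^+ 2)) h1.
(* Q is the classical antiderivative r^2 (J_0 (lam r)^2 + J_1 (lam r)^2) / 2. *)
pose Q (r : R) := r ^+ 2 / 2 * (bes 0 (mu * r ^+ 2) ^+ 2 + mu * r ^+ 2 * bes 1 (mu * r ^+ 2) ^+ 2).
pose F (r : R) := besselJ 0 (lam * r) * (besselJ 0 (lam * r) * r).
have DQ (r : R) : is_derive r 1 Q (F r).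
  have h0 := Db 0 r; have h1 := Db 1 r; rewrite /F !JE; apply: is_derive_eq.
  by rewrite /GRing.scale/= bes0_recurrence; field.
have cF : continuous F.
  have cb : continuous (fun r : R => bes 0 (mu * r ^+ 2)) := is_derive_continuous (Db 0).
  rewrite (_ : F = fun r => bes 0 (mu * r ^+ 2) * (bes 0 (mu * r ^+ 2) * r)); last first.
    by apply/funext => r; rewrite /F JE.
  by move=> r; apply: cvgM; [exact: cb|apply: cvgM; [exact: cb|exact: cvg_id]].
have iF : (leb1 R).-integrable `[0, 1] (EFin \o F).
  apply: continuous_compact_integrable; first exact: segment_compact.
  exact: continuous_subspaceT.
have iF' (i : interval R) : [set` i] `<=` `[0, 1] -> measurable ([set` i] : set (measurableTypeR R)) ->
    (leb1 R).-integrable [set` i] (EFin \o F).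
  by move=> i01 mi; apply: integrableS iF.
have i1 : (leb1 R).-integrable `]0, 1[ (EFin \o F).
  by apply: iF' => // r; rewrite /= !in_itv/= => /andP[/ltW -> /ltW ->].
split; first exact: i1.
rewrite -/F (@Rintegral_itv_bndo_bndc _ _ _ F)// Rintegral_itv_obnd_cbnd; last first.
  by apply: iF' => // r; rewrite /= !in_itv/= => /andP[/ltW -> ->].
rewrite /Rintegral (@continuous_FTC2 _ F Q)//.
- rewrite /Q /= besselJE expr1 -/mu !expr1n !mulr1.
  have -> : bes 0 mu = 0 by move: Jlam; rewrite -[lam]mulr1 JE expr1n mulr1.
  by rewrite exprMn -/mu; field.
- exact: continuous_subspaceT.
- split.
  + by move=> r _; have := DQ r; case.
  + apply: cvg_at_right_filter; exact: (is_derive_continuous DQ).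
  + apply: cvg_at_left_filter; exact: (is_derive_continuous DQ).
- by move=> r _; rewrite derive1E; have h := DQ r; rewrite derive_val.
Qed.

Lemma bessel_coef_mode (R : realType) (lambda : nat -> R) (c : R) (n : nat) :
  0 < lambda n -> besselJ 0 (lambda n) = 0 ->
  bessel_coef lambda (fun r => c * besselJ 0 (lambda n * r)) n = c.
Proof.
move=> l0 J0; have [i e] := integral_besselJ0_sqr J0.
rewrite /bessel_coef; under eq_Rintegral do rewrite -!mulrA.
rewrite RintegralZl// e; have := besselJ_zero1 l0 J0 => J1.
by field.
Qed.

(** Membership in the class only provides some parameters with the required bounds; evaluation at h
    and at 0 identifies them with the given ones. *)
Lemma conductivity_inj (R : realType) (h a1 a2 b1 b2 : R) : 0 < h ->
  conductivity h a1 a2 = conductivity h b1 b2 -> a1 = b1 /\ a2 = b2.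
Proof.
move=> h0 e; split.
  by move: (congr1 (fun k => k h) e); rewrite /conductivity lexx => /addrI.
by move: (congr1 (fun k => k 0) e); rewrite /conductivity leNgt h0/= => /addrI.
Qed.

(** The slice of the solution has trace K and derivative K d at the bottom, where the eigenvalue
    equation reads a lam = - (1 + a2) d. Substituting d in the mode identity and cancelling lam K
    gives the claim. *)
Lemma DtN_eigenvalue (R : realType) (h a1 a2 a : R) (lambda : nat -> R) (n : nat) :
  0 < h -> 0 <= a1 -> 0 <= a2 -> 0 < lambda n -> besselJ 0 (lambda n) = 0 ->
  DtN lambda h a1 a2 (fun r => besselJ 0 (lambda n * r))
    (bessel_coef lambda (fun r => a * lambda n * besselJ 0 (lambda n * r))) ->
  (1 + a2 - a) * expR (lambda n * h) * (2 + a1 + a2) =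
  (1 + a2 + a) * expR (- (lambda n * h)) * (a2 - a1).
Proof.
move=> h0 a10 a20 l0 J0 [_ _ [v [[g [[usq _ gsq] gdiv gdata]] /(_ n)[d [w [cw aew dw]] cd]]]].
have J1 := besselJ_zero1 l0 J0.
pose lam := lambda n; pose mode (q : R * R) : R := bes 0 ((lam / 2) ^+ 2 * (q.1 ^+ 2 + q.2 ^+ 2)).
pose K : R := pi * besselJ 1 lam ^+ 2.
have K0 : 0 < K by rewrite mulr_gt0 ?pi_gt0// exprn_even_gt0.
have [B B0 [mm _ _ [mB _ _ _]]] := mode_bounds lam.
have U0 : \int[leb2 R]_(q in @disk R) (mode q ^+ 2) = K.
  rewrite Rintegral_mkcond (@disk_bessel_coef _ _ _ l0 J0 (fun r => 1 * besselJ 0 (lambda n * r))).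
  - by rewrite bessel_coef_mode// mulr1.
  - by move=> q qd; rewrite patchE mem_set// mul1r -modeE.
  - by move=> q qd; rewrite patchE memNset.
  - have /integrable_mkcond := integrable_mode_sqr lam => /(_ (@measurable_disk R)).
    by apply: eq_integrable => // q _; rewrite /= !patchE; case: ifP.
(* [w] represents the Fourier-Bessel coefficient, while the mode identity concerns integrals over
   the disk; on almost every slice they differ by the factor K. *)
have aeU : {ae leb1 R, forall z, 0 < z -> K * w z = slice (radial3 v) mode z}.
  have aeF := ae_filter_ringOfSetsType (leb1 R).
  apply: filterS2 aew (ae_integrable_slice usq mm B0 mB) => z wz iz z0.
  rewrite wz// /slice (@disk_bessel_coef _ _ _ l0 J0 (v^~ z))//.
  - by move=> q qd; rewrite /ext patchE mem_set.
  - by move=> q qd; rewrite ext0 ?mul0r// => -[].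
have cw' : {within `[0, +oo[, continuous (fun z => K * w z)}.
  by move=> z; apply: cvgMl_tmp; exact: cw.
have dw' : (K * w t - K * w 0) / t @[t --> 0^'+] --> K * d.
  under eq_fun do rewrite -mulrBr -mulrA.
  by apply: cvgMl_tmp; exact: dw.
have s10 : 0 < 1 + a1 by rewrite ltr_pwDl.
have s20 : 0 < 1 + a2 by rewrite ltr_pwDl.
have fmode q : disk q -> radial2 (fun r => besselJ 0 (lam * r)) q = mode q.
  by move=> _; rewrite /mode modeE.
have mgam : measurable_fun setT (conductivity h a1 a2).
  exact: (@measurable_gam R h (1 + a1) (1 + a2)).
have gamB : exists2 k, 0 <= k & forall z, `|conductivity h a1 a2 z| <= k.
  exists (`|1 + a1| + `|1 + a2|); first by rewrite addr_ge0.
  by move=> z; exact: (gam_bound h (1 + a1) (1 + a2) z).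
have := @radial_mode_ratio R lam l0 J0 (radial3 v) g _ usq gsq gdata fmode
  _ mgam gamB gdiv h (1 + a1) (1 + a2) (K * d) _ h0 s10 s20 erefl cw' aeU dw'.
rewrite U0; move: cd; rewrite bessel_coef_mode// -/lam => cd E.
have lK : lam * K != 0 by rewrite mulf_neq0// gt_eqF.
have Kd : (1 + a2) * (K * d) = - (a * (lam * K)).
  by rewrite mulrCA -[(1 + a2) * d]opprK -mulNr -cd; ring.
have Kp : (1 + a2) * (lam * K + K * d) = lam * K * (1 + a2 - a) by rewrite mulrDr Kd; ring.
have Km : (1 + a2) * (lam * K - K * d) = lam * K * (1 + a2 + a) by rewrite mulrBr Kd; ring.
apply: (mulfI lK); transitivity ((1 + a2) * ((lam * K + K * d) * expR (lam * h) * (1 + a1 + (1 + a2)))).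
  by rewrite [RHS]mulrA [X in _ = X * _]mulrA Kp -/lam; ring.
by rewrite E [LHS]mulrA [X in X * _ = _]mulrA Km -/lam; ring.
Qed.

Theorem proposition3p2 (R : realType) (h M alpha1 alpha2 : R)
    (lambda A : nat -> R) :
  0 < h -> 0 < M ->
  conductivity_class h M (conductivity h alpha1 alpha2) ->
  positive_zeros_J0 lambda ->
  (forall n : nat,
     DtN lambda h alpha1 alpha2 (fun r => besselJ 0 (lambda n * r))
       (bessel_coef lambda
          (fun r => A n * lambda n * besselJ 0 (lambda n * r)))) ->
  A 0%N != 1 + alpha2 ->
  let quotient := fun n : nat =>
    (A n - 1 - alpha2) / (A n.+1 - 1 - alpha2) in
  let scaled := fun n : nat =>
    (A n - 1 - alpha2) * expR (2 * lambda n * h) / (1 + alpha2) in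
  let Alim := limn scaled in
  [/\ cvgn A /\ alpha2 = limn A - 1,
      cvgn quotient /\ h = 1 / (2 * pi) * ln (limn quotient) &
      [/\ cvgn scaled, 2 - Alim != 0 &
          alpha1 = (2 * Alim + (Alim + 2) * alpha2) / (2 - Alim)]].
Proof.
move=> h0 _ [b1 [b2 [/andP[b10 _] /andP[b20 _] /(conductivity_inj h0)[e1 e2]]]].
rewrite -{}e1 in b10; rewrite -{}e2 in b20.
move=> zl dtn A0; apply: reconstruction => // n.
have : range lambda (lambda n) by exists n.
by rewrite zl.2 => -[l0 J0]; exact: DtN_eigenvalue (dtn n).
Qed.
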